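(* Let $\lambda>0$ and $\alpha>0$. Let $\{c_k\}_{k\ge1}$ be i.i.d. random variables whose common distribution is absolutely continuous on $[0,1]$ with density that is bounded and positive almost everywhere with respect to Lebesgue measure. Let $l_k=e^{-\lambda k^\alpha}$, let $I_k$ be the open interval of length $l_k$ centered at $c_k$, and let $S=\bigcap_{m\ge1}\bigcup_{k\ge m} I_k$. Then: (1) if $0<\alpha\le 1$, then almost surely $\mathrm{Cap}(S)=\mathrm{Cap}([0,1])>0$; (2) if $\alpha>1$, then $\mathrm{Cap}(S)=0$.
   Context: For finite Borel measures $\mu,\nu$ on $\mathbb{C}$, the interaction is $I(\nu,\mu)=\iint(-\log|z-w|)\,d\nu(z)\,d\mu(w)$ and the energy is $I(\mu)=I(\mu,\mu)$. The logarithmic capacity of $E\subset\mathbb{C}$ is $\mathrm{Cap}(E)=\exp(-\inf I(\mu))$, the infimum over Borel probability measures $\mu$ whose support is a compact subset of $E$ (with $e^{-\infty}=0$). *)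

(* Defs.v *)
From HB Require Import structures.
From mathcomp Require Import all_boot all_order all_algebra.
From mathcomp Require Import all_classical all_reals all_analysis.
Set Implicit Arguments. Unset Strict Implicit. Unset Printing Implicit Defensive.
Import Order.TTheory GRing.Theory Num.Theory.
Import numFieldNormedType.Exports.
Local Open Scope classical_set_scope.
Local Open Scope ring_scope.

(* The complex plane C is modelled as R * R (z = x + i y <-> (x, y)),
   with its product (= Borel) sigma-algebra and product topology. *)

Definition cdist {R : realType} (z w : R * R) : R :=
  Num.sqrt ((z.1 - w.1) ^+ 2 + (z.2 - w.2) ^+ 2).

Definition logkernel {R : realType} (z w : R * R) : \bar R :=
  if cdist z w == 0 then +oo%E else (- ln (cdist z w))%:E.

Definition interaction {R : realType}
  (nu mu : {measure set (R * R)%type -> \bar R}) : \bar R :=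
  (\int[nu]_z \int[mu]_w logkernel z w)%E.

Definition energy {R : realType} (mu : {measure set (R * R)%type -> \bar R})
  : \bar R := interaction mu mu.

Definition msupport {R : realType} (mu : {measure set (R * R)%type -> \bar R})
  : set (R * R) :=
  [set z | forall U : set (R * R), open U -> U z -> (0 < mu U)%E].

Definition admissible {R : realType} (E : set (R * R))
  (mu : probability (R * R)%type R) : Prop :=
  compact (msupport mu) /\ msupport mu `<=` E.

Definition logcap {R : realType} (E : set (R * R)) : \bar R :=
  match ereal_inf [set energy mu | mu in [set mu | admissible E mu]] with
  | +oo%E => 0%E
  | -oo%E => +oo%E
  | r%:E => (expR (- r))%:E
  end.

Definition embedR {R : realType} (A : set R) : set (R * R) :=
  [set z | z.2 = 0 /\ A z.1].

Definition mutually_independent {d} {T : measurableType d} {R : realType}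
  (P : probability T R) (X : nat -> {RV P >-> R}) : Prop :=
  forall (F : seq nat) (A : nat -> set R), uniq F ->
    (forall i, i \in F -> measurable (A i)) ->
    P (\bigcap_(i in [set` F]) (X i @^-1` A i)) =
    (\prod_(i <- F) P (X i @^-1` A i))%E.

(* The random limsup set S = \bigcap_m \bigcup_{k >= m} I_k, where
   c k is c_{k+1} of the paper and I_{k+1} is the open interval of length
   l_{k+1} = exp(-lambda (k+1)^alpha) centred at c_{k+1}. *)
Definition interval_len {R : realType} (lambda alpha : R) (k : nat) : R :=
  expR (- (lambda * (k.+1%:R `^ alpha))).

Definition limsup_set {d} {T : measurableType d} {R : realType}
  (P : probability T R) (c : nat -> {RV P >-> R}) (lambda alpha : R)
  (omega : T) : set R :=
  \bigcap_(m in [set: nat]) \bigcup_(k in [set k | (m <= k)%N])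
    `](c k omega - interval_len lambda alpha k / 2),
       (c k omega + interval_len lambda alpha k / 2)[%classic.

(* Main.v *)
(* The energy of a measure on the line is compared with sums over dyadic nodes,
   a pair of nodes costing -ln of the length of their hull.

   If alpha > 1, let mu live on the limsup set and put the mass b_k of mu on
   pieces of the intervals I_k, k >= m. On I_k the kernel is at least
   w_k = lambda k^alpha, so \sum w_k b_k^2 is bounded by the energy, whereas
   1 = \sum b_k <= t \sum w_k b_k^2 + (4 t)^-1 \sum_(k >= m) 1/w_k by AM-GM;
   as \sum 1/w_k converges, the energy cannot be finite.

   If alpha <= 1, then I_k contains a dyadic node of generation r0 k around c_k.
   Weighting late centres c_k by 1 / (k f(c_k)) imitates Lebesgue measure on any
   dyadic node: as \sum 1/k diverges, second moments and Borel-Cantelli show that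
   almost surely the mutual energies of such discretised masses are, up to a
   constant, at most those of the nodes themselves. Hence the mass of a measure
   on [0, 1] can be moved into the intervals I_k, k >= m, at an energy cost that
   is small for pairs of nodes far apart relative to their size, and bounded for
   the other pairs, whose total mass tends to 0 with the size of the nodes
   because the energy is finite. Iterating with m tending to infinity and
   summable costs, the nested nodes converge to a measure on the limsup set. *)
Require Import Defs.
From HB Require Import structures.
From mathcomp Require Import all_boot all_order all_algebra.
From mathcomp Require Import all_classical all_reals all_analysis.
From mathcomp Require Import measurable_realfun simple_functions.
From mathcomp Require Import ring lra.
Import Order.TTheory GRing.Theory Num.Theory.
Import numFieldNormedType.Exports.
Local Open Scope classical_set_scope.
Local Open Scope ring_scope.
Set Implicit Arguments.
Unset Strict Implicit.
Unset Printing Implicit Defensive.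

(** * Integration, independence and second moments *)

Import HBNNSimple.

(** The node around c_k has generation r0 (k + 1), so its self-energy grows linearly in k.
    Probabilities a_k on a block must therefore keep \sum a_k^2 k small. With a_k proportional to
    1/k this sum is 1/H, where H is the harmonic mass of the block, and by Cauchy-Schwarz no choice
    does better: the same series decides both halves of the theorem.

    The density may come close to 0, so 1 / f is used only where f >= 2^-p; these sets exhaust a
    node up to a null set as p grows.

    All random input is condensed in [good_centers], which holds off one null set. From there on the
    argument is deterministic and treats all measures on [0, 1] at once, as the capacity requires.

    A stage is a random node on the fixed probability space [0, 1], so that successive stages are
    nested pointwise. The limit measure is the law of the limit point, and monotone convergence
    takes the place of weak compactness and semicontinuity. *)

Lemma ge0_integral_density d (T : measurableType d) (R : realType)
    (m mu : {measure set T -> \bar R}) (rho : T -> R) :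
  measurable_fun setT rho -> (forall x, 0 <= rho x) ->
  (forall A, measurable A -> m A = (\int[mu]_(x in A) (rho x)%:E)%E) ->
  forall phi : T -> \bar R, measurable_fun setT phi -> (forall x, 0 <= phi x)%E ->
  (\int[m]_x phi x = \int[mu]_x (phi x * (rho x)%:E))%E.
Proof.
move=> mrho rho0 mE phi mphi phi0.
(* The hypothesis is the case of indicators; linearity gives simple functions and monotone
   convergence the rest. *)
have ind A : measurable A ->
    (\int[m]_x (\1_A x)%:E = \int[mu]_x ((\1_A x)%:E * (rho x)%:E))%E.
  move=> mA; rewrite integral_indic// setIT mE// integral_mkcond.
  apply: eq_integral => x _; rewrite patchE indicE.
  by case: (x \in A); rewrite ?mul1e ?mul0e.
pose f_ := nnsfun_approx measurableT mphi.
have sf n : (\int[m]_x (f_ n x)%:E = \int[mu]_x ((f_ n x)%:E * (rho x)%:E))%E.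
  under [LHS]eq_integral do rewrite fimfunE -fsumEFin//.
  rewrite [LHS]ge0_integral_fsum//; last 2 first.
    - by move=> r; exact/measurable_EFinP/measurableT_comp.
    - by move=> k x _; rewrite EFinM nnfun_muleindic_ge0.
  under [RHS]eq_integral.
    move=> x xD; rewrite fimfunE -fsumEFin// ge0_mule_fsuml; last first.
      by move=> r; rewrite EFinM nnfun_muleindic_ge0.
    over.
  rewrite [RHS]ge0_integral_fsum//; last 2 first.
    - move=> r; apply: emeasurable_funM; last exact/measurable_EFinP.
      by apply/measurable_EFinP; apply/measurableT_comp => //.
    - move=> k x _; rewrite EFinM mule_ge0//; last by rewrite lee_fin.
      by rewrite nnfun_muleindic_ge0.
  apply: eq_fsbigr => r _.
  rewrite integralZl_indic_nnsfun//= ind//.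
  have [r0|r0] := ltP r 0.
    rewrite preimage_nnfun0//.
    rewrite [X in (_ * X)%E]integral0_eq; last first.
      by move=> x _; rewrite indicE in_set0 mul0e.
    by rewrite mule0 integral0_eq// => x _; rewrite indicE in_set0 mulr0 mul0e.
  rewrite -ge0_integralZl//.
  - by apply: eq_integral => x _; rewrite EFinM muleA.
  - apply: emeasurable_funM; last exact/measurable_EFinP.
    exact/measurable_EFinP.
  - by move=> x _; rewrite mule_ge0 ?lee_fin.
transitivity (lim (\int[m]_x (f_ n x)%:E @[n --> \oo])%E).
  rewrite -monotone_convergence//=.
  - apply: eq_integral => ? /[!inE] xD; apply/esym/cvg_lim => //=.
    exact: cvg_nnsfun_approx.
  - by move=> n; exact/measurable_EFinP/measurable_funTS.
  - by move=> n ? _; rewrite lee_fin.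
  - by move=> ? _ ? ? mn; rewrite lee_fin; exact/lefP/nd_nnsfun_approx.
under eq_fun do rewrite sf.
rewrite -monotone_convergence//=.
- apply: eq_integral => x _; apply/cvg_lim => //=.
  by apply: cvgeZr => //; exact: cvg_nnsfun_approx.
- by move=> n; apply: emeasurable_funM; exact/measurable_EFinP/measurable_funTS.
- by move=> n ? _; rewrite mule_ge0 ?lee_fin.
- move=> x _ a b ab; apply: lee_wpmul2r; rewrite lee_fin//.
  exact/lefP/nd_nnsfun_approx.
Qed.

Lemma ge0_integral_comp_density d (T : measurableType d) d' (T' : measurableType d')
    (R : realType) (m : {measure set T -> \bar R}) (mu : {measure set T' -> \bar R})
    (X : T -> T') (rho : T' -> R) :
  measurable_fun setT X ->
  measurable_fun setT rho -> (forall x, 0 <= rho x) ->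
  (forall A, measurable A -> m (X @^-1` A) = (\int[mu]_(x in A) (rho x)%:E)%E) ->
  forall phi : T' -> \bar R, measurable_fun setT phi -> (forall x, 0 <= phi x)%E ->
  (\int[m]_x phi (X x) = \int[mu]_x (phi x * (rho x)%:E))%E.
Proof.
move=> mX mrho rho0 mE phi mphi phi0.
pose X' : {mfun T >-> T'} := HB.pack X (isMeasurableFun.Build _ _ _ _ _ mX).
have /= := ge0_integral_pushforward mX m measurableT mphi (fun x _ => phi0 x).
rewrite preimage_setT => <-.
exact: (@ge0_integral_density _ _ _ (pushforward m X') mu).
Qed.

(** This class is closed under all operations used below and implies integrability, so expectations
    can be handled as real numbers. *)
Definition bounded_measurable d (T : measurableType d) (R : realType)
  (g : T -> R) : Prop :=
  measurable_fun setT g /\ exists C : R, forall t, `|g t| <= C.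

Section bounded_measurable.
Context d (T : measurableType d) (R : realType).
Implicit Types g h : T -> R.

Lemma bounded_measurable_cst (r : R) : bounded_measurable (fun _ : T => r).
Proof. by split => //; exists `|r|. Qed.

Lemma bounded_measurableD g h : bounded_measurable g -> bounded_measurable h ->
  bounded_measurable (fun t => g t + h t).
Proof.
move=> [mg [C gC]] [mh [D hD]]; split; first exact: measurable_funD.
by exists (C + D) => t; rewrite (le_trans (ler_normD _ _))// lerD.
Qed.

Lemma bounded_measurableM g h : bounded_measurable g -> bounded_measurable h ->
  bounded_measurable (fun t => g t * h t).
Proof.
move=> [mg [C gC]] [mh [D hD]]; split; first exact: measurable_funM.
by exists (C * D) => t; rewrite normrM ler_pM.
Qed.

Lemma bounded_measurableB g h : bounded_measurable g -> bounded_measurable h ->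
  bounded_measurable (fun t => g t - h t).
Proof.
move=> bg bh; have := bounded_measurableD bg
  (bounded_measurableM (bounded_measurable_cst (-1)) bh).
by congr bounded_measurable; apply/funext => t; rewrite mulN1r.
Qed.

Lemma bounded_measurable_indic (A : set T) : measurable A ->
  bounded_measurable (\1_A : T -> R).
Proof.
move=> mA; split; first exact: measurable_indic.
by exists 1 => t; rewrite indicE; case: (_ \in _); rewrite ?normr1 ?normr0.
Qed.

Lemma bounded_measurable_sum (I : Type) (s : seq I) (G : I -> T -> R) :
  (forall i, bounded_measurable (G i)) ->
  bounded_measurable (fun t => \sum_(i <- s) G i t).
Proof.
move=> bG; elim: s => [|i s IH].
  under eq_fun do rewrite big_nil; exact: bounded_measurable_cst.
by under eq_fun do rewrite big_cons; exact: bounded_measurableD.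
Qed.

Lemma bounded_measurable_comp d' (T' : measurableType d') (X : T' -> T) g :
  measurable_fun setT X -> bounded_measurable g ->
  bounded_measurable (fun t => g (X t)).
Proof.
move=> mX [mg [C gC]]; split; first exact: (measurableT_comp mg mX).
by exists C => t.
Qed.

Lemma bounded_measurable_integrable (P : probability T R) g :
  bounded_measurable g -> P.-integrable setT (EFin \o g).
Proof.
move=> [mg [C gC]]; apply: measurable_bounded_integrable => //.
  by rewrite (le_lt_trans (probability_le1 _ _)) ?ltry.
exists C; split; first exact: num_real.
by move=> x Cx t _ /=; exact: le_trans (gC t) (ltW Cx).
Qed.

End bounded_measurable.

Definition Ex d (T : measurableType d) (R : realType) (P : probability T R)
  (g : T -> R) : R := (\int[P]_t g t)%R.

Section Ex.
Context d (T : measurableType d) (R : realType) (P : probability T R).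
Implicit Types g h : T -> R.

Lemma Ex_cst (r : R) : Ex P (fun=> r) = r.
Proof.
rewrite /Ex Rintegral_cst// [X in fine X](@probability_setT _ _ _ P).
by rewrite mulr1.
Qed.

Lemma ExD g h : bounded_measurable g -> bounded_measurable h ->
  Ex P (fun t => g t + h t) = Ex P g + Ex P h.
Proof. by move=> bg bh; apply: RintegralD => //; exact: bounded_measurable_integrable. Qed.

Lemma ExZ (r : R) g : bounded_measurable g -> Ex P (fun t => r * g t) = r * Ex P g.
Proof. by move=> bg; apply: RintegralZl => //; exact: bounded_measurable_integrable. Qed.

Lemma Ex_sum (I : Type) (s : seq I) (G : I -> T -> R) :
  (forall i, bounded_measurable (G i)) ->
  Ex P (fun t => \sum_(i <- s) G i t) = \sum_(i <- s) Ex P (G i).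
Proof.
move=> bG; elim: s => [|i s IH].
  by under eq_fun do rewrite big_nil; rewrite Ex_cst big_nil.
under eq_fun do rewrite big_cons.
by rewrite ExD// ?IH ?big_cons//; exact: bounded_measurable_sum.
Qed.

Lemma Ex_le g h : bounded_measurable g -> bounded_measurable h ->
  (forall t, g t <= h t) -> Ex P g <= Ex P h.
Proof.
by move=> bg bh gh; apply: le_Rintegral => //; exact: bounded_measurable_integrable.
Qed.

Lemma Ex_ge0 g : (forall t, 0 <= g t) -> 0 <= Ex P g.
Proof. by move=> g0; exact: Rintegral_ge0. Qed.

Lemma EFin_Ex g : bounded_measurable g -> (Ex P g)%:E = (\int[P]_t (g t)%:E)%E.
Proof.
by move=> bg; rewrite /Ex fineK//; exact: integrable_fin_num (bounded_measurable_integrable P bg).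
Qed.

Lemma Ex_indic (A : set T) : measurable A -> Ex P (\1_A) = fine (P A).
Proof. by move=> mA; rewrite /Ex /Rintegral integral_indic// setIT. Qed.

Lemma Ex_markov g (e : R) : bounded_measurable g -> (forall t, 0 <= g t) -> 0 < e ->
  (P [set t | (e <= g t)%R] <= (e^-1 * Ex P g)%:E)%E.
Proof.
move=> bg g0 e0; set A := [set t | _].
have mA : measurable A.
  rewrite /A -[X in measurable X]setTI.
  by apply: measurable_fun_le => //; exact: bg.1.
have PA : P A \is a fin_num by exact: fin_num_measure.
rewrite -(fineK PA) lee_fin -Ex_indic// -ler_pdivrMl ?invr_gt0// invrK -ExZ//; last first.
  exact: bounded_measurable_indic.
apply: Ex_le => //.
  apply: bounded_measurableM; first exact: bounded_measurable_cst.
  exact: bounded_measurable_indic.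
move=> t; rewrite indicE; have [/set_mem|_] := boolP (t \in A); last by rewrite mulr0.
by rewrite mulr1.
Qed.

End Ex.

Section independence.
Context d (T : measurableType d) (R : realType) (P : probability T R).
Context d1 (E1 : measurableType d1) d2 (E2 : measurableType d2).

(** Independence on rectangles identifies the joint law with the product of the two laws; Tonelli
    then factors the integral. *)
Lemma Ex_independent (U : {RV P >-> E1}) (V : {RV P >-> E2}) (g1 : E1 -> R) (g2 : E2 -> R) :
  (forall A B, measurable A -> measurable B ->
    P (U @^-1` A `&` V @^-1` B) = (P (U @^-1` A) * P (V @^-1` B))%E) ->
  bounded_measurable g1 -> bounded_measurable g2 ->
  (forall x, 0 <= g1 x) -> (forall y, 0 <= g2 y) ->
  Ex P (fun t => g1 (U t) * g2 (V t)) =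
  Ex P (fun t => g1 (U t)) * Ex P (fun t => g2 (V t)).
Proof.
move=> UV bg1 bg2 g10 g20.
have b1 : bounded_measurable (fun t => g1 (U t)) by exact: bounded_measurable_comp.
have b2 : bounded_measurable (fun t => g2 (V t)) by exact: bounded_measurable_comp.
apply: EFin_inj; rewrite EFinM !EFin_Ex//; last exact: bounded_measurableM.
have mUV : measurable_fun setT (fun t => (U t, V t)) by exact: measurable_fun_pair.
pose UV' : {mfun T >-> (E1 * E2)%type} := HB.pack (fun t => (U t, V t))
  (isMeasurableFun.Build _ _ _ _ _ mUV).
pose G (z : E1 * E2) := (g1 z.1 * g2 z.2)%:E.
have mG : measurable_fun setT G.
  apply/measurable_EFinP; apply: measurable_funM.
    by apply: (measurableT_comp bg1.1); exact: measurable_fst.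
  by apply: (measurableT_comp bg2.1); exact: measurable_snd.
have G0 z : (0 <= G z)%E by rewrite lee_fin mulr_ge0.
transitivity (\int[distribution P UV']_z G z)%E.
  by rewrite (ge0_integral_distribution UV').
transitivity (\int[distribution P U \x distribution P V]_z G z)%E.
  apply: eq_measure_integral => A mA _; apply/esym.
  apply: (@product_measure_unique _ _ _ _ _ (distribution P U) (distribution P V) (distribution P UV')) => //.
rewrite fubini_tonelli1//.
have m1 : measurable_fun setT (fun x => (g1 x)%:E) by apply/measurable_EFinP; exact: bg1.1.
have m2 : measurable_fun setT (fun x => (g2 x)%:E) by apply/measurable_EFinP; exact: bg2.1.
have p1 x : (0 <= (g1 x)%:E)%E by rewrite lee_fin.
have p2 x : (0 <= (g2 x)%:E)%E by rewrite lee_fin.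
have -> := esym (ge0_integral_distribution U m1 p1).
have -> := esym (ge0_integral_distribution V m2 p2).
rewrite -ge0_integralZr//; last by apply: integral_ge0 => y _.
apply: eq_integral => x _; rewrite /fubini_F /G/=.
under eq_integral do rewrite EFinM.
by rewrite ge0_integralZl.
Qed.

End independence.

(** For fixed W both sides are finite measures in E, and they agree on the rectangles, which form a
    generating pi-system. *)
Lemma independent_of_rectangles d (T : measurableType d) (R : realType)
    (P : probability T R) d1 d2 (T1 : measurableType d1) (T2 : measurableType d2)
    (Z : {mfun T >-> (T1 * T2)%type}) (W : set T) : measurable W ->
  (forall A B, measurable A -> measurable B ->
    P (Z @^-1` (A `*` B) `&` W) = (P (Z @^-1` (A `*` B)) * P W)%E) ->
  forall E, measurable E -> P (Z @^-1` E `&` W) = (P (Z @^-1` E) * P W)%E.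
Proof.
move=> mW rect E mE.
pose G : set (set (T1 * T2)) :=
  [set C | exists A, measurable A /\ exists B, measurable B /\ C = A `*` B].
have PW : P W \is a fin_num by exact: fin_num_measure.
pose m2 := mscale (NngNum (fine_ge0 (measure_ge0 P W))) (distribution P Z).
transitivity (pushforward (mrestr P mW) Z E); first by [].
transitivity (m2 E); last by rewrite /m2 /mscale/= fineK// muleC.
apply: (measure_unique G (fun=> setT)) => //.
- rewrite measurable_prod_measurableType; congr (<<s _ >>).
  rewrite predeqE; split => [[A mA [B mB <-]]|[A [mA [B [mB ->]]]]].
    by exists A; split => //; exists B.
  by exists A => //; exists B.
- move=> _ _ [X1 [mX1 [X2 [mX2 ->]]]] [Y1 [mY1 [Y2 [mY2 ->]]]].
  rewrite -setXI; exists (X1 `&` Y1); split; first exact: measurableI.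
  by exists (X2 `&` Y2); split => //; exact: measurableI.
- move=> _; exists setT; split => //; exists setT; split => //.
  by rewrite setXTT.
- by rewrite bigcup_const.
- move=> _ [A [mA [B [mB ->]]]].
  rewrite /pushforward/= /mrestr /m2 /mscale/= [X in (X * _)%E]fineK// muleC.
  exact: rect.
- move=> _; rewrite /pushforward/= /mrestr.
  apply: (le_lt_trans (probability_le1 _ _)); last exact: ltry.
  by apply: measurableI => //; rewrite preimage_setT.
Qed.

Section pairs.
Context d (T : measurableType d) (R : realType) (P : probability T R).
Variable X : nat -> {RV P >-> R}.
Hypothesis indX : mutually_independent X.

Let mpair k j : measurable_fun setT (fun t => (X k t, X j t)).
Proof. exact: measurable_fun_pair. Qed.

Definition RVpair k j : {mfun T >-> (R * R)%type} :=
  HB.pack (fun t => (X k t, X j t)) (isMeasurableFun.Build _ _ _ _ _ (mpair k j)).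

Lemma independent2 k j A B : k != j -> measurable A -> measurable B ->
  P (X k @^-1` A `&` X j @^-1` B) = (P (X k @^-1` A) * P (X j @^-1` B))%E.
Proof.
move=> kj mA mB.
have := @indX [:: k; j] (fun i => if i == k then A else B).
rewrite !big_cons big_nil mule1 eqxx [j == k]eq_sym (negbTE kj) => <-.
- congr (P _); apply/seteqP; split => t /=.
    move=> [At Bt] i /=; rewrite !inE => /orP[] /eqP->.
      by rewrite eqxx.
    by rewrite eq_sym (negbTE kj).
  move=> H; split; first by have := H k; rewrite /= inE eqxx; exact.
  by have := H j; rewrite /= !inE eqxx orbT eq_sym (negbTE kj); exact.
- by rewrite /= inE kj.
- by move=> i _; case: ifP.
Qed.

Lemma independent4 k j k' j' A B C D : uniq [:: k; j; k'; j'] ->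
  measurable A -> measurable B -> measurable C -> measurable D ->
  P (RVpair k j @^-1` (A `*` B) `&` RVpair k' j' @^-1` (C `*` D)) =
  (P (X k @^-1` A) * P (X j @^-1` B) * (P (X k' @^-1` C) * P (X j' @^-1` D)))%E.
Proof.
move=> U mA mB mC mD.
have := @indX [:: k; j; k'; j'] (fun i => if i == k then A else if i == j then B else
   if i == k' then C else D).
move: (U) => /=; rewrite !inE !negb_or andbT => /andP[/and3P[kj kk' kj'] /andP[/andP[jk' jj'] k'j']].
rewrite !big_cons big_nil mule1 !eqxx (eq_sym j k) (eq_sym k' k) (eq_sym j' k).
rewrite (eq_sym k' j) (eq_sym j' j) (eq_sym j' k').
rewrite (negbTE kj) (negbTE kk') (negbTE kj') (negbTE jk') (negbTE jj') (negbTE k'j').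
rewrite -!muleA => <-//.
- congr (P _); apply/seteqP; split => t /=.
    move=> [[At Bt] [Ct Dt]] i /=; rewrite !inE => /or4P[] /eqP->.
    + by rewrite eqxx.
    + by rewrite (eq_sym j) (negbTE kj) eqxx.
    + by rewrite !(eq_sym k') (negbTE kk') (negbTE jk') eqxx.
    + by rewrite !(eq_sym j') (negbTE kj') (negbTE jj') (negbTE k'j').
  move=> H; split; split.
  + by have := H k; rewrite /= !inE eqxx; exact.
  + by have := H j; rewrite /= !inE eqxx (eq_sym j) (negbTE kj) orbT; exact.
  + by have := H k'; rewrite /= !inE eqxx !(eq_sym k') (negbTE kk') (negbTE jk') !orbT; exact.
  + by have := H j'; rewrite /= !inE eqxx !(eq_sym j') (negbTE kj') (negbTE jj') (negbTE k'j') !orbT; exact.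
- by move=> i _; case: ifP => // _; case: ifP => // _; case: ifP.
Qed.

(** The passage from rectangles to all measurable sets is made twice, once in each pair, starting
    from [independent4]. *)
Lemma independent_pairs k j k' j' E F : uniq [:: k; j; k'; j'] ->
  measurable E -> measurable F ->
  P (RVpair k j @^-1` E `&` RVpair k' j' @^-1` F) =
  (P (RVpair k j @^-1` E) * P (RVpair k' j' @^-1` F))%E.
Proof.
move=> U mE mF.
have mpre k1 j1 G : measurable G -> measurable (RVpair k1 j1 @^-1` G).
  by move=> mG; rewrite -[X in measurable X]setTI; exact: mpair.
have kj : k != j by move: U; rewrite /= !inE !negb_or => /andP[/andP[]].
have kj' : k' != j'.
  by move: U; rewrite /= !inE !negb_or => /andP[_ /andP[_ /andP[]]].
apply: independent_of_rectangles => //; first exact: mpre.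
move=> A B mA mB; rewrite setIC muleC.
apply: independent_of_rectangles => //; first by apply: mpre; exact: measurableX.
move=> C D mC mD; rewrite setIC independent4// muleC.
by rewrite -(independent2 kj mA mB) -(independent2 kj' mC mD).
Qed.

End pairs.

Section second_moment.
Context d (T : measurableType d) (R : realType) (P : probability T R).

Lemma Ex_sqr_sum (I : finType) (Z : I -> T -> R) (B : I -> I -> R) :
  (forall i, bounded_measurable (Z i)) ->
  (forall i j, Ex P (fun t => Z i t * Z j t) <= B i j) ->
  Ex P (fun t => (\sum_i Z i t) ^+ 2) <= \sum_i \sum_j B i j.
Proof.
move=> bZ ZB.
have -> : (fun t => (\sum_i Z i t) ^+ 2) = (fun t => \sum_i \sum_j Z i t * Z j t).
  by apply/funext => t; rewrite expr2 big_distrlr.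
rewrite Ex_sum; last first.
  by move=> i; apply: bounded_measurable_sum => j; exact: bounded_measurableM.
apply: ler_sum => i _; rewrite Ex_sum; last by move=> j; exact: bounded_measurableM.
exact: ler_sum.
Qed.

Lemma Ex_centered (Y Z : T -> R) (a b m n : R) :
  bounded_measurable Y -> bounded_measurable Z ->
  Ex P Y = m -> Ex P Z = n ->
  Ex P (fun t => (a * (Y t - m)) * (b * (Z t - n))) =
  a * b * (Ex P (fun t => Y t * Z t) - m * n).
Proof.
move=> bY bZ Ym Zn.
have -> : (fun t => (a * (Y t - m)) * (b * (Z t - n))) =
   (fun t => (a * b) * ((Y t * Z t + (- n) * Y t) + ((- m) * Z t + m * n))).
  by apply/funext => t; ring.
have c (r : R) := bounded_measurable_cst T r.
have bYZ := bounded_measurableM bY bZ.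
have b1 := bounded_measurableM (c (- n)) bY.
have b2 := bounded_measurableM (c (- m)) bZ.
have b3 := bounded_measurableD b2 (c (m * n)).
have b4 := bounded_measurableD bYZ b1.
rewrite ExZ; last exact: bounded_measurableD.
rewrite ExD// ExD// ExD// Ex_cst.
rewrite (ExZ P (- n) bY) (ExZ P (- m) bZ) Ym Zn.
by congr (_ * _); ring.
Qed.

(** Covariances vanish off the diagonal, so only the squares of the weights remain. *)
Lemma Ex_variance_sum M (a : nat -> R) (Z : nat -> T -> R) (m C : R) :
  (forall k, 0 <= a k) -> 0 <= m ->
  (forall k, bounded_measurable (Z k)) ->
  (forall k, Ex P (Z k) = m) ->
  (forall k j, k != j -> Ex P (fun t => Z k t * Z j t) = m * m) ->
  (forall k, Ex P (fun t => Z k t * Z k t) <= C) ->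
  Ex P (fun t => (\sum_(k < M) a k * (Z k t - m)) ^+ 2) <=
  C * \sum_(k < M) a k ^+ 2.
Proof.
move=> a0 m0 bZ Zm Zind ZC.
have c (r : R) := bounded_measurable_cst T r.
apply: (le_trans (Ex_sqr_sum
   (B := fun i j : 'I_M => if i == j then C * a i ^+ 2 else 0) _ _)).
- by move=> i; apply: bounded_measurableM => //; exact: bounded_measurableB.
- move=> i j; rewrite Ex_centered//.
  have [->|ij] := eqVneq i j.
    rewrite -expr2 mulrC ler_wpM2r ?exprn_ge0// lerBlDr.
    by rewrite (le_trans (ZC j))// lerDl mulr_ge0.
  by rewrite Zind// subrr mulr0.
- rewrite mulr_sumr; apply: ler_sum => i _.
  rewrite (bigD1 i)//= eqxx big1 ?addr0// => j /negbTE ji.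
  by rewrite eq_sym ji.
Qed.

(** Two pairs without a common index are uncorrelated. The others have at least one of four possible
    coincidences, and each coincidence contributes at most C \sum a_k^2 because the weights sum to
    1. *)
Lemma Ex_variance_pairs M (a : nat -> R) (Y : nat -> nat -> T -> R) (m C : R) :
  (forall k, 0 <= a k) -> 0 <= m -> \sum_(k < M) a k = 1 ->
  (forall k j, bounded_measurable (Y k j)) ->
  (forall k j, k != j -> Ex P (Y k j) = m) ->
  (forall k j k' j', uniq [:: k; j; k'; j'] ->
    Ex P (fun t => Y k j t * Y k' j' t) = m * m) ->
  (forall k j k' j', k != j -> k' != j' ->
    Ex P (fun t => Y k j t * Y k' j' t) <= C) ->
  Ex P (fun t => (\sum_(k < M) \sum_(j < M)
     (if k == j then 0 else a k * a j * (Y k j t - m))) ^+ 2) <=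
  4 * C * \sum_(k < M) a k ^+ 2.
Proof.
move=> a0 m0 a1 bY Ym Yind YC.
have c (r : R) := bounded_measurable_cst T r.
pose w (p : 'I_M * 'I_M) : R := a p.1 * a p.2.
pose Z (p : 'I_M * 'I_M) t := if p.1 == p.2 then 0 else w p * (Y p.1 p.2 t - m).
have -> : (fun t => (\sum_(k < M) \sum_(j < M)
     (if k == j then 0 else a k * a j * (Y k j t - m))) ^+ 2) =
   (fun t => (\sum_p Z p t) ^+ 2).
  by apply/funext => t; rewrite pair_bigA.
have wZ p : bounded_measurable (Z p).
  rewrite /Z; case: (p.1 == p.2); first exact: c.
  by apply: bounded_measurableM => //; exact: bounded_measurableB.
have C0 : 0 <= C.
  apply: le_trans (YC 0%N 1%N 0%N 1%N isT isT).
  by apply: Ex_ge0 => t; rewrite -expr2 sqr_ge0.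
have w0 p : 0 <= w p by rewrite mulr_ge0.
pose e (i j : 'I_M) : R := (i == j)%:R.
apply: (le_trans (Ex_sqr_sum
   (B := fun p q => C * (w p * w q * (e p.1 q.1 + e p.1 q.2 + e p.2 q.1 + e p.2 q.2))) _ _)).
- exact: wZ.
- move=> p q.
  have B0 : 0 <= C * (w p * w q * (e p.1 q.1 + e p.1 q.2 + e p.2 q.1 + e p.2 q.2)).
    by rewrite !mulr_ge0// !addr_ge0.
  rewrite /Z; case: (boolP (p.1 == p.2)) => [_|p12].
    by under eq_fun do rewrite mul0r; rewrite Ex_cst.
  case: (boolP (q.1 == q.2)) => [_|q12].
    by under eq_fun do rewrite mulr0; rewrite Ex_cst.
  have n12 : (p.1 : nat) != p.2 by rewrite (inj_eq val_inj).
  have n34 : (q.1 : nat) != q.2 by rewrite (inj_eq val_inj).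
  rewrite (Ex_centered _ _ (bY _ _) (bY _ _) (Ym _ _ n12) (Ym _ _ n34)).
  have [U|U] := boolP (uniq [:: p.1 : nat; p.2 : nat; q.1 : nat; q.2 : nat]).
    by rewrite Yind// subrr mulr0.
  rewrite [leRHS]mulrCA; apply: ler_wpM2l; first by rewrite mulr_ge0.
  apply: (@le_trans _ _ C).
    by rewrite lerBlDr (le_trans (YC _ _ _ _ n12 n34))// lerDl mulr_ge0.
  rewrite -{1}[C]mulr1 ler_wpM2l//.
  have : [|| p.1 == q.1, p.1 == q.2, p.2 == q.1 | p.2 == q.2].
    apply: contraR U; rewrite !negb_or -!(inj_eq val_inj)/= => /and4P[h1 h2 h3 h4].
    by rewrite !inE !negb_or n12 n34 h1 h2 h3 h4.
  by rewrite /e; do 4 case: eqP => _ //=; rewrite ?addr0 ?add0r// -?natrD ler1n.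
- under eq_bigr do rewrite -mulr_sumr.
  rewrite -mulr_sumr [4 * C]mulrC -mulrA; apply: ler_wpM2l => //.
  have S1 (i : 'I_M) : \sum_(j < M) a j * e i j = a i.
    rewrite (bigD1 i)//= /e eqxx mulr1 big1 ?addr0// => j /negbTE ji.
    by rewrite eq_sym ji mulr0.
  have inner (p : 'I_M * 'I_M) (i : 'I_M) :
      (\sum_q w q * e i q.1 = a i) /\ (\sum_q w q * e i q.2 = a i).
    split.
      rewrite /w -(pair_bigA _ (fun k j : 'I_M => a k * a j * e i k))/=.
      under eq_bigr do under eq_bigr do rewrite mulrAC.
      by under eq_bigr do rewrite -mulr_sumr a1 mulr1; exact: S1.
    rewrite /w -(pair_bigA _ (fun k j : 'I_M => a k * a j * e i j))/=.
    under eq_bigr do under eq_bigr do rewrite -mulrA.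
    under eq_bigr do rewrite -mulr_sumr S1.
    by rewrite -mulr_suml a1 mul1r.
  rewrite (eq_bigr (fun p => w p * (a p.1 *+ 2 + a p.2 *+ 2))); last first.
    move=> p _; under eq_bigr do rewrite -mulrA.
    rewrite -mulr_sumr; congr (_ * _).
    under eq_bigr do rewrite !mulrDr.
    rewrite !big_split/= !(inner p _).1 !(inner p _).2.
    by rewrite !mulr2n !addrA.
  rewrite /w -(pair_bigA _ (fun k j : 'I_M => a k * a j * (a k *+ 2 + a j *+ 2)))/=.
  under eq_bigr do under eq_bigr do rewrite mulrDr.
  under eq_bigr do rewrite big_split/=.
  rewrite big_split/= [X in _ + X]exchange_big/=.
  have E k : \sum_(j < M) a k * a j * (a k *+ 2) = 2 * a k ^+ 2.
    under eq_bigr do rewrite mulrAC.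
    by rewrite -mulr_sumr a1; ring.
  under eq_bigr do rewrite E.
  under [X in _ + X]eq_bigr do under eq_bigr do rewrite [a _ * a _]mulrC.
  under [X in _ + X]eq_bigr do rewrite E.
  by rewrite -mulr_sumr -mulrDl -natrD.
Qed.

End second_moment.

(** * Moments of the weighted centres *)

(* ln 2 * log_count n x y replaces -ln |x - y| cut off at scale 2^-n, up to an
   additive constant. *)
Definition log_count (R : realType) (n : nat) (x y : R) : R :=
  \sum_(r < n) (`|x - y| <= 2 ^- r)%R%:R.

Section log_count.
Context (R : realType).
Implicit Types x y : R.

Lemma log_count_ge0 n x y : 0 <= log_count n x y.
Proof. by rewrite sumr_ge0. Qed.

Lemma log_count_le n x y : log_count n x y <= n%:R.
Proof.
apply: (@le_trans _ _ (\sum_(r < n) (1 : R))); last by rewrite sumr_const card_ord.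
by apply: ler_sum => r _; rewrite (ler_nat _ _ 1) leq_b1.
Qed.

Lemma log_countC n x y : log_count n x y = log_count n y x.
Proof. by rewrite /log_count distrC. Qed.

(** A further scale raises a count s <= n to s + 1 and its square by 2 s + 1 <= 2 n + 1. *)
Lemma log_count_sqr n x y :
  log_count n x y ^+ 2 <= \sum_(r < n) (2 * r + 1)%:R * (`|x - y| <= 2 ^- r)%R%:R.
Proof.
elim: n => [|n IH]; first by rewrite /log_count !big_ord0 expr0n.
rewrite /log_count !big_ord_recr/= -/(log_count n x y).
case: (_ <= 2 ^- n); last by rewrite mulr0 !addr0.
rewrite mulr1 sqrrD expr1n mulr1 natrD natrM -addrA lerD// lerD2r -mulr_natl.
by rewrite ler_wpM2l// log_count_le.
Qed.

(** The first q terms are at most 2^-q each, and the others form a geometric tail of sum at most 4 *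
    2^-q. *)
Lemma sum_min_pow2 q n : \sum_(r < n) Num.min (2 ^- q) (2 * 2 ^- r) <=
  2 ^- q * (q%:R + 4) :> R.
Proof.
(* The remainder of the tail is kept in the bound so that the induction on n closes. *)
suff : \sum_(r < n) Num.min (2 ^- q) (2 * 2 ^- r) <=
    2 ^- q * (minn n q)%:R + 4 * 2 ^- q - 4 * 2 ^- maxn n q :> R.
  move/le_trans; apply; rewrite mulrDr [4 * _]mulrC lerBlDr -addrA lerD//.
    by rewrite ler_wpM2l ?ler_nat ?geq_minr.
  by rewrite lerDl mulr_ge0.
elim: n => [|n IH].
  by rewrite big_ord0 min0n max0n mulr0 add0r subrr.
rewrite big_ord_recr/= (le_trans (lerD IH (lexx _)))//.
have [nq|qn] := ltnP n q.
  rewrite ?(minn_idPl (ltnW nq)) ?(maxn_idPr (ltnW nq)) ?(minn_idPl nq) ?(maxn_idPr nq).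
  rewrite -[n.+1]addn1 natrD mulrDr mulr1.
  have : Num.min (2 ^- q) (2 * 2 ^- n) <= 2 ^- q :> R by rewrite ge_min lexx.
  lra.
rewrite ?(minn_idPr qn) ?(maxn_idPl qn) ?(minn_idPr (leqW qn)) ?(maxn_idPl (leqW qn)).
have : Num.min (2 ^- q) (2 * 2 ^- n) <= 2 * 2 ^- n :> R by rewrite ge_min lexx orbT.
rewrite exprS invfM; lra.
Qed.

Lemma sum_odd_pow2 n :
  \sum_(r < n) (2 * r + 1)%:R * (2 * 2 ^- r) <= 12 :> R.
Proof.
suff -> : \sum_(r < n) (2 * r + 1)%:R * (2 * 2 ^- r) =
    12 - (8 * n + 12)%:R * 2 ^- n :> R.
  by rewrite gerBl mulr_ge0.
elim: n => [|n IH].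
  by rewrite big_ord0 expr0 invr1 mulr1 subrr.
rewrite big_ord_recr/= IH exprS invfM !natrD !natrM -[n.+1]addn1 natrD.
by field; rewrite expf_neq0.
Qed.

End log_count.

Definition unit_density (R : realType) (f : R -> R) (x : R) : R :=
  f x * \1_`[0%R, 1%R] x.

Section law.
Context d (T : measurableType d) (R : realType) (P : probability T R).
Variables (X : nat -> {RV P >-> R}) (f : R -> R).
Hypothesis indX : mutually_independent X.
Hypothesis mf : measurable_fun setT f.
Hypothesis f0 : forall x, 0 <= f x.
Hypothesis lawX : forall (k : nat) (A : set R), measurable A ->
     P (X k @^-1` A) =
     (\int[@lebesgue_measure R]_(x in A `&` `[0%R, 1%R]) (f x)%:E)%E.
Local Notation mu := (@lebesgue_measure R).

Local Notation rho := (unit_density f).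

Let mrho : measurable_fun setT rho.
Proof. by apply: measurable_funM => //; exact: measurable_indic. Qed.

Let rho0 x : 0 <= rho x. Proof. by rewrite mulr_ge0// indicE. Qed.

Let law_density k A : measurable A ->
  P ((X k : T -> measurableTypeR R) @^-1` A) = (\int[mu]_(x in A) (rho x)%:E)%E.
Proof.
move=> mA; transitivity (P (X k @^-1` A)) => //.
rewrite lawX// integral_mkcondr.
by apply: eq_integral => x _; rewrite patchE /unit_density indicE; case: ifP; rewrite ?mulr1 ?mulr0.
Qed.

Let integral_law k (phi : R -> \bar R) : measurable_fun setT phi ->
  (forall x, 0 <= phi x)%E ->
  (\int[P]_t phi (X k t) = \int[mu]_x (phi x * (rho x)%:E))%E.
Proof.
move=> mphi phi0.
have mX : measurable_fun setT (X k : T -> measurableTypeR R) 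
  by move=> _ A mA; exact: (measurable_funP (X k) measurableT A mA).
have := @ge0_integral_comp_density _ T _ (measurableTypeR R) R P lebesgue_measure
  (X k) rho mX.  apply.
- exact: mrho.
- exact: rho0.
- exact: law_density.
- exact: mphi.
- exact: phi0.
Qed.

Lemma Ex_law k (g : R -> R) : bounded_measurable g -> (forall x, 0 <= g x) ->
  (Ex P (fun t => g (X k t)))%:E = (\int[mu]_x (g x * rho x)%:E)%E.
Proof.
move=> bg g0; rewrite EFin_Ex; last exact: bounded_measurable_comp.
have mg : measurable_fun setT (EFin \o g) by apply/measurable_EFinP; exact: bg.1.
by rewrite (integral_law k mg) // => x; rewrite lee_fin.
Qed.

(** By independence the pair has a product law, and the density is applied in one variable at a
    time. *)
Lemma Ex_law2 k j (g : R * R -> R) : k != j ->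
  bounded_measurable g -> (forall x, 0 <= g x) ->
  (Ex P (fun t => g (X k t, X j t)))%:E =
  (\int[mu]_x ((\int[mu]_y (g (x, y) * rho y)%:E) * (rho x)%:E))%E.
Proof.
move=> kj bg g0.
pose Z := RVpair X k j.
rewrite EFin_Ex; last exact: (bounded_measurable_comp (X := Z)).
have mg : measurable_fun setT (EFin \o g) by apply/measurable_EFinP; exact: bg.1.
have g0' x : (0 <= (EFin \o g) x)%E by rewrite lee_fin.
transitivity (\int[distribution P Z]_z (EFin \o g) z)%E.
  by rewrite (ge0_integral_distribution Z).
transitivity (\int[distribution P (X k) \x distribution P (X j)]_z (EFin \o g) z)%E.
  apply: eq_measure_integral => A mA _.
  apply/esym; apply: (@product_measure_unique _ _ _ _ _ (distribution P (X k))
    (distribution P (X j)) (distribution P Z)) => // B C mB mC.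
  exact: (independent2 indX).
rewrite fubini_tonelli1//.
have mF : measurable_fun setT (fubini_F (distribution P (X j)) (EFin \o g)).
  exact: measurable_fun_fubini_tonelli_F.
have F0 x : (0 <= fubini_F (distribution P (X j)) (EFin \o g) x)%E.
  by apply: integral_ge0 => y _.
rewrite (ge0_integral_distribution (X k) mF F0).
rewrite (integral_law k mF F0).
apply: eq_integral => x _; congr (_ * _)%E; rewrite /fubini_F.
have mgx : measurable_fun setT (fun y => (EFin \o g) (x, y)).
  by apply: (measurableT_comp mg); exact: measurable_pair1.
by rewrite (ge0_integral_distribution (X j) mgx)// (integral_law j mgx).
Qed.

End law.

(* Under the density f, the mean of inv_density f A is the Lebesgue measure of A. *)
Definition inv_density (R : realType) (f : R -> R) (A : set R) (x : R) : R :=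
  \1_A x / f x.

(** Its mean over two distinct centres is the integral of [log_count n] over A x B for Lebesgue
    measure, a truncated mutual energy of A and B. *)
Definition pair_kernel (R : realType) (f : R -> R) (n : nat) (A B : set R)
  (z : R * R) : R :=
  inv_density f A z.1 * inv_density f B z.2 * log_count n z.1 z.2.

Section moments.
Context d (T : measurableType d) (R : realType) (P : probability T R).
Variables (X : nat -> {RV P >-> R}) (f : R -> R).
Hypothesis indX : mutually_independent X.
Hypothesis mf : measurable_fun setT f.
Hypothesis f0 : forall x, 0 <= f x.
Hypothesis lawX : forall (k : nat) (A : set R), measurable A ->
     P (X k @^-1` A) =
     (\int[@lebesgue_measure R]_(x in A `&` `[0%R, 1%R]) (f x)%:E)%E.
Local Notation mu := (@lebesgue_measure R).
Variable delta : R.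
Hypothesis delta0 : 0 < delta.
(** The lower bound on f keeps the weights [inv_density f A] below 1 / delta, which gives finite
    second moments. *)
Definition good_set (A : set R) : Prop :=
  [/\ measurable A, A `<=` `[0%R, 1%R] & forall x, A x -> delta <= f x].

Lemma inv_density_ge0 A x : 0 <= inv_density f A x.
Proof. by rewrite divr_ge0// indicE. Qed.

Lemma inv_density_le A x : good_set A -> inv_density f A x <= delta^-1.
Proof.
move=> [mA A01 Af]; rewrite /inv_density indicE; case: (boolP (x \in A)) => [/set_mem Ax|_].
  have fx := Af _ Ax.
  by rewrite mul1r lef_pV2// posrE// (lt_le_trans delta0).
by rewrite mul0r invr_ge0 ltW.
Qed.

Lemma measurable_inv_density A : good_set A -> measurable_fun setT (inv_density f A).
Proof.
move=> [mA A01 Af].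
have -> : inv_density f A = (fun x => \1_A x * (Num.max delta (f x))^-1).
  apply/funext => x; rewrite /inv_density indicE; case: (boolP (x \in A)) => [/set_mem Ax|_].
    by rewrite (max_idPr (Af _ Ax)).
  by rewrite !mul0r.
apply: measurable_funM; first exact: measurable_indic.
have mm : measurable_fun setT (fun x => Num.max delta (f x)) by exact: measurable_maxr.
(* The maximum is positive, so its inverse is the power -1, to which [measurable_powR] applies. *)
have -> : (fun x => (Num.max delta (f x))^-1) = (fun x => (Num.max delta (f x)) `^ (-1)).
  by apply/funext => x; rewrite powR_inv1// le_max (ltW delta0).
exact: (measurableT_comp (measurable_powR (-1)) mm).
Qed.

Lemma bounded_inv_density A : good_set A -> bounded_measurable (inv_density f A).
Proof.
move=> gA; split; first exact: measurable_inv_density.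
by exists delta^-1 => x; rewrite ger0_norm ?inv_density_ge0// inv_density_le.
Qed.

Lemma inv_densityE A x : good_set A -> inv_density f A x * unit_density f x = \1_A x.
Proof.
move=> [mA A01 Af]; rewrite /inv_density /unit_density !indicE.
case: (boolP (x \in A)) => [/set_mem Ax|_]; last by rewrite !mul0r.
by rewrite mem_set ?mulr1 ?mul1r; [rewrite mulVf// gt_eqF// (lt_le_trans delta0 (Af _ Ax))|exact: A01].
Qed.

Lemma good_set_le1 A : good_set A -> (mu A <= 1)%E.
Proof.
move=> [mA A01 _]; apply: (@le_trans _ _ (mu `[0%R, 1%R])).
  by apply: le_measure; rewrite ?inE.
by rewrite lebesgue_measure_itv/= lte_fin ltr01 oppr0 adde0.
Qed.

Lemma good_set_fin A : good_set A -> mu A \is a fin_num.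
Proof.
by move=> gA; rewrite ge0_fin_numE// (le_lt_trans (good_set_le1 gA)) ?ltry.
Qed.

Lemma Ex_inv_density A k : good_set A ->
  Ex P (fun t => inv_density f A (X k t)) = fine (mu A).
Proof.
move=> gA; apply: EFin_inj.
rewrite (fineK (good_set_fin gA)); transitivity (\int[mu]_x (inv_density f A x * unit_density f x)%:E)%E.
  exact: (Ex_law mf f0 lawX k (bounded_inv_density gA) (inv_density_ge0 A)).
under eq_integral do rewrite inv_densityE//.
by rewrite integral_indic// ?setIT//; case: gA.
Qed.

(** The weights cancel both densities, so the mean is the plane measure of E within A x B; it is
    bounded slice by slice. *)
Lemma Ex_inv_density_pair A B E (s : R) k j : k != j -> good_set A -> good_set B ->
  measurable E -> (forall x, mu (B `&` xsection E x) <= s%:E)%E ->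
  Ex P (fun t => inv_density f A (X k t) * inv_density f B (X j t) * \1_E (X k t, X j t))
  <= fine (mu A) * s.
Proof.
move=> kj gA gB mE Es.
pose g (z : R * R) : R := inv_density f A z.1 * inv_density f B z.2 * \1_E z.
have bg : bounded_measurable g.
  apply: bounded_measurableM; last exact: bounded_measurable_indic.
  apply: bounded_measurableM.
    exact: (bounded_measurable_comp measurable_fst (bounded_inv_density gA)).
  exact: (bounded_measurable_comp measurable_snd (bounded_inv_density gB)).
have i0 (D : set (R * R)) z : 0 <= \1_D z :> R by rewrite indicE.
have g0 z : 0 <= g z.
  by apply: mulr_ge0 => //; apply: mulr_ge0; exact: inv_density_ge0.
rewrite -lee_fin EFinM (fineK (good_set_fin gA)).
rewrite (Ex_law2 indX mf f0 lawX kj bg g0).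
have [mA _ _] := gA; have [mB _ _] := gB.
have -> : (mu A * s%:E)%E = (\int[mu]_x ((\1_A x)%:E * s%:E))%E.
  rewrite ge0_integralZr//; first by rewrite integral_indic// setIT.
    by apply/measurable_EFinP; exact: measurable_indic.
  by apply: le_trans (Es 0); exact: measure_ge0.
have s0 : (0 <= s%:E)%E by apply: le_trans (Es 0); exact: measure_ge0.
apply: ge0_le_integral => //.
- move=> x _; apply: mule_ge0; last by rewrite lee_fin mulr_ge0// indicE.
  by apply: integral_ge0 => y _; rewrite lee_fin mulr_ge0// mulr_ge0// indicE.
- have mr : measurable_fun setT (fun x : R => (unit_density f x)%:E).
    by apply/measurable_EFinP; apply: measurable_funM => //; exact: measurable_indic.
  apply: emeasurable_funM => //.
  pose G (z : measurableTypeR R * measurableTypeR R) := (g z * unit_density f z.2)%:E.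
  have mG : measurable_fun setT G.
    apply/measurable_EFinP; apply: measurable_funM; first exact: bg.1.
    have /measurable_EFinP := mr.
    by move=> /(@measurableT_comp _ _ _ _ _ _ _ _ snd); apply; exact: measurable_snd.
  by apply: (@measurable_fun_fubini_tonelli_F _ _ _ _ _ mu G) => // z; rewrite lee_fin mulr_ge0// mulr_ge0// indicE.
- apply: emeasurable_funM => //.
  by apply/measurable_EFinP; exact: measurable_indic.
- move=> x _.
  have -> : (\int[mu]_y (g (x, y) * unit_density f y)%:E =
     (inv_density f A x)%:E * mu (B `&` xsection E x))%E.
    transitivity (\int[mu]_y ((inv_density f A x)%:E * (\1_(B `&` xsection E x) y)%:E))%E.
      apply: eq_integral => y _; rewrite -EFinM; congr EFin.
      rewrite /g indicI/= -(inv_densityE y gB).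
      have -> : \1_(xsection E x) y = \1_E (x, y) :> R by rewrite !indicE mem_xsection.
      by ring.
    rewrite ge0_integralZl//.
    + by rewrite integral_indic ?setIT//; apply: measurableI => //; exact: measurable_xsection.
    + by apply/measurable_EFinP; apply: measurable_indic; apply: measurableI => //; exact: measurable_xsection.
    + by rewrite lee_fin inv_density_ge0.
  rewrite muleAC -EFinM inv_densityE//.
  by apply: lee_wpmul2l => //; rewrite lee_fin indicE.
Qed.

End moments.

Definition near_diag (R : realType) (r : nat) : set (R * R) :=
  [set z | `|z.1 - z.2| <= 2 ^- r].

Arguments near_diag : clear implicits.

Lemma measurable_near_diag (R : realType) r : measurable (near_diag R r).
Proof.
rewrite /near_diag -[X in measurable X]setTI.
apply: (measurable_fun_le (f := fun z : R * R => `|z.1 - z.2|) (g := cst (2 ^- r))) => //.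
apply: (measurableT_comp (@normr_measurable R setT)).
by apply: measurable_funB; [exact: measurable_fst|exact: measurable_snd].
Qed.

Lemma log_countE (R : realType) n (z : R * R) :
  log_count n z.1 z.2 = \sum_(r < n) \1_(near_diag R r) z.
Proof.
apply: eq_bigr => r _; rewrite indicE; congr (_%:R); congr nat_of_bool.
by apply/idP/idP => [H|/set_mem//]; rewrite mem_set.
Qed.

Section kernel_moments.
Context d (T : measurableType d) (R : realType) (P : probability T R).
Variables (X : nat -> {RV P >-> R}) (f : R -> R).
Hypothesis indX : mutually_independent X.
Hypothesis mf : measurable_fun setT f.
Hypothesis f0 : forall x, 0 <= f x.
Hypothesis lawX : forall (k : nat) (A : set R), measurable A ->
     P (X k @^-1` A) =
     (\int[@lebesgue_measure R]_(x in A `&` `[0%R, 1%R]) (f x)%:E)%E.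
Local Notation mu := (@lebesgue_measure R).
Variable delta : R.
Hypothesis delta0 : 0 < delta.
Implicit Types A B : set R.

Lemma bounded_pair_kernel n A B : good_set f delta A -> good_set f delta B ->
  bounded_measurable (pair_kernel f n A B).
Proof.
move=> gA gB; apply: bounded_measurableM.
  apply: bounded_measurableM.
    exact: (bounded_measurable_comp measurable_fst (bounded_inv_density mf f0 delta0 gA)).
  exact: (bounded_measurable_comp measurable_snd (bounded_inv_density mf f0 delta0 gB)).
under eq_fun do rewrite log_countE.
by apply: bounded_measurable_sum => r; apply: bounded_measurable_indic; exact: measurable_near_diag.
Qed.

Lemma pair_kernel_ge0 n A B z : 0 <= pair_kernel f n A B z.
Proof. 
apply: mulr_ge0; last exact: log_count_ge0.
by apply: mulr_ge0; exact: (inv_density_ge0 f0). Qed.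

Lemma xsection_near_diag r (x : R) :
  (mu (xsection (near_diag R r) x) <= (2 * 2 ^- r)%:E)%E.
Proof.
have -> : xsection (near_diag R r) x = `[x - 2 ^- r, x + 2 ^- r]%classic.
  apply/seteqP; split => y; rewrite /xsection/near_diag/= inE/= in_itv/= ler_distlC => /andP[? ?].
    by apply/andP; split => //; lra.
  by apply/andP; split => //; lra.
rewrite lebesgue_measure_itv/= lte_fin; case: ifP => _.
  by rewrite -EFinD lee_fin; lra.
by rewrite lee_fin mulr_ge0.
Qed.

(** A slice lies both in B and in an interval of length 2 * 2^-r, whence the minimum. *)
Lemma Ex_near_diag k j A B q r : k != j -> good_set f delta A -> good_set f delta B ->
  (mu B <= (2 ^- q)%:E)%E ->
  Ex P (fun t => inv_density f A (X k t) * inv_density f B (X j t) *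
    \1_(near_diag R r) (X k t, X j t)) <= fine (mu A) * Num.min (2 ^- q) (2 * 2 ^- r).
Proof.
move=> kj gA gB Bq.
apply: (Ex_inv_density_pair indX mf f0 lawX delta0 kj gA gB) => [|x].
  exact: measurable_near_diag.
have [mB _ _] := gB.
have mx : measurable (xsection (near_diag R r) x).
  by apply: measurable_xsection; exact: measurable_near_diag.
rewrite EFin_min le_min; apply/andP; split.
  by apply: le_trans Bq; apply: le_measure; rewrite ?inE//; exact: measurableI.
apply: le_trans (xsection_near_diag r x).
by apply: le_measure; rewrite ?inE//; exact: measurableI.
Qed.

Let bounded_near_diag A B r k j : good_set f delta A -> good_set f delta B ->
  bounded_measurable (fun t => inv_density f A (X k t) * inv_density f B (X j t) *
    \1_(near_diag R r) (X k t, X j t)).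
Proof.
move=> gA gB; apply: bounded_measurableM; last first.
  by apply: (bounded_measurable_comp (X := RVpair X k j)) => //; apply: bounded_measurable_indic; exact: measurable_near_diag.
by apply: bounded_measurableM; apply: (@bounded_measurable_comp _ _ _ _ _ _) => //;
  apply: (bounded_inv_density mf f0 delta0).
Qed.

Lemma Ex_pair_kernel n k j A B q : k != j -> good_set f delta A -> good_set f delta B ->
  (mu B <= (2 ^- q)%:E)%E ->
  Ex P (fun t => pair_kernel f n A B (X k t, X j t)) <=
  fine (mu A) * (2 ^- q * (q%:R + 4)).
Proof.
move=> kj gA gB Bq.
under eq_fun do rewrite /pair_kernel log_countE mulr_sumr.
rewrite Ex_sum; last by move=> r; exact: bounded_near_diag.
apply: (@le_trans _ _ (\sum_(r < n) fine (mu A) * Num.min (2 ^- q) (2 * 2 ^- r))).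
  by apply: ler_sum => r _; exact: Ex_near_diag.
by rewrite -mulr_sumr ler_wpM2l ?fine_ge0//; exact: sum_min_pow2.
Qed.

Lemma Ex_pair_kernelC n k j A B :
  Ex P (fun t => pair_kernel f n A B (X k t, X j t)) =
  Ex P (fun t => pair_kernel f n B A (X j t, X k t)).
Proof.
congr Ex; apply/funext => t; rewrite /pair_kernel/= log_countC.
by rewrite [inv_density f A _ * _]mulrC.
Qed.

(** All pairs of distinct centres have the same law, so the pair (0, 1) can serve as a reference. *)
Lemma Ex_pair_kernel_law n k j A B : k != j ->
  good_set f delta A -> good_set f delta B ->
  Ex P (fun t => pair_kernel f n A B (X k t, X j t)) =
  Ex P (fun t => pair_kernel f n A B (X 0 t, X 1 t)).
Proof.
move=> kj gA gB; apply: EFin_inj.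
by rewrite !(Ex_law2 indX mf f0 lawX _ (bounded_pair_kernel n gA gB) (@pair_kernel_ge0 n A B)).
Qed.

(** What matters is that the bound does not depend on n: a logarithm is square integrable, so the
    truncation level may grow with the block. The constant 12 comes from [sum_odd_pow2]. *)
Lemma Ex_pair_kernel_sqr n k j A B : k != j ->
  good_set f delta A -> good_set f delta B ->
  Ex P (fun t => pair_kernel f n A B (X k t, X j t) ^+ 2) <= 12 * delta ^- 2.
Proof.
move=> kj gA gB.
have gB1 : (mu B <= (2 ^- 0)%:E)%E.
  by rewrite expr0 invr1; exact: good_set_le1 gB.
pose G t := \sum_(r < n) (delta ^- 2 * (2 * r + 1)%:R) * (inv_density f A (X k t) * inv_density f B (X j t) *
    \1_(near_diag R r) (X k t, X j t)).
have bG (r : 'I_n) : bounded_measurable (fun t => (delta ^- 2 * (2 * r + 1)%:R) * (inv_density f A (X k t) * inv_density f B (X j t) *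
    \1_(near_diag R r) (X k t, X j t))).
  by apply: bounded_measurableM; [exact: bounded_measurable_cst|exact: bounded_near_diag].
apply: (@le_trans _ _ (Ex P G)).
  apply: Ex_le.
  - under eq_fun do rewrite expr2.
    by apply: bounded_measurableM; apply: (bounded_measurable_comp (X := RVpair X k j)) => //; exact: bounded_pair_kernel.
  - exact: bounded_measurable_sum.
  move=> t; rewrite /pair_kernel/= exprMn.
  set a := inv_density f A _; set b := inv_density f B _.
  have a0 : 0 <= a by exact: inv_density_ge0.
  have b0 : 0 <= b by exact: inv_density_ge0.
  have ad : a <= delta^-1 by exact: inv_density_le.
  have bd : b <= delta^-1 by exact: inv_density_le.
  have -> : G t = (delta ^- 2 * (a * b)) * \sum_(r < n) (2 * r + 1)%:R * (`|X k t - X j t| <= 2 ^- r)%R%:R.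
    rewrite /G mulr_sumr; apply: eq_bigr => r _.
    have -> : \1_(near_diag R r) (X k t, X j t) = (`|X k t - X j t| <= 2 ^- r)%R%:R :> R.
      rewrite indicE; congr (_%:R); congr nat_of_bool.
      by apply/idP/idP => [/set_mem//|H]; rewrite mem_set.
    by rewrite -/a -/b; ring.
  apply: ler_pM; rewrite ?sqr_ge0//; last exact: log_count_sqr.
  rewrite expr2; apply: ler_wpM2r; first by rewrite mulr_ge0.
  by rewrite -exprVn expr2; exact: ler_pM.
rewrite /G Ex_sum//.
apply: (@le_trans _ _ (\sum_(r < n) delta ^- 2 * ((2 * r + 1)%:R * (2 * 2 ^- r)))).
  apply: ler_sum => r _; rewrite ExZ; last exact: bounded_near_diag.
  rewrite -[leLHS]mulrA; apply: ler_wpM2l; first by rewrite invr_ge0 exprn_ge0// ltW.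
  apply: ler_wpM2l => //.
  apply: le_trans (Ex_near_diag r kj gA gB gB1) _.
  rewrite -[leRHS]mul1r; apply: ler_pM => //.
  - exact: fine_ge0.
  - by rewrite -lee_fin fineK ?(good_set_fin gA)//; exact: good_set_le1 gA.
  - by rewrite ge_min lexx orbT.
rewrite -mulr_sumr mulrC; apply: ler_wpM2r; first by rewrite invr_ge0 exprn_ge0// ltW.
exact: sum_odd_pow2.
Qed.

End kernel_moments.

(** * Almost sure behaviour of blocks of centres *)

Lemma borel_cantelli_pow2 d (T : measurableType d) (R : realType)
    (P : probability T R) (E : nat -> set T) (c : R) :
  (forall i, measurable (E i)) -> (forall i, (P (E i) <= (c * 2 ^- i)%:E)%E) ->
  {ae P, forall t, exists i0, forall i, (i0 <= i)%N -> ~ E i t}.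
Proof.
move=> mE PE.
have c0 : 0 <= c.
  by have := le_trans (measure_ge0 P (E 0%N)) (PE 0%N); rewrite expr0 invr1 mulr1 lee_fin.
have S : (\sum_(n <oo) P (E n) < +oo)%E.
  apply: (@le_lt_trans _ _ (2 * c)%:E); last exact: ltry.
  apply: lime_le; first exact: is_cvg_nneseries.
  apply: nearW => n; rewrite big_mkord.
  apply: (@le_trans _ _ (\sum_(i < n) (c * 2 ^- i)%:E)%E); first exact: lee_sum.
  rewrite sumEFin lee_fin -mulr_sumr mulrC ler_wpM2r//.
  suff -> : \sum_(i < n) 2 ^- i = 2 - 2 * 2 ^- n :> R by rewrite gerBl mulr_ge0.
  elim: n => [|n IH]; first by rewrite big_ord0 expr0 invr1 mulr1 subrr.
  by rewrite big_ord_recr/= IH exprS; field; rewrite expf_neq0.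
exists (lim_sup_set E); split.
- apply: bigcap_measurable => // k _; exact: bigcup_measurable.
- exact: lim_sup_set_cvg0.
- move=> t /= H n _; apply: contrapT => nE; apply: H; exists n => i ni Ei.
  by apply: nE; exists i.
Qed.

Section blocks.
Context (R : realType).

(** Block i ignores the indices below i, so that only late centres receive mass. *)
Definition block_weight (i k : nat) : R := if (i <= k)%N then k.+1%:R^-1 else 0.

Lemma block_weight_ge0 i k : 0 <= block_weight i k.
Proof. by rewrite /block_weight; case: ifP. Qed.

Lemma block_weight_unbounded (i : nat) (B : R) :
  exists M, B <= \sum_(k < M) block_weight i k.
Proof.
apply: contrapT => H; apply: (@dvg_harmonic R).
apply: nondecreasing_is_cvgn.
  apply/nondecreasing_seqP => n; rewrite /series/= big_nat_recr//= lerDl.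
  exact: harmonic_ge0.
(* The i terms missing from the harmonic series are at most 1 each; were the weights bounded by B,
   the series would be bounded by i + B. *)
exists (i%:R + B) => _ [n _ <-]; rewrite /series/= big_mkord.
apply: (@le_trans _ _ (\sum_(k < n) ((k < i)%N%:R + block_weight i k))).
  apply: ler_sum => k _; rewrite /harmonic/= /block_weight [(i <= k)%N]leqNgt.
  case: (ltnP k i) => _ /=; last by rewrite add0r.
by rewrite addr0 invf_le1// ler1n.
rewrite big_split/=; apply: lerD.
  rewrite -natr_sum ler_nat.
  elim: n => [|n IH]; first by rewrite big_ord0.
  rewrite big_ord_recr/=; case: (ltnP n i) => ni; last by rewrite addn0.
  apply: (@leq_trans n.+1) => //; rewrite -addn1 leq_add2r.
  apply: (@leq_trans (\sum_(k < n) 1)); last by rewrite sum1_card card_ord.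
  by apply: leq_sum => k _; rewrite leq_b1.
by rewrite leNgt; apply/negP => /ltW Bn; apply: H; exists n.
Qed.

(** Mass at least 2^i in block i makes the variances O(2^-i), hence summable over the blocks. *)
Definition block_end (i : nat) : nat :=
  sval (cid (block_weight_unbounded i (2 ^+ i))).

Definition block_mass (i : nat) : R := \sum_(k < block_end i) block_weight i k.

Lemma block_mass_ge i : 2 ^+ i <= block_mass i.
Proof. exact: (svalP (cid (block_weight_unbounded i (2 ^+ i)))). Qed.

Lemma block_mass_gt0 i : 0 < block_mass i.
Proof. by apply: lt_le_trans (block_mass_ge i); rewrite exprn_gt0. Qed.

Definition block_prob (i k : nat) : R := block_weight i k / block_mass i.

Lemma block_prob_ge0 i k : 0 <= block_prob i k.
Proof. by rewrite divr_ge0 ?block_weight_ge0 ?ltW ?block_mass_gt0. Qed.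

Lemma sum_block_prob i : \sum_(k < block_end i) block_prob i k = 1.
Proof. by rewrite -mulr_suml divff// gt_eqF ?block_mass_gt0. Qed.

(* The node around c_k has self-energy of order k + 1: this bound makes the
   diagonal terms of the energies negligible. *)
Lemma sum_block_prob_sqrM i :
  \sum_(k < block_end i) block_prob i k ^+ 2 * k.+1%:R <= 2 ^- i.
Proof.
apply: (@le_trans _ _ (\sum_(k < block_end i) block_weight i k / block_mass i ^+ 2)).
  apply: ler_sum => k _; rewrite /block_prob exprMn exprVn mulrAC.
  apply: ler_wpM2r; first by rewrite invr_ge0 exprn_ge0// ltW// block_mass_gt0.
  rewrite /block_weight; case: ifP => _; last by rewrite expr0n mul0r.
  by rewrite expr2 -mulrA mulVf// mulr1.
rewrite -mulr_suml -/(block_mass i) expr2 invfM mulrA divff ?gt_eqF ?block_mass_gt0//.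
by rewrite mul1r lef_pV2 ?block_mass_ge// posrE ?exprn_gt0 ?block_mass_gt0.
Qed.

Lemma sum_block_prob_sqr i : \sum_(k < block_end i) block_prob i k ^+ 2 <= 2 ^- i.
Proof.
apply: le_trans (sum_block_prob_sqrM i); apply: ler_sum => k _.
by rewrite ler_peMr ?sqr_ge0// ler1n.
Qed.

End blocks.

Section block_laws.
Context d (T : measurableType d) (R : realType) (P : probability T R).
Variables (X : nat -> {RV P >-> R}) (f : R -> R).
Hypothesis indX : mutually_independent X.
Hypothesis mf : measurable_fun setT f.
Hypothesis f0 : forall x, 0 <= f x.
Hypothesis lawX : forall (k : nat) (A : set R), measurable A ->
     P (X k @^-1` A) =
     (\int[@lebesgue_measure R]_(x in A `&` `[0%R, 1%R]) (f x)%:E)%E.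
Local Notation mu := (@lebesgue_measure R).
Variable delta : R.
Hypothesis delta0 : 0 < delta.
Implicit Types A B : set R.
Local Notation a := (@block_prob R).
Local Notation M := (@block_end R).

(** Markov's inequality for V^2 gives summable probabilities, and Borel-Cantelli applies; nothing is
    assumed about the dependence between blocks. *)
Let chebyshev_ae (V : nat -> T -> R) (c eps : R) : 0 < eps ->
  (forall i, bounded_measurable (V i)) ->
  (forall i, Ex P (fun t => V i t ^+ 2) <= c * 2 ^- i) ->
  {ae P, forall t, exists i0, forall i, (i0 <= i)%N -> `|V i t| < eps}.
Proof.
move=> e0 bV Vc.
have bV2 i : bounded_measurable (fun t => V i t ^+ 2).
  by under eq_fun do rewrite expr2; exact: bounded_measurableM.
have e20 : 0 < eps ^+ 2 by rewrite exprn_gt0.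
have : {ae P, forall t, exists i0, forall i, (i0 <= i)%N ->
    ~ [set t | (eps ^+ 2 <= V i t ^+ 2)%R] t}.
  apply: (borel_cantelli_pow2 (c := eps ^- 2 * c)) => i.
    rewrite -[X in measurable X]setTI.
    by apply: measurable_fun_le => //; exact: (bV2 i).1.
  apply: le_trans (Ex_markov P (bV2 i) _ e20) _ => [t|]; first exact: sqr_ge0.
  by rewrite lee_fin -mulrA ler_wpM2l// invr_ge0 ltW.
apply: filterS => t [i0 H]; exists i0 => i ii0; have /= := H i ii0.
move/negP; rewrite -ltNge -[V i t ^+ 2]real_normK ?num_real// ltr_pXn2r// nnegrE ltW//.
Qed.

Lemma block_average_ae A (eps : R) : good_set f delta A -> 0 < eps ->
  {ae P, forall t, exists i0, forall i, (i0 <= i)%N ->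
    fine (mu A) - eps < \sum_(k < M i) a i k * inv_density f A (X k t)}.
Proof.
move=> gA e0; set m := fine (mu A).
have bh k : bounded_measurable (fun t => inv_density f A (X k t)).
  by apply: bounded_measurable_comp => //; exact: (bounded_inv_density mf f0 delta0).
have m0 : 0 <= m by rewrite fine_ge0.
have cst r := @bounded_measurable_cst _ T R r.
pose V i t := \sum_(k < M i) a i k * (inv_density f A (X k t) - m).
have : {ae P, forall t, exists i0, forall i, (i0 <= i)%N -> `|V i t| < eps}.
  apply: (@chebyshev_ae _ (delta ^- 2)) => // i.
    apply: bounded_measurable_sum => k.
    by apply: bounded_measurableM => //; exact: bounded_measurableB.
  apply: (@le_trans _ _ (delta ^- 2 * \sum_(k < M i) a i k ^+ 2)); last first.
    apply: ler_wpM2l; first by rewrite invr_ge0 exprn_ge0// ltW.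
    exact: sum_block_prob_sqr.
  apply: (@Ex_variance_sum _ _ _ P (M i) (a i) (fun k t => inv_density f A (X k t)) m (delta ^- 2)) => //.
  - by move=> k; exact: block_prob_ge0.
  - by move=> k; exact: (Ex_inv_density mf f0 lawX delta0).
  - move=> k j kj.
    have := @Ex_independent _ _ _ P _ R _ R (X k) (X j) (inv_density f A) (inv_density f A).
    move=> ->//.
    + by rewrite !(Ex_inv_density mf f0 lawX delta0).
    + by move=> B C mB mC; exact: independent2.
    + exact: (bounded_inv_density mf f0 delta0).
    + exact: (bounded_inv_density mf f0 delta0).
    + exact: inv_density_ge0.
    + exact: inv_density_ge0.
  - move=> k; apply: (@le_trans _ _ (Ex P (fun=> delta ^- 2))); last by rewrite Ex_cst.
    apply: Ex_le => //; first exact: bounded_measurableM.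
    move=> t; rewrite -exprVn expr2; have h0 := inv_density_ge0 f0 A (X k t).
    by have h1 := inv_density_le delta0 (X k t) gA; exact: ler_pM.
apply: filterS => t [i0 H]; exists i0 => i /H; rewrite ltr_norml => /andP[+ _].
have -> : V i t = \sum_(k < M i) a i k * inv_density f A (X k t) - m.
  rewrite /V; under eq_bigr do rewrite mulrBr.
  by rewrite sumrB -mulr_suml sum_block_prob mul1r.
lra.
Qed.

(** The truncation level n i may vary with the block because both the bound mbar on the means and
    the second moments are uniform in it. The diagonal is left out here and estimated separately. *)
Lemma block_energy_ae A B (n : nat -> nat) (mbar eps : R) :
  good_set f delta A -> good_set f delta B -> 0 < eps ->
  (forall n, Ex P (fun t => pair_kernel f n A B (X 0 t, X 1 t)) <= mbar) ->
  {ae P, forall t, exists i0, forall i, (i0 <= i)%N ->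
    \sum_(k < M i) \sum_(j < M i) (if k == j then 0 else
       a i k * a i j * pair_kernel f (n i) A B (X k t, X j t)) < mbar + eps}.
Proof.
move=> gA gB e0 mE.
pose Y i k j t := pair_kernel f (n i) A B (X k t, X j t).
have bY i k j : bounded_measurable (Y i k j).
  apply: (bounded_measurable_comp (X := RVpair X k j)) => //.
  exact: (bounded_pair_kernel mf f0 delta0).
have Y0 i k j t : 0 <= Y i k j t by exact: pair_kernel_ge0.
pose m i := Ex P (Y i 0%N 1%N).
have m0 i : 0 <= m i by exact: Ex_ge0.
have Ym i k j : k != j -> Ex P (Y i k j) = m i.
  by move=> kj; exact: (Ex_pair_kernel_law indX mf f0 lawX delta0).
have cst r := @bounded_measurable_cst _ T R r.
pose V i t := \sum_(k < M i) \sum_(j < M i)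
     (if k == j then 0 else a i k * a i j * (Y i k j t - m i)).
have : {ae P, forall t, exists i0, forall i, (i0 <= i)%N -> `|V i t| < eps}.
  apply: (@chebyshev_ae _ (4 * (12 * delta ^- 2))) => // i.
    apply: bounded_measurable_sum => k; apply: bounded_measurable_sum => j.
    case: (k == j); first exact: cst.
    by apply: bounded_measurableM => //; exact: bounded_measurableB.
  have d2 : 0 <= delta ^- 2 by rewrite invr_ge0 exprn_ge0// ltW.
  apply: (@le_trans _ _ (4 * (12 * delta ^- 2) * \sum_(k < M i) a i k ^+ 2)); last first.
    by apply: ler_wpM2l; [rewrite !mulr_ge0|exact: sum_block_prob_sqr].
  apply: (@Ex_variance_pairs _ _ _ P (M i) (a i) (Y i) (m i) (12 * delta ^- 2)) => //.
  - by move=> k; exact: block_prob_ge0.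
  - exact: sum_block_prob.
  - by move=> k j; exact: Ym.
  - move=> k j k' j' U.
    have kj : k != j by move: U; rewrite /= !inE !negb_or => /andP[/andP[]].
    have kj' : k' != j'.
      by move: U; rewrite /= !inE !negb_or => /andP[_ /andP[_ /andP[]]].
    pose g : R * R -> R := pair_kernel f (n i) A B.
    have bg : bounded_measurable g by exact: (bounded_pair_kernel mf f0 delta0).
    have g0 z : 0 <= g z by exact: pair_kernel_ge0.
    have := Ex_independent (U := RVpair X k j) (V := RVpair X k' j')
      (fun E F => @independent_pairs _ _ _ _ _ indX k j k' j' E F U) bg bg g0 g0.
    by rewrite -[Ex P (fun t => g (RVpair X k j t))]/(Ex P (Y i k j))
      -[Ex P (fun t => g (RVpair X k' j' t))]/(Ex P (Y i k' j')) !Ym// => <-.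
  - move=> k j k' j' kj kj'.
    have C2 k1 j1 : k1 != j1 -> Ex P (fun t => Y i k1 j1 t ^+ 2) <= 12 * delta ^- 2.
      by move=> kj1; exact: (Ex_pair_kernel_sqr indX mf f0 lawX delta0).
    have b2 k1 j1 : bounded_measurable (fun t => Y i k1 j1 t ^+ 2).
      by under eq_fun do rewrite expr2; exact: bounded_measurableM.
    (* From u v <= (u^2 + v^2) / 2: mixed moments reduce to second moments, even for pairs that
       share an index. *)
    apply: (@le_trans _ _ (Ex P (fun t => 2^-1 * (Y i k j t ^+ 2 + Y i k' j' t ^+ 2)))).
      apply: Ex_le; first exact: bounded_measurableM.
        by apply: bounded_measurableM => //; exact: bounded_measurableD.
      move=> t; have := sqr_ge0 (Y i k j t - Y i k' j' t); rewrite sqrrB mulr2n.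
      set u := Y i k j t; set v := Y i k' j' t; move=> H; nra.
    rewrite ExZ; last exact: bounded_measurableD.
    rewrite ExD//; have := C2 _ _ kj; have := C2 _ _ kj'.
    set u := Ex P _; set v := Ex P _; set w := 12 * _ => H1 H2; lra.
apply: filterS => t [i0 H]; exists i0 => i /H; rewrite ltr_norml => /andP[_].
move=> Vlt.
(* Without the diagonal the total weight s is at most 1, so the mean m i * s of the double sum stays
   below mbar. *)
pose s := \sum_(k < M i) \sum_(j < M i) (if k == j then 0 else a i k * a i j).
have s1 : s <= 1.
  apply: (@le_trans _ _ (\sum_(k < M i) \sum_(j < M i) a i k * a i j)).
    apply: ler_sum => k _; apply: ler_sum => j _; case: ifP => // _.
    by rewrite mulr_ge0// block_prob_ge0.
  under eq_bigr do rewrite -mulr_sumr sum_block_prob mulr1.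
  by rewrite sum_block_prob.
have s0 : 0 <= s.
  apply: sumr_ge0 => k _; apply: sumr_ge0 => j _; case: ifP => // _.
  by rewrite mulr_ge0// block_prob_ge0.
have -> : \sum_(k < M i) \sum_(j < M i) (if k == j then 0 else
       a i k * a i j * pair_kernel f (n i) A B (X k t, X j t)) = V i t + m i * s.
  rewrite /V /s mulr_sumr -big_split/=; apply: eq_bigr => k _.
  rewrite mulr_sumr -big_split/=; apply: eq_bigr => j _.
  by case: (k == j); [rewrite mulr0 addr0|rewrite /Y; ring].
rewrite addrC; apply: ler_ltD => //.
by apply: le_trans (mE (n i)); rewrite -/(m i) ler_piMr.
Qed.

End block_laws.

(** * Dyadic nodes *)

Section dyadic.
Context {R : realType}.

(* The pair (r, n) stands for the dyadic interval [n 2^-r, (n+1) 2^-r]. *)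
Definition dlo (J : nat * nat) : R := J.2%:R * 2 ^- J.1.
Definition dhi (J : nat * nat) : R := J.2.+1%:R * 2 ^- J.1.
Definition dcell (J : nat * nat) : set R := `[dlo J, dhi J[%classic.
Definition valid_node (J : nat * nat) : bool := (J.2 < 2 ^ J.1)%N.
(** Unlike the distance of the two nodes, this length is never 0, and it decreases when the nodes
    shrink: node energies are finite and increase under refinement. *)
Definition hull (J K : nat * nat) : R :=
  Num.max (dhi J) (dhi K) - Num.min (dlo J) (dlo K).
Definition node_energy (J K : nat * nat) : R := - ln (hull J K).
Definition cell (r : nat) (x : R) : nat * nat := (r, Num.truncn (x * 2 ^+ r)).

Implicit Types (J K : nat * nat) (x y : R).

Lemma pow2_gt0 n : 0 < 2 ^- n :> R. Proof. by rewrite invr_gt0 exprn_gt0. Qed.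
Hint Resolve pow2_gt0 : core.

Lemma dlo_ge0 J : 0 <= dlo J. Proof. by rewrite mulr_ge0. Qed.

Lemma dhi_sub_dlo J : dhi J - dlo J = 2 ^- J.1.
Proof. by rewrite -mulrBl -natrB// subSnn mul1r. Qed.

Lemma dlo_lt_dhi J : dlo J < dhi J.
Proof. by rewrite -subr_gt0 dhi_sub_dlo. Qed.

Lemma dhi_le1 J : valid_node J -> dhi J <= 1.
Proof. by move=> vJ; rewrite ler_pdivrMr ?exprn_gt0// mul1r -natrX ler_nat. Qed.

Lemma dcell_unit J x : valid_node J -> dcell J x -> 0 <= x < 1.
Proof.
move=> /dhi_le1 h; rewrite /dcell/= in_itv/= => /andP[a b].
by rewrite (le_trans (dlo_ge0 J) a) (lt_le_trans b h).
Qed.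

Lemma dcell_sub_unit J : valid_node J -> dcell J `<=` `[0%R, 1%R].
Proof.
move=> vJ x /(dcell_unit vJ)/andP[a b]; rewrite /= in_itv/= a.
exact: ltW.
Qed.

Lemma cell_dcell r x : 0 <= x -> dcell (cell r x) x.
Proof.
move=> x0; have := truncn_itv (mulr_ge0 x0 (exprn_ge0 r (ler0n R 2))).
move=> /andP[a b]; rewrite /dcell/= in_itv/= /dlo /dhi/=.
by rewrite ler_pdivrMr ?exprn_gt0// ltr_pdivlMr ?exprn_gt0// a b.
Qed.

Lemma valid_cell r x : 0 <= x -> x < 1 -> valid_node (cell r x).
Proof.
move=> x0 x1; rewrite /valid_node/= truncn_lt_nat ?mulr_ge0 ?exprn_ge0//.
by rewrite natrX gtr_pMl ?exprn_gt0.
Qed.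

(** A finer dyadic cell that meets J lies inside J. *)
Lemma cell_subset J r x : dcell J x -> (J.1 <= r)%N ->
  dlo J <= dlo (cell r x) /\ dhi (cell r x) <= dhi J.
Proof.
case: J => q n; rewrite /dcell/= in_itv/= /dlo /dhi/= => /andP[a b] qr.
have x0 : 0 <= x by apply: le_trans a; rewrite mulr_ge0.
have p : (2 : R) ^+ r = 2 ^+ q * 2 ^+ (r - q) by rewrite -exprD subnKC.
have e : 2 ^- q = 2 ^+ (r - q) * 2 ^- r :> R.
  by rewrite p invfM mulrCA divff ?mulr1// expf_neq0.
move: a b; rewrite ler_pdivrMr ?exprn_gt0// ltr_pdivlMr ?exprn_gt0// => a b.
rewrite !e !mulrA !ler_pM2r// -![2 ^+ (r - q)]natrX -!natrM !ler_nat; split.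
  rewrite truncn_ge_nat ?mulr_ge0 ?exprn_ge0//.
  by rewrite natrM natrX p mulrA ler_pM2r ?exprn_gt0.
rewrite truncn_lt_nat ?mulr_ge0 ?exprn_ge0//.
by rewrite natrM natrX p mulrA ltr_pM2r ?exprn_gt0.
Qed.

Lemma hull_size J K : 2 ^- J.1 <= hull J K.
Proof.
by rewrite -dhi_sub_dlo lerB// ?le_max ?ge_min lexx.
Qed.

Lemma hull_gt0 J K : 0 < hull J K.
Proof. exact: lt_le_trans (hull_size J K). Qed.

Lemma hull_dist J K x y : dlo J <= x <= dhi J -> dlo K <= y <= dhi K ->
  `|x - y| <= hull J K.
Proof.
move=> /andP[a b] /andP[c e]; rewrite ler_norml /hull.
have : dhi J <= Num.max (dhi J) (dhi K) by rewrite le_max lexx.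
have : dhi K <= Num.max (dhi J) (dhi K) by rewrite le_max lexx orbT.
have : Num.min (dlo J) (dlo K) <= dlo J by rewrite ge_min lexx.
have : Num.min (dlo J) (dlo K) <= dlo K by rewrite ge_min lexx orbT.
set u := Num.max _ _; set v := Num.min _ _ => *; apply/andP; split; lra.
Qed.

Lemma hull_le1 J K : valid_node J -> valid_node K -> hull J K <= 1.
Proof.
move=> /dhi_le1 vJ /dhi_le1 vK; rewrite lerBlDr.
have : 0 <= Num.min (dlo J) (dlo K) by rewrite le_min !dlo_ge0.
have : Num.max (dhi J) (dhi K) <= 1 by rewrite ge_max vJ vK.
lra.
Qed.

Lemma node_energy_ge0 J K : valid_node J -> valid_node K -> 0 <= node_energy J K.
Proof. by move=> vJ vK; rewrite oppr_ge0 ln_le0// hull_le1. Qed.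

Lemma node_energy_diag J : node_energy J J = ln 2 * J.1%:R.
Proof.
rewrite /node_energy /hull maxxx minxx dhi_sub_dlo lnV ?posrE ?exprn_gt0//.
by rewrite opprK lnXn// mulr_natr.
Qed.

(** If 2^-m <= h < 2^-(m-1) with 0 < m <= n, then exactly m scales are counted, while -ln h <= m ln
    2. *)
Lemma ln_le_count (h : R) n : 0 < h -> 2 ^- n <= h ->
  - ln h <= ln 2 * \sum_(r < n) (h <= 2 ^- r)%R%:R.
Proof.
move=> h0; elim: n => [|n IH] hn.
  by rewrite big_ord0 mulr0 oppr_le0 ln_ge0// -(invr1 R).
have l2 : 0 <= ln 2 :> R by rewrite ln_ge0// ler1n.
have [hn'|hn'] := leP (2 ^- n) h.
  by apply: le_trans (IH hn') _; rewrite ler_wpM2l// big_ord_recr/= lerDl.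
rewrite (eq_bigr (fun=> 1)); last first.
  move=> r _; have -> : h <= 2 ^- r; last by [].
  apply: le_trans (ltW hn') _; rewrite lef_pV2 ?posrE ?exprn_gt0//.
  by rewrite ler_eXn2l ?ltr1n// -ltnS.
rewrite sumr_const card_ord -mulr_natr mul1r mulr_natr -lnXn//.
rewrite -[X in - ln X]invrK lnV ?posrE ?invr_gt0// opprK.
rewrite ler_ln ?posrE ?invr_gt0 ?exprn_gt0//.
by rewrite -[leRHS]invrK lef_pV2 ?posrE.
Qed.

(** The hull contains x and y, so a scale that exceeds the hull also exceeds |x - y|; r <= n ensures
    that no scale is cut off. *)
Lemma node_energy_cell r s n x y : 0 <= x -> 0 <= y -> (r <= n)%N ->
  node_energy (cell r x) (cell s y) <= ln 2 * log_count n x y.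
Proof.
move=> x0 y0 rn.
have hx := hull_size (cell r x) (cell s y).
have hn : 2 ^- n <= hull (cell r x) (cell s y).
  apply: le_trans hx; rewrite lef_pV2 ?posrE ?exprn_gt0//.
  by rewrite ler_eXn2l ?ltr1n.
apply: le_trans (ln_le_count (hull_gt0 _ _) hn) _.
rewrite ler_wpM2l ?ln_ge0 ?ler1n//; apply: ler_sum => i _.
have closed z q : 0 <= z -> dlo (cell q z) <= z <= dhi (cell q z).
  by move=> /(cell_dcell q); rewrite /dcell/= in_itv/= => /andP[-> /ltW->].
have d := hull_dist (closed x r x0) (closed y s y0).
rewrite ler_nat; case: leP => // h; case: leP => // /(le_lt_trans h).
by rewrite ltNge d.
Qed.

End dyadic.

(** The generation is linear in k: when alpha <= 1 and r0 is large, the cell is shorter than half of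
    I_k and so lies inside it. *)
Definition center_node (R : realType) (c : nat -> R) (r0 k : nat) : nat * nat :=
  cell (r0 * k.+1) (c k).

(* Up to an additive constant, ln 2 * minn J.1 K.1 is the largest mutual energy
   that uniform masses on J and K can have. *)
Definition good_centers (R : realType) (r0 : nat) (c : nat -> R) : Prop :=
  forall (F : seq (nat * nat)) (m : nat), all valid_node F ->
  exists (n : nat) (v : nat * nat -> nat -> R),
    [/\ forall J k, 0 <= v J k,
        forall J k, J \in F -> v J k != 0 -> (m <= k)%N /\ dcell J (c k),
        forall J, J \in F -> \sum_(k < n) v J k = 1
      & forall J K, J \in F -> K \in F ->
          \sum_(k < n) \sum_(j < n) v J k * v K j *
            node_energy (center_node c r0 k) (center_node c r0 j) <=
          ln 2 * (minn J.1 K.1 + 6)%:R].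

(** The part of a node on which 1 / f is at most 2^p; f itself may have no positive lower bound. *)
Definition superlevel (R : realType) (f : R -> R) (J : nat * nat) (p : nat) : set R :=
  dcell J `&` [set x | 2 ^- p <= f x].

Section superlevel.
Context (R : realType) (f : R -> R).
Hypothesis mf : measurable_fun setT f.
Hypothesis f0 : forall x, 0 <= f x.
Local Notation mu := (@lebesgue_measure R).
Hypothesis fpos : {ae mu, forall x, x \in `[0, 1] -> 0 < f x}.

Lemma good_superlevel J p : valid_node J -> good_set f (2 ^- p) (superlevel f J p).
Proof.
move=> vJ; split.
- apply: measurableI; first exact: measurable_itv.
  by rewrite -[X in measurable X]setTI; exact: measurable_fun_le.
- by move=> x [Jx _]; exact: dcell_sub_unit vJ _ Jx.
- by move=> x [].
Qed.

Lemma measure_dcell (J : nat * nat) : mu (dcell J) = (2 ^- J.1)%:E.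
Proof.
rewrite lebesgue_measure_itv/= lte_fin dlo_lt_dhi -EFinD.
by rewrite dhi_sub_dlo.
Qed.

Lemma superlevel_le J p : valid_node J -> (mu (superlevel f J p) <= (2 ^- J.1)%:E)%E.
Proof.
move=> vJ; rewrite -measure_dcell; apply: le_measure; rewrite ?inE.
- by case: (good_superlevel p vJ).
- exact: measurable_itv.
- exact: subIsetl.
Qed.

(** As f > 0 almost everywhere, these sets increase to J up to a null set; continuity from below
    applies. *)
Lemma superlevel_cvg J (eps : R) : valid_node J -> 0 < eps ->
  exists p0, forall p, (p0 <= p)%N -> 2 ^- J.1 - eps < fine (mu (superlevel f J p)).
Proof.
move=> vJ e0.
have mA p : measurable (superlevel f J p) by case: (good_superlevel p vJ).
have mU : measurable (\bigcup_p superlevel f J p) by exact: bigcupT_measurable.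
have nd : nondecreasing_seq (superlevel f J).
  move=> p q pq; apply/subsetPset => x [Jx fx]; split => //=.
  apply: le_trans fx; rewrite lef_pV2 ?posrE ?exprn_gt0//.
  by rewrite ler_eXn2l ?ltr1n.
have cv : mu (superlevel f J p) @[p --> \oo] --> mu (\bigcup_p superlevel f J p).
  exact: (@nondecreasing_cvg_mu _ (measurableTypeR R) R lebesgue_measure _ mA mU nd).
have UE : (mu (dcell J) <= mu (\bigcup_p superlevel f J p))%E.
  have [N [mN N0 sN]] := fpos.
  have sub : dcell J `<=` (\bigcup_p superlevel f J p) `|` N.
    move=> x Jx; have [fx|fx] := ltP 0 (f x).
      left.
      have /cvgrPdist_lt/(_ _ fx)[p _ /(_ p (leqnn p))] : 2 ^- p @[p --> \oo] --> (0 : R).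
        under eq_fun do rewrite -exprVn.
        by apply: cvg_expr; rewrite gtr0_norm ?invr_gt0// invf_lt1// ltr1n.
      rewrite sub0r normrN gtr0_norm// => /ltW h.
      by exists p.
    right; apply: sN => /= H; have := H (dcell_sub_unit vJ Jx).
    by rewrite ltNge fx.
  apply: (@le_trans _ _ (mu ((\bigcup_p superlevel f J p) `|` N))).
    by apply: le_measure; rewrite ?inE//; [exact: measurable_itv|exact: measurableU].
  by apply: le_trans (measureU2 _ _ _) _ => //; rewrite [X in (_ + X)%E]N0 adde0.
have Ufin : mu (\bigcup_p superlevel f J p) \is a fin_num.
  rewrite ge0_fin_numE//; apply: (@le_lt_trans _ _ (mu (dcell J))).
    apply: le_measure; rewrite ?inE//; first exact: measurable_itv.
    by move=> x [p _ []].
  by rewrite measure_dcell ltry.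
have U2 : 2 ^- J.1 <= fine (mu (\bigcup_p superlevel f J p)).
  by rewrite -lee_fin fineK// -measure_dcell.
have /cvgrPdist_lt/(_ _ e0)[p0 _ H] : fine (mu (superlevel f J p)) @[p --> \oo] -->
    fine (mu (\bigcup_p superlevel f J p)).
  by rewrite -(fineK Ufin) in cv; exact: fine_cvg cv.
exists p0 => p /H; rewrite ltr_norml => /andP[_].
lra.
Qed.
End superlevel.

Lemma eventually_all (I : eqType) (F : seq I) (Q : I -> nat -> Prop) :
  (forall J, J \in F -> exists i0, forall i, (i0 <= i)%N -> Q J i) ->
  exists i0, forall i, (i0 <= i)%N -> forall J, J \in F -> Q J i.
Proof.
elim: F => [|J F IH] H; first by exists 0%N.
have [|i1 H1] := IH; first by move=> K KF; apply: H; rewrite inE KF orbT.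
have [i2 H2] := H J (mem_head _ _).
exists (maxn i1 i2) => i; rewrite geq_max => /andP[a b] K.
by rewrite inE => /predU1P[->|KF]; [exact: H2|exact: H1].
Qed.

(** * The centres are almost surely good *)

Section good_centers.
Context d (T : measurableType d) (R : realType) (P : probability T R).
Variables (X : nat -> {RV P >-> R}) (f : R -> R).
Hypothesis indX : mutually_independent X.
Hypothesis mf : measurable_fun setT f.
Hypothesis f0 : forall x, 0 <= f x.
Hypothesis lawX : forall (k : nat) (A : set R), measurable A ->
     P (X k @^-1` A) =
     (\int[@lebesgue_measure R]_(x in A `&` `[0%R, 1%R]) (f x)%:E)%E.
Local Notation mu := (@lebesgue_measure R).
Hypothesis fpos : {ae mu, forall x, x \in `[0, 1] -> 0 < f x}.
Local Notation a := (@block_prob R).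
Local Notation M := (@block_end R).
Variable r0 : nat.

Let p2 n : 0 < 2 ^- n :> R. Proof. exact: pow2_gt0. Qed.

Let average (p i : nat) (J : nat * nat) (t : T) : R :=
  \sum_(k < M i) a i k * inv_density f (superlevel f J p) (X k t).

Let offdiag (p i : nat) (J K : nat * nat) (t : T) : R :=
  \sum_(k < M i) \sum_(j < M i) (if k == j then 0 else
    a i k * a i j * pair_kernel f (r0 * M i) (superlevel f J p) (superlevel f K p)
      (X k t, X j t)).

(** [Ex_pair_kernel] yields the generation of the second set; by symmetry the coarser node can be
    put second, which gives the minimum. *)
Lemma Ex_pair_kernel_superlevel n p J K : valid_node J -> valid_node K ->
  Ex P (fun t => pair_kernel f n (superlevel f J p) (superlevel f K p) (X 0 t, X 1 t)) <=
  2 ^- J.1 * 2 ^- K.1 * ((minn J.1 K.1)%:R + 4).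
Proof.
move=> vJ vK.
have H (A B : nat * nat) k j : k != j -> valid_node A -> valid_node B ->
  Ex P (fun t => pair_kernel f n (superlevel f A p) (superlevel f B p) (X k t, X j t)) <=
  2 ^- A.1 * 2 ^- B.1 * (B.1%:R + 4).
  move=> kj vA vB; have gA := good_superlevel mf p vA; have gB := good_superlevel mf p vB.
  apply: le_trans (Ex_pair_kernel indX mf f0 lawX (p2 p) n kj gA gB (superlevel_le mf p vB)) _.
  rewrite -mulrA ler_wpM2r ?mulr_ge0// -lee_fin fineK ?superlevel_le//.
  exact: (good_set_fin gA).
have [JK|KJ] := leqP J.1 K.1.
  rewrite Ex_pair_kernelC.
  by rewrite [_ ^- _ * _ ^- _]mulrC; exact: H.
exact: H.
Qed.

(** All parameters are natural numbers, precision 2^-e included, so countably many null sets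
    suffice. *)
Let ae_laws : {ae P, forall t, forall j1 j2 k1 k2 p e : nat,
  valid_node (j1, j2) -> valid_node (k1, k2) ->
  (exists i0, forall i, (i0 <= i)%N ->
    fine (mu (superlevel f (j1, j2) p)) - 2 ^- e < average p i (j1, j2) t) /\
  (exists i0, forall i, (i0 <= i)%N ->
    offdiag p i (j1, j2) (k1, k2) t <
    2 ^- j1 * 2 ^- k1 * ((minn j1 k1)%:R + 4) + 2 ^- e)}.
Proof.
apply: ae_foralln => j1; apply: ae_foralln => j2; apply: ae_foralln => k1.
apply: ae_foralln => k2; apply: ae_foralln => p; apply: ae_foralln => e.
have [vJ|] := boolP (valid_node (j1, j2)); last by move=> _; exact: aeW.
have [vK|] := boolP (valid_node (k1, k2)); last by move=> _; exact: aeW.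
have gJ := good_superlevel mf p vJ; have gK := good_superlevel mf p vK.
have H1 := block_average_ae indX mf f0 lawX (p2 p) gJ (p2 e).
have H2 := @block_energy_ae _ _ _ _ _ _ indX mf f0 lawX _ (p2 p) _ _
  (fun i => r0 * M i)%N _ _ gJ gK (p2 e)
  (fun n => Ex_pair_kernel_superlevel n p vJ vK).
by apply: filterS2 H1 H2.
Qed.

Lemma good_centers_ae : {ae P, forall t, good_centers r0 (fun k => X k t)}.
Proof.
apply: filterS ae_laws => t H F m /allP vF.
pose Q := \max_(J <- F) J.1.
have QF J : J \in F -> (J.1 <= Q)%N by move=> JF; exact: leq_bigmax_seq.
(* For 0 <= x <= Q this gives x + 4 + 2 eps <= (1 - 2 eps)^2 (x + 6): the step from + 4 to + 6 pays
   for all errors below. *)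
pose eps : R := (8 * (Q + 6)%:R)^-1.
have Q6 : 0 < (Q + 6)%:R :> R by rewrite ltr0n addnS.
have eps0 : 0 < eps by rewrite invr_gt0 mulr_gt0.
have epsQ : eps * (Q + 6)%:R = 8^-1.
  by rewrite /eps invfM -mulrA mulVf ?mulr1// gt_eqF.
have [p /(_ p (leqnn p)) Hp] := eventually_all (Q := fun J p => 2 ^- J.1 - eps * 2 ^- J.1 <
  fine (mu (superlevel f J p))) (fun J JF => superlevel_cvg mf fpos (vF J JF)
  (mulr_gt0 eps0 (p2 J.1))).
have small c : 0 < c -> exists n0, forall n, (n0 <= n)%N -> 2 ^- n <= c :> R.
  move=> c0.
  have /cvgrPdist_lt/(_ _ c0)[n0 _ Hn] : 2 ^- n @[n --> \oo] --> (0 : R).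
    under eq_fun do rewrite -exprVn.
    by apply: cvg_expr; rewrite gtr0_norm ?invr_gt0// invf_lt1// ltr1n.
  by exists n0 => n /Hn; rewrite sub0r normrN gtr0_norm// => /ltW.
(* Error budget, at most eps 2^-J.1 2^-K.1 for all J, K in F; it is spent once on the fluctuation
   2^-e and once on the diagonal. *)
pose s := eps * (2 ^- Q * 2 ^- Q) : R.
have s0 : 0 < s by rewrite !mulr_gt0.
have [e /(_ e (leqnn e)) He] := small _ s0.
(* Up to ln 2, a diagonal term is at most c a_k^2 (k + 1): two weights bounded by 2^p and a node of
   generation r0 (k + 1). *)
pose c := r0%:R * (2 ^+ p * 2 ^+ p) : R.
have c0 : 0 <= c by rewrite mulr_ge0// mulr_ge0// exprn_ge0.
have [i1 Hi1] : exists n0, forall n, (n0 <= n)%N -> c * 2 ^- n <= s.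
  have [|n0 Hn0] := small (s / (c + 1)); first by rewrite divr_gt0// ltr_wpDl.
  exists n0 => n /Hn0; rewrite ler_pdivlMr ?ltr_wpDl// => h; apply: le_trans h.
  by rewrite mulrC; apply: ler_wpM2l; rewrite ?lerDl// ltW.
have [i2 Hi2] := eventually_all (Q := fun J i =>
   fine (mu (superlevel f J p)) - 2 ^- e < average p i J t)
   (fun J JF => (H J.1 J.2 J.1 J.2 p e (vF J JF) (vF J JF)).1).
have [i3 Hi3] := eventually_all (F := [seq (J, K) | J <- F, K <- F])
   (Q := fun JK i => offdiag p i JK.1 JK.2 t <
    2 ^- JK.1.1 * 2 ^- JK.2.1 * ((minn JK.1.1 JK.2.1)%:R + 4) + 2 ^- e)
   (fun JK JKF => ltac:(move: JKF => /allpairsP[[J K] [JF KF ->]];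
      exact: (H J.1 J.2 K.1 K.2 p e (vF J JF) (vF K KF)).2)).
pose i := maxn m (maxn i1 (maxn i2 i3)).
have mi : (m <= i)%N by rewrite leq_maxl.
have {}Hi1 : c * 2 ^- i <= s by apply: Hi1; rewrite !leq_max leqnn !orbT.
have {}Hi2 := Hi2 i ltac:(by rewrite !leq_max leqnn !orbT).
have {}Hi3 := Hi3 i ltac:(by rewrite !leq_max leqnn !orbT).
pose h J k := inv_density f (superlevel f J p) (X k t).
have h0 J k : 0 <= h J k by exact: inv_density_ge0.
have hcell J k : h J k != 0 -> dcell J (X k t).
  rewrite /h /inv_density indicE; have [/set_mem[]//|_] := boolP (_ \in _).
  by rewrite mul0r eqxx.
have hle J k : J \in F -> h J k <= 2 ^+ p.
  move=> JF; rewrite -[leRHS]invrK.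
  exact: (inv_density_le (p2 p) (X k t) (good_superlevel mf p (vF J JF))).
(* The mass that block i puts on J, close to 2^-J.1; dividing by it normalises the weights v. *)
pose W J := average p i J t.
have W0 J : 0 <= W J.
  by apply: sumr_ge0 => k _; apply: mulr_ge0; [exact: block_prob_ge0|exact: h0].
have WJ J : J \in F -> 2 ^- J.1 * (1 - 2 * eps) <= W J.
  move=> JF; have := Hi2 J JF; rewrite -/(W J); have := Hp J JF.
  have : 2 ^- e <= eps * 2 ^- J.1.
    apply: le_trans He _; apply: ler_wpM2l; first exact: ltW.
    apply: (@le_trans _ _ (2 ^- Q * 1)).
      apply: ler_wpM2l; [exact: ltW|rewrite invf_le1 ?exprn_gt0//].
      by rewrite exprn_ege1// ler1n.
    by rewrite mulr1 lef_pV2 ?posrE ?exprn_gt0// ler_eXn2l ?ltr1n// QF.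
  set u := fine _; set w := W J; set z := 2 ^- J.1; set y := 2 ^- e.
  move=> *; lra.
have eps2 : 0 < 1 - 2 * eps.
  suff : eps <= 8^-1 by lra.
  rewrite -epsQ -[leLHS]mulr1; apply: ler_wpM2l; first exact: ltW.
  by rewrite ler1n addnS.
have Wgt0 J : J \in F -> 0 < W J.
  by move=> JF; apply: lt_le_trans (WJ J JF); rewrite mulr_gt0.
exists (M i), (fun J k => a i k * h J k / W J); split.
- by move=> J k; rewrite divr_ge0// mulr_ge0// block_prob_ge0.
- move=> J k JF; rewrite mulf_eq0 negb_or => /andP[+ _].
  rewrite mulf_eq0 negb_or => /andP[ak hk]; split; last exact: hcell hk.
  apply: leq_trans mi _; move: ak; apply: contraR; rewrite -ltnNge => ki.
  by rewrite /block_prob /block_weight leqNgt ki mul0r.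
- move=> J JF; rewrite -mulr_suml divff// gt_eqF//; exact: Wgt0.
- move=> J K JF KF.
  have l2 : 0 <= ln 2 :> R by rewrite ln_ge0// ler1n.
  pose G (k j : 'I_(M i)) : R := if k == j
    then (2 ^+ p * 2 ^+ p) * r0%:R * (a i k ^+ 2 * k.+1%:R)
    else a i k * a i j * pair_kernel f (r0 * M i) (superlevel f J p) (superlevel f K p)
      (X k t, X j t).
  have termwise (k j : 'I_(M i)) : a i k * h J k * (a i j * h K j) *
      node_energy (center_node (fun k => X k t) r0 k) (center_node (fun k => X k t) r0 j) <=
      ln 2 * G k j.
    have G0 : 0 <= ln 2 * G k j.
      apply: mulr_ge0 => //; rewrite /G; case: ifP => _.
        have q0 : 0 <= 2 ^+ p :> R by rewrite exprn_ge0.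
        by apply: mulr_ge0; rewrite mulr_ge0 ?sqr_ge0// mulr_ge0.
      apply: mulr_ge0; last exact: pair_kernel_ge0.
      by apply: mulr_ge0; exact: block_prob_ge0.
    have [z|hk] := eqVneq (h J k) 0; first by rewrite z mulr0 !mul0r.
    have [z|hj] := eqVneq (h K j) 0; first by rewrite z !(mulr0, mul0r).
    have Xk : 0 <= X k t by have /andP[] := dcell_unit (vF J JF) (hcell _ _ hk).
    have Xj : 0 <= X j t by have /andP[] := dcell_unit (vF K KF) (hcell _ _ hj).
    have aa : 0 <= a i k * a i j by rewrite mulr_ge0// block_prob_ge0.
    rewrite /G; case: eqP => [kj|_].
      rewrite -kj node_energy_diag/= natrM.
      have -> : a i k * h J k * (a i k * h K k) * (ln 2 * (r0%:R * k.+1%:R)) =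
        (ln 2 * r0%:R * (a i k ^+ 2 * k.+1%:R)) * (h J k * h K k) by ring.
      have -> : ln 2 * (2 ^+ p * 2 ^+ p * r0%:R * (a i k ^+ 2 * k.+1%:R)) =
        (ln 2 * r0%:R * (a i k ^+ 2 * k.+1%:R)) * (2 ^+ p * 2 ^+ p) by ring.
      apply: ler_wpM2l.
        by apply: mulr_ge0; [exact: mulr_ge0|rewrite mulr_ge0 ?sqr_ge0].
      by apply: ler_pM => //; exact: hle.
    have -> : a i k * h J k * (a i j * h K j) = a i k * a i j * (h J k * h K j) by ring.
    have -> : ln 2 * (a i k * a i j * pair_kernel f (r0 * M i) (superlevel f J p)
        (superlevel f K p) (X k t, X j t)) = a i k * a i j * (h J k * h K j) *
        (ln 2 * log_count (r0 * M i) (X k t) (X j t)).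
      by rewrite /pair_kernel/= -/(h J k) -/(h K j); ring.
    apply: ler_wpM2l; first by rewrite mulr_ge0// mulr_ge0.
    by apply: node_energy_cell => //; rewrite leq_mul2l ltn_ord orbT.
  have GE : \sum_(k < M i) \sum_(j < M i) G k j <= offdiag p i J K t + s.
    have -> : \sum_(k < M i) \sum_(j < M i) G k j = offdiag p i J K t +
        c * \sum_(k < M i) a i k ^+ 2 * k.+1%:R.
      rewrite /offdiag mulr_sumr -big_split/=; apply: eq_bigr => k _.
      rewrite (bigD1 k)//= [in RHS](bigD1 k)//= /G eqxx add0r addrC; congr (_ + _).
        by apply: eq_bigr => j; rewrite eq_sym => /negbTE ->.
      by rewrite /c; ring.
    rewrite lerD2l; apply: le_trans Hi1; rewrite ler_wpM2l//.
    exact: sum_block_prob_sqrM.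
  have off : offdiag p i J K t <
      2 ^- J.1 * 2 ^- K.1 * ((minn J.1 K.1)%:R + 4) + 2 ^- e.
    by apply: (Hi3 (J, K)); apply/allpairsP; exists (J, K).
  have sJK : s <= 2 ^- J.1 * 2 ^- K.1 * eps.
    rewrite /s mulrC; apply: ler_wpM2r; first exact: ltW.
    apply: ler_pM; [exact: ltW|exact: ltW| |].
      by rewrite lef_pV2 ?posrE ?exprn_gt0// ler_eXn2l ?ltr1n// QF.
    by rewrite lef_pV2 ?posrE ?exprn_gt0// ler_eXn2l ?ltr1n// QF.
  have -> : \sum_(k < M i) \sum_(j < M i) a i k * h J k / W J * (a i j * h K j / W K) *
      node_energy (center_node (fun k => X k t) r0 k) (center_node (fun k => X k t) r0 j)
      = (W J * W K)^-1 * \sum_(k < M i) \sum_(j < M i) a i k * h J k * (a i j * h K j) *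
      node_energy (center_node (fun k => X k t) r0 k) (center_node (fun k => X k t) r0 j).
    rewrite mulr_sumr; apply: eq_bigr => k _; rewrite mulr_sumr.
    by apply: eq_bigr => j _; rewrite invfM; ring.
  rewrite ler_pdivrMl ?mulr_gt0 ?Wgt0//.
  apply: (@le_trans _ _ (ln 2 * \sum_(k < M i) \sum_(j < M i) G k j)).
    rewrite mulr_sumr; apply: ler_sum => k _; rewrite mulr_sumr.
    by apply: ler_sum => j _; exact: termwise.
  rewrite [leRHS]mulrCA; apply: ler_wpM2l => //.
  apply: le_trans GE _.
  have x0 : 0 <= (minn J.1 K.1)%:R :> R by [].
  have xQ : (minn J.1 K.1)%:R <= Q%:R :> R by rewrite ler_nat geq_min QF.
  apply: (@le_trans _ _ (2 ^- J.1 * 2 ^- K.1 * ((minn J.1 K.1)%:R + 4 + 2 * eps))).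
    move: off He sJK; set u := offdiag _ _ _ _ _; set x := (minn _ _)%:R.
    set z := 2 ^- J.1 * 2 ^- K.1; set y := 2 ^- e; move=> *; nra.
  (* Both normalising masses are replaced by their lower bounds [WJ]. *)
  apply: (@le_trans _ _ (2 ^- J.1 * (1 - 2 * eps) * (2 ^- K.1 * (1 - 2 * eps)) *
    ((minn J.1 K.1) + 6)%:R)); last first.
    apply: ler_wpM2r => //; apply: ler_pM; [| |exact: WJ|exact: WJ].
      by apply: mulr_ge0; exact: ltW.
    by apply: mulr_ge0; exact: ltW.
  have -> : 2 ^- J.1 * (1 - 2 * eps) * (2 ^- K.1 * (1 - 2 * eps)) * (minn J.1 K.1 + 6)%:R =
    2 ^- J.1 * 2 ^- K.1 * ((1 - 2 * eps) * (1 - 2 * eps) * (minn J.1 K.1 + 6)%:R).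
    set z1 := 2 ^- J.1; set z2 := 2 ^- K.1; ring.
  apply: ler_wpM2l; first by apply: mulr_ge0; exact: ltW.
  move: epsQ x0 xQ eps0; rewrite !natrD; set x := (minn _ _)%:R; set q := Q%:R.
  move=> *; nra.
Qed.

End good_centers.

(** * Logarithmic energy in the plane *)

Section log_energy.
Context {R : realType}.
Implicit Types (z w : R * R) (mu : probability (R * R)%type R).

Lemma measurable_logkernel :
  measurable_fun setT (fun p : (R * R) * (R * R) => logkernel p.1 p.2).
Proof.
have m11 : measurable_fun setT (fun p : (R * R) * (R * R) => p.1.1).
  exact: (measurableT_comp measurable_fst measurable_fst).
have m12 : measurable_fun setT (fun p : (R * R) * (R * R) => p.1.2).
  exact: (measurableT_comp measurable_snd measurable_fst).
have m21 : measurable_fun setT (fun p : (R * R) * (R * R) => p.2.1).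
  exact: (measurableT_comp measurable_fst measurable_snd).
have m22 : measurable_fun setT (fun p : (R * R) * (R * R) => p.2.2).
  exact: (measurableT_comp measurable_snd measurable_snd).
have md : measurable_fun setT (fun p : (R * R) * (R * R) => cdist p.1 p.2).
  rewrite /cdist.
  apply: (measurableT_comp (f := @Num.sqrt R)).
    by apply: continuous_measurable_fun; exact: sqrt_continuous.
  by apply: measurable_funD; apply: measurable_funX; exact: measurable_funB.
rewrite /logkernel; apply: measurable_fun_ifT => //.
  by apply: measurable_fun_eqr.
apply/measurable_EFinP; apply: measurable_funN.
exact: (measurableT_comp (@measurable_ln R) md).
Qed.

(** A countable base of the plane: it makes open sets measurable and reduces arbitrary unions of
    null open sets to countable ones. *)
Definition rat_box (q : rat * rat * rat * rat) : set (R * R) :=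
  `]ratr q.1.1.1, ratr q.1.1.2[ `*` `]ratr q.1.2, ratr q.2[.

Lemma measurable_rat_box q : measurable (rat_box q).
Proof. by apply: measurableX; exact: measurable_itv. Qed.

Lemma open_rat_box (U : set (R * R)) z : open U -> U z ->
  exists q, rat_box q `<=` U /\ rat_box q z.
Proof.
move=> oU Uz.
have [e e0 He] : exists2 e : R, 0 < e & ball z e `<=` U.
  by have := oU; rewrite openE => /(_ _ Uz)/nbhs_ballP[e e0 He]; exists e.
have between (x y : R) : x < y -> exists a : rat, x < ratr a < y.
  by move=> /rat_in_itvoo[a]; rewrite in_itv/= => h; exists a.
have [a /andP[h1 h2]] := between (z.1 - e) z.1 ltac:(lra).
have [b /andP[h3 h4]] := between z.1 (z.1 + e) ltac:(lra).
have [a' /andP[h5 h6]] := between (z.2 - e) z.2 ltac:(lra).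
have [b' /andP[h7 h8]] := between z.2 (z.2 + e) ltac:(lra).
exists (a, b, a', b'); split.
  apply: subset_trans He => -[x y] [/=]; rewrite !in_itv/= => /andP[x1 x2] /andP[y1 y2].
  by split; rewrite /ball/= ltr_distlC; apply/andP; split; lra.
by split => /=; rewrite in_itv/=; apply/andP.
Qed.

(** The default [set0] contributes nothing to a union over all codes n. *)
Let boxes (Q : set (R * R) -> Prop) n : set (R * R) :=
  if unpickle n is Some q then if `[< Q (rat_box q) >] then rat_box q else set0 else set0.

Let mboxes Q n : measurable (boxes Q n).
Proof.
rewrite /boxes; case: unpickle => // q; case: ifP => // _.
exact: measurable_rat_box.
Qed.

Let boxesE (Q : set (R * R) -> Prop) q z : Q (rat_box q) -> rat_box q z ->
  (\bigcup_n boxes Q n) z.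
Proof.
move=> Qq qz; exists (pickle q); first exact: I.
by rewrite /boxes pickleK asboolT.
Qed.

Lemma open_measurable_plane (U : set (R * R)) : open U -> measurable U.
Proof.
move=> oU; have -> : U = \bigcup_n boxes (fun B => B `<=` U) n.
  apply/seteqP; split => z.
    by move=> /(open_rat_box oU)[q [qU qz]]; exact: boxesE qU qz.
  move=> [n _]; rewrite /boxes; case: unpickle => // q.
  by case: asboolP => // qU; exact: qU.
by apply: bigcupT_measurable => n; exact: mboxes.
Qed.

(** A point off the support has a null neighbourhood, hence lies in a null rational box, and there
    are countably many of these. *)
Lemma null_outside_msupport mu :
  exists N, [/\ measurable N, mu N = 0%E & ~` N `<=` msupport mu].
Proof.
pose G n := boxes (fun B => mu B = 0%E) n.
have mG n : measurable (G n) by exact: mboxes.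
have G0 n : mu (G n) = 0%E.
  rewrite /G /boxes; case: unpickle => [q|]; last exact: measure0.
  by case: asboolP => // _; exact: measure0.
exists (\bigcup_n G n); split; first exact: bigcupT_measurable.
  apply/eqP; rewrite eq_le measure_ge0 andbT.
  apply: (@le_trans _ _ (\sum_(n <oo) mu (G n))%E); last first.
    by rewrite eseries0// => i _ _; exact: G0.
  by apply: measure_sigma_subadditive => //; exact: bigcupT_measurable.
move=> z; apply: contra_notP => /existsNP[U /not_implyP[oU /not_implyP[Uz]]].
move=> /negP; rewrite -leNgt => U0.
have [q [qU qz]] := open_rat_box oU Uz.
apply: boxesE qz; apply/eqP; rewrite eq_le measure_ge0 andbT.
apply: le_trans U0; apply: le_measure; rewrite ?inE//.
  exact: measurable_rat_box.
exact: open_measurable_plane.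
Qed.

End log_energy.

Section shifted.
Context {R : realType}.

(** The point is the case where g has integral +oo: the negative part of g - C is at most C, so only
    the positive part diverges. *)
Lemma integralB_cst d (T : measurableType d) (mu : probability T R)
    (g : T -> \bar R) (C : R) : measurable_fun setT g ->
  (forall x, 0 <= g x)%E -> 0 <= C ->
  (\int[mu]_x (g x - C%:E) = \int[mu]_x g x - C%:E)%E.
Proof.
move=> mg g0 C0.
have iC : (\int[mu]_x (C%:E) = C%:E)%E.
  by rewrite integral_cst// [X in (_ * X)%E](@probability_setT _ _ _ mu) mule1.
have intC : mu.-integrable setT (cst C%:E).
  by apply: finite_measure_integrable_cst.
have [gfin|ginf] := ltP (\int[mu]_x g x)%E +oo%E.
  have ig : mu.-integrable setT g.
    apply/integrableP; split => //.
    by under eq_integral do rewrite gee0_abs//.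
  by rewrite integralB// iC.
have gE : (\int[mu]_x g x = +oo)%E by apply/eqP; rewrite eq_le leey.
rewrite gE.
have mf : measurable_fun setT (fun x => g x - C%:E)%E.
  by apply: emeasurable_funB.
rewrite integralE.
set f := (fun x => g x - C%:E)%E in mf *.
have C0' : (0 <= C%:E)%E by rewrite lee_fin.
have neg : (\int[mu]_x f^\- x <= C%:E)%E.
  rewrite -[leRHS]iC; apply: ge0_le_integral => //.
  - exact: measurable_funeneg.
  - move=> x _; rewrite funenegE ge_max C0' andbT /f.
    have := g0 x; case: (g x) => [r r0|_|//]; last by rewrite /= leNye.
    by rewrite -EFinB -EFinN lee_fin; have : 0 <= r := r0; lra.
have pos : (\int[mu]_x f^\+ x = +oo)%E.
  apply/eqP; rewrite eq_le leey/=.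
  have : (\int[mu]_x g x <= \int[mu]_x (f^\+ x + C%:E))%E.
    apply: ge0_le_integral => //.
    - by apply: emeasurable_funD => //; exact: measurable_funepos.
    - move=> y _; rewrite funeposE /f.
      have := g0 y; case: (g y) => [r _|_|//]; last by rewrite /= leey.
      rewrite -EFinB -EFin_max -EFinD lee_fin.
      have : r - C <= Num.max (r - C) 0 by rewrite le_max lexx.
      lra.
  rewrite ge0_integralD//; last exact: measurable_funepos.
  rewrite gE iC; case: (\int[mu]_x f^\+ x)%E => //.
rewrite pos; have : (0 <= \int[mu]_x f^\- x)%E by exact: integral_ge0.
by move: neg; case: (\int[mu]_x f^\- x)%E.
Qed.

Definition shifted_kernel (C : R) (z w : R * R) : \bar R :=
  maxe (logkernel z w + C%:E)%E 0%E.

Lemma shifted_kernel_ge0 C z w : (0 <= shifted_kernel C z w)%E.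
Proof. by rewrite le_max lexx orbT. Qed.

Lemma measurable_shifted_kernel C :
  measurable_fun setT (fun p : (R * R) * (R * R) => shifted_kernel C p.1 p.2).
Proof.
apply: measurable_maxe => //; apply: emeasurable_funD => //.
exact: measurable_logkernel.
Qed.

Definition potential (mu : probability (R * R)%type R) C z : \bar R :=
  (\int[mu]_w shifted_kernel C z w)%E.

Lemma measurable_potential (mu : probability (R * R)%type R) C :
  measurable_fun setT (potential mu C).
Proof.
apply: (@measurable_fun_fubini_tonelli_F _ _ _ _ _ mu
  (fun p => shifted_kernel C p.1 p.2)).
  exact: measurable_shifted_kernel.
by move=> p; exact: shifted_kernel_ge0.
Qed.

Lemma potential_ge0 (mu : probability (R * R)%type R) C z : (0 <= potential mu C z)%E.
Proof. by apply: integral_ge0 => w _; exact: shifted_kernel_ge0. Qed.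

(* The kernel need not be bounded below off the support, hence the truncation in
   shifted_kernel. *)
Lemma energy_shift (mu : probability (R * R)%type R) (C : R) : 0 <= C ->
  (forall z w, msupport mu z -> msupport mu w -> ((- C)%:E <= logkernel z w)%E) ->
  energy mu = (\int[mu]_z potential mu C z - C%:E)%E.
Proof.
move=> C0 KC; have [N [mN N0 sN]] := null_outside_msupport mu.
have mK1 z : measurable_fun setT (fun w => logkernel z w).
  exact: (measurableT_comp measurable_logkernel (measurable_pair1 z)).
have mS1 z : measurable_fun setT (fun w => shifted_kernel C z w).
  exact: (measurableT_comp (measurable_shifted_kernel C) (measurable_pair1 z)).
have inner z : ~ N z ->
    (\int[mu]_w logkernel z w = potential mu C z - C%:E)%E.
  move=> Nz; rewrite -integralB_cst//; last by move=> w; exact: shifted_kernel_ge0.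
  apply: ae_eq_integral => //; [exact: mK1|by apply: emeasurable_funB|].
  exists N; split => // w; apply: contra_notP => Nw _.
  have := KC z w (sN _ Nz) (sN _ Nw); rewrite /shifted_kernel.
  case: (logkernel z w) => [r| |]// h.
  rewrite -EFinD -EFin_max -EFinB; congr EFin; rewrite lee_fin in h.
  by rewrite max_l; lra.
rewrite /energy /interaction.
rewrite -integralB_cst//; [|exact: measurable_potential|exact: potential_ge0].
apply: ae_eq_integral => //.
(* The kernel has no constant sign, so Tonelli is applied to its positive and negative parts. *)
- have -> : (fun z => \int[mu]_w logkernel z w)%E =
    (fun z => \int[mu]_w (fun p : (R * R) * (R * R) => logkernel p.1 p.2)^\+ (z, w) -
       \int[mu]_w (fun p : (R * R) * (R * R) => logkernel p.1 p.2)^\- (z, w))%E.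
    by apply/funext => z; rewrite integralE; congr (_ - _)%E; apply: eq_integral => w _; rewrite ?funeposE ?funenegE.
  apply: emeasurable_funB.
    apply: (@measurable_fun_fubini_tonelli_F _ _ _ _ _ mu
      (fun p : (R * R) * (R * R) => logkernel p.1 p.2)^\+%E) => //.
    by apply: measurable_funepos; exact: measurable_logkernel.
  apply: (@measurable_fun_fubini_tonelli_F _ _ _ _ _ mu
      (fun p : (R * R) * (R * R) => logkernel p.1 p.2)^\-%E) => //.
  by apply: measurable_funeneg; exact: measurable_logkernel.
- by apply: emeasurable_funB => //; exact: measurable_potential.
- by exists N; split => // z; apply: contra_notP => Nz _; exact: inner.
Qed.

Lemma cdist_real (x y : R) : cdist (x, 0) (y, 0) = `|x - y|.
Proof. by rewrite /cdist/= subrr expr0n/= addr0 sqrtr_sqr. Qed.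

Lemma logkernel_ge (z w : R * R) (D : R) : 0 < D -> cdist z w <= D ->
  ((- ln D)%:E <= logkernel z w)%E.
Proof.
move=> D0 zD; rewrite /logkernel; case: eqP => [_|/eqP d0]; first exact: leey.
rewrite lee_fin lerN2 ler_ln ?posrE// lt_def d0.
exact: sqrtr_ge0.
Qed.

End shifted.

(** * Zero capacity *)

Section riemann_tail.
Context {R : realType}.
Implicit Types (u : nat -> R) (alpha : R).

Lemma small_tail u (B : R) : (forall k, 0 <= u k) ->
  (forall n, \sum_(k < n) u k <= B) ->
  forall e, 0 < e -> exists m, forall n, \sum_(i < n) u (m + i)%N < e.
Proof.
move=> u0 uB e e0.
pose S := [set \sum_(k < n) u k | n in [set: nat]].
have supS : has_sup S.
  split; first by exists (\sum_(k < 0) u k), 0%N.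
  by exists B => _ [n _ <-].
have [_ [m _ <-] Hm] := sup_adherent e0 supS.
exists m => n; rewrite -(ltrD2l (\sum_(k < m) u k)).
have -> : \sum_(k < m) u k + \sum_(i < n) u (m + i)%N = \sum_(k < m + n) u k.
  by rewrite big_split_ord.
apply: (@le_lt_trans _ _ (sup S)); last by lra.
by apply: ub_le_sup; [exact: supS.2|exists (m + n)%N].
Qed.

(** Condensation: pairing the terms 2k + 2 and 2k + 3 gives s <= 1 + q s for the partial sums, with
    q = 2^(1 - alpha) < 1. *)
Lemma riemann_bounded alpha : 1 < alpha ->
  exists B, forall n, \sum_(k < n) (k.+1%:R `^ alpha)^-1 <= B :> R.
Proof.
move=> a1; pose a k : R := (k.+1%:R `^ alpha)^-1.
have a0 k : 0 <= a k by rewrite invr_ge0 powR_ge0.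
pose q : R := 2 * (2 `^ alpha)^-1.
have p2 : 0 < 2 `^ alpha :> R by rewrite powR_gt0.
have double k : ((k.+1 * 2)%:R `^ alpha)^-1 = (2 `^ alpha)^-1 * a k :> R.
  by rewrite mulnC natrM powRM// invfM.
have H n : \sum_(k < n.*2.+1) a k <= 1 + q * \sum_(k < n) a k.
  elim: n => [|n IH].
    by rewrite big_ord0 big_ord_recr big_ord0/= add0r mulr0 addr0 /a powR1 invr1.
  rewrite doubleS 2!big_ord_recr/= [in leRHS]big_ord_recr/= mulrDr.
  have e1 : a n.*2.+1 = (2 `^ alpha)^-1 * a n.
    by rewrite -double /a -muln2 -addn2 -[(n * 2 + 2)%N]/(n * 2 + 1 * 2)%N -mulnDl addn1.
  have e2 : a n.*2.+2 <= a n.*2.+1.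
    rewrite /a lef_pV2 ?posrE ?powR_gt0//.
    by apply: ge0_ler_powR; rewrite ?nnegrE ?ler_nat// ltW// (lt_trans _ a1).
  move: IH; set u := \sum_(i < _) _; set v := \sum_(i < n) _.
  rewrite /q; move: e1 e2; set x := a _; set y := a _; set z := a n; set w := (2 `^ _)^-1.
  lra.
have q1 : q < 1.
  rewrite /q -ltr_pdivlMr ?invr_gt0// invrK mul1r.
  by rewrite -ltr_ln ?posrE// ln_powR ltr_pMl// ln_gt0// ltr1n.
exists (1 - q)^-1 => n; rewrite -[leRHS]mul1r ler_pdivlMr ?subr_gt0//.
have h : \sum_(k < n) a k <= \sum_(k < n.*2.+1) a k.
  have -> : n.*2.+1 = (n + n.+1)%N by rewrite addnS addnn.
  by rewrite big_split_ord/= lerDl sumr_ge0.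
have := le_trans h (H n); rewrite -/(a _); set s := \sum_(k < n) _; lra.
Qed.

End riemann_tail.

Section zero_capacity.
Context {R : realType}.
Variables (c l w : nat -> R).
Hypothesis w0 : forall k, 0 < w k.
Hypothesis lw : forall k, l k = expR (- w k).
Hypothesis wsum : exists B, forall n, \sum_(k < n) (w k)^-1 <= B.

Lemma energy_limsup (E : set R) (mu : probability (R * R)%type R) :
  (forall m, E `<=` \bigcup_(k in [set k | (m <= k)%N])
     `](c k - l k / 2), (c k + l k / 2)[%classic) ->
  admissible (embedR E) mu -> energy mu = +oo%E.
Proof.
move=> Ecov [cK KE].
have [B0 [_ /(_ (`|B0| + 1)) HB]] := compact_bounded cK.
pose B := `|B0| + 1.
have {}HB z : msupport mu z -> `|z.1| <= B.
  move=> Kz; apply: le_trans (HB _ z Kz); last by rewrite ltr_pwDr// ler_norm.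
  by rewrite [leRHS]/(Num.max _ _) le_max lexx.
have B0' : 0 < B by rewrite ltr_wpDl.
(* D bounds the distances within the support, and D >= 1 makes the shift C = ln D nonnegative. *)
pose D := 2 * B + 1.
have D1 : 1 <= D by rewrite lerDr mulr_ge0// ltW.
pose C := ln D.
have C0 : 0 <= C by exact: ln_ge0.
have KC z z' : msupport mu z -> msupport mu z' -> ((- C)%:E <= logkernel z z')%E.
  move=> Kz Kz'; apply: logkernel_ge; first by rewrite (lt_le_trans ltr01).
  have := KE _ Kz; have := KE _ Kz'; case: z Kz => x y; case: z' Kz' => x' y'.
  move=> /HB/= h1 /HB/= h2 [/= -> _] [/= -> _]; rewrite cdist_real.
  by apply: le_trans (ler_normB _ _) _; rewrite /D; lra.
rewrite (energy_shift C0 KC).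
have [fin|] := ltP (\int[mu]_z potential mu C z)%E +oo%E; last first.
  by rewrite leye_eq => /eqP ->.
exfalso.
have I0 : (0 <= \int[mu]_z potential mu C z)%E.
  by apply: integral_ge0 => z _; exact: potential_ge0.
have Ifin : (\int[mu]_z potential mu C z)%E \is a fin_num by rewrite ge0_fin_numE.
pose I := fine (\int[mu]_z potential mu C z)%E.
have I0' : 0 <= I by exact: fine_ge0.
have [Bw HBw] := wsum.
(* With t = (4 (I + 1))^-1 both AM-GM terms below are at most 1/4, against a mass above 1/2. I + 1
   stands for I to avoid dividing by 0. *)
have [m Hm] : exists m, forall n, \sum_(i < n) (w (m + i)%N)^-1 < (4 * (I + 1))^-1.
  apply: (@small_tail _ (fun k => (w k)^-1) Bw) => //.
    by move=> k; rewrite invr_ge0 ltW.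
  by rewrite invr_gt0 mulr_gt0// ltr_wpDl.
pose Dm i : set (R * R) :=
  `](c (m + i)%N - l (m + i)%N / 2), (c (m + i)%N + l (m + i)%N / 2)[%classic `*` [set 0].
have mDm i : measurable (Dm i).
  by apply: measurableX; [exact: measurable_itv|exact: measurable_set1].
(* The intervals may overlap: each point is charged to the first one that contains it. *)
pose J := seqDU Dm.
have mJ i : measurable (J i) by exact: seqDU_measurable.
have cov : mu (\bigcup_i J i) = 1%E.
  rewrite -seqDU_bigcup_eq.
  have [N [mN N0 sN]] := null_outside_msupport mu.
  have sub : ~` (\bigcup_i Dm i) `<=` N.
    move=> z; apply: contra_notP => Nz.
    have [z2 Ez] := KE _ (sN _ Nz); have [k /= mk kz] := Ecov m _ Ez.
    exists (k - m)%N => //; rewrite /Dm subnKC//; split => //.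
  have mU : measurable (\bigcup_i Dm i) by exact: bigcupT_measurable.
  have c0 : mu (~` (\bigcup_i Dm i)) = 0%E.
    apply/eqP; rewrite eq_le measure_ge0 andbT -N0.
    by apply: le_measure; rewrite ?inE//; exact: measurableC.
  have := probability_setC mu (measurableC mU); rewrite setCK => ->.
  by rewrite [X in (1 - X)%E]c0 sube0.
pose b i := fine (mu (J i)).
have bE i : mu (J i) = (b i)%:E by rewrite /b fineK// fin_num_measure.
have b0 i : 0 <= b i by exact: fine_ge0.
have sJ i z : J i z -> Dm i z by exact: subset_seqDU.
(* Two points of one interval are at distance at most its length exp(-w), so the kernel is at least
   w there; shift and truncation only raise it. *)
have pot i z : J i z -> ((w (m + i)%N * b i)%:E <= potential mu C z)%E.
  move=> /sJ[zi z2].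
  have -> : (w (m + i)%N * b i)%:E = (\int[mu]_(y in J i) (w (m + i)%N)%:E)%E.
    by rewrite integral_cst// EFinM -bE.
  apply: (@le_trans _ _ (\int[mu]_(y in J i) shifted_kernel C z y)%E).
    apply: ge0_le_integral => //.
    - by move=> y _; rewrite lee_fin ltW.
    - apply: measurable_funTS.
      exact: (measurableT_comp (measurable_shifted_kernel C) (measurable_pair1 z)).
    - move=> y /sJ[yi y2].
      rewrite /shifted_kernel le_max; apply/orP; left.
      have h : ((w (m + i)%N)%:E <= logkernel z y)%E.
        have -> : w (m + i)%N = - ln (l (m + i)%N) by rewrite lw expRK opprK.
        apply: logkernel_ge; first by rewrite lw expR_gt0.
        case: z zi z2 => x x' /= + ->; case: y yi y2 => y y' /= + ->.
        rewrite cdist_real !in_itv/= => /andP[y1 y2] /andP[x1 x2].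
        by rewrite ler_distl; apply/andP; split; lra.
      apply: le_trans h _; by apply: leeDl; rewrite lee_fin.
  apply: ge0_subset_integral => //.
  - exact: (measurableT_comp (measurable_shifted_kernel C) (measurable_pair1 z)).
  - by move=> y _; exact: shifted_kernel_ge0.
have energy_sum n : \sum_(i < n) w (m + i)%N * b i ^+ 2 <= I.
  rewrite -lee_fin /I fineK// -sumEFin.
  apply: (@le_trans _ _ (\sum_(i < n) \int[mu]_(z in J i) potential mu C z)%E).
    apply: lee_sum => i _.
    have -> : (w (m + i)%N * b i ^+ 2)%:E = (\int[mu]_(z in J i) (w (m + i)%N * b i)%:E)%E.
      by rewrite integral_cst// expr2 mulrA EFinM -bE.
    apply: ge0_le_integral => //.
    - by move=> z _; rewrite lee_fin mulr_ge0// ltW.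
    - by apply: measurable_funTS; exact: measurable_potential.
    - by move=> z Jz; exact: pot.
  rewrite -(big_mkord xpredT (fun i => \int[mu]_(z in J i) potential mu C z)%E).
  rewrite -ge0_integral_bigsetU//.
  - apply: ge0_subset_integral => //.
    + by apply: bigsetU_measurable => i _.
    + exact: measurable_potential.
    + by move=> z _; exact: potential_ge0.
  - exact: iota_uniq.
  - by apply: sub_trivIset (trivIset_seqDU Dm).
  - by apply: measurable_funTS; exact: measurable_potential.
  - by move=> z _; exact: potential_ge0.
have [n Hn] : exists n, 2^-1 < \sum_(i < n) b i.
  have cv : (\sum_(i < n) b i)%:E @[n --> \oo] --> mu (\bigcup_i J i).
    have -> : (fun n => (\sum_(i < n) b i)%:E) = (fun n => (\sum_(0 <= i < n) mu (J i))%E).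
      by apply/funext => n; rewrite -sumEFin big_mkord; apply: eq_bigr => i _; rewrite bE.
    apply: measure_semi_sigma_additive => //; first exact: trivIset_seqDU.
    exact: bigcupT_measurable.
  rewrite cov in cv.
  have /fine_cvg/cvgrPdist_lt/(_ 2^-1 ltac:(by rewrite invr_gt0))[n _ /(_ n (leqnn n))] := cv.
  by rewrite /= ltr_norml => /andP[_ h]; exists n; lra.
have tI : 0 < 4 * (I + 1) by rewrite mulr_gt0// ltr_wpDl.
pose t := (4 * (I + 1))^-1.
have t0 : 0 < t by rewrite invr_gt0.
have amgm i : b i <= t * (w (m + i)%N * b i ^+ 2) + (I + 1) * (w (m + i)%N)^-1.
  have wi := w0 (m + i)%N; set v := w _ in wi *; set x := b i.
  have -> : I + 1 = (4 * t)^-1 by rewrite /t invfM invrK mulrA mulVf ?mul1r.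
  rewrite -subr_ge0.
  have -> : t * (v * x ^+ 2) + (4 * t)^-1 / v - x = (t * v)^-1 * (t * v * x - 2^-1) ^+ 2.
    by field; rewrite !gt_eqF.
  by rewrite mulr_ge0 ?sqr_ge0// invr_ge0 mulr_ge0// ltW.
have : \sum_(i < n) b i <= t * I + (I + 1) * \sum_(i < n) (w (m + i)%N)^-1.
  apply: (@le_trans _ _ (\sum_(i < n) (t * (w (m + i)%N * b i ^+ 2) + (I + 1) * (w (m + i)%N)^-1))).
    by apply: ler_sum => i _; exact: amgm.
  rewrite big_split/= -!mulr_sumr lerD2r; apply: ler_wpM2l; first exact: ltW.
  exact: energy_sum.
have h1 : t * I <= 4^-1.
  by rewrite /t mulrC ler_pdivrMr// ; lra.
have h2 : (I + 1) * \sum_(i < n) (w (m + i)%N)^-1 <= 4^-1.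
  apply: (@le_trans _ _ ((I + 1) * (4 * (I + 1))^-1)).
    by apply: ler_wpM2l; [rewrite addr_ge0|exact: ltW].
  by rewrite invfM mulrCA divff ?mulr1// gt_eqF// ltr_wpDl.
move: Hn h1 h2; set u := \sum_(i < n) b i; set v := t * I; set x := (I + 1) * _.
lra.
Qed.

End zero_capacity.

(** * Stages and their refinement *)

Section base_space.
Context {R : realType}.
Local Notation mu := (@lebesgue_measure R).

Definition unit_prob : probability (measurableTypeR R) R := @uniform_prob R 0 1 ltr01.

Lemma unit_probE (A : set R) : measurable A -> unit_prob A = mu (A `&` `[0%R, 1%R]).
Proof.
move=> mA; rewrite /unit_prob/= /uniform_prob integral_uniform_pdf.
rewrite (eq_integral (cst 1%E)); last first.
  move=> x /set_mem[_]; rewrite /= in_itv/= /uniform_pdf => ->.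
  by rewrite subr0 invr1.
by rewrite integral_cst ?mul1e//; apply: measurableI.
Qed.

Section split.
Variables (A : set R) (mA : measurable A).
(** The distribution function of A. It is 1-Lipschitz, so it takes every value from 0 to F 1, and A
    can be cut into pieces of any prescribed masses. *)
Let F (t : R) : R := fine (unit_prob (A `&` `]-oo, t])).

Let mI t : measurable (A `&` `]-oo, t]).
Proof. by apply: measurableI => //; exact: measurable_itv. Qed.

Let FE t : (F t)%:E = unit_prob (A `&` `]-oo, t]).
Proof. by rewrite fineK//; apply: fin_num_measure; exact: mI. Qed.

Let F_homo s t : s <= t -> F s <= F t.
Proof.
move=> st; rewrite -lee_fin !FE; apply: le_measure; rewrite ?inE; [exact: mI|exact: mI|].
by apply: setIS; apply: subset_itvl; rewrite bnd_simp.
Qed.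

Let F_lip s t : s <= t -> F t <= F s + (t - s).
Proof.
move=> st; rewrite -lee_fin EFinD !FE.
have -> : A `&` `]-oo, t]%classic = (A `&` `]-oo, s]%classic) `|` (A `&` `]s, t]%classic).
  rewrite -setIUr; congr (_ `&` _).
  by rewrite -itv_bndbnd_setU ?bnd_simp.
have m2 : measurable (A `&` `]s, t]%classic) by apply: measurableI => //; exact: measurable_itv.
apply: (@le_trans _ _ (unit_prob (A `&` `]-oo, s]) + unit_prob (A `&` `]s, t]))%E).
  by apply: measureU2 => //; exact: mI.
apply: leeD => //.
rewrite unit_probE//; apply: (@le_trans _ _ (mu `]s, t])).
  apply: le_measure; rewrite ?inE//.
    by apply: measurableI => //; exact: measurable_itv.
  by move=> x [[]].
rewrite lebesgue_measure_itv/= lte_fin; case: ifP => _; first by rewrite -EFinB.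
by rewrite lee_fin subr_ge0.
Qed.

Let F_ge0 t : 0 <= F t. Proof. exact: fine_ge0. Qed.

Let F_le0 t : t <= 0 -> F t = 0.
Proof.
move=> t0; apply/eqP; rewrite eq_le F_ge0 andbT -lee_fin FE unit_probE; last exact: mI.
apply: (@le_trans _ _ (mu [set 0])); last by rewrite lebesgue_measure_set1.
apply: le_measure; rewrite ?inE//.
  by apply: measurableI; [exact: mI|exact: measurable_itv].
move=> x [[_]]; rewrite /= !in_itv/= => xt /andP[x0 _].
by apply/eqP; rewrite eq_le x0 (le_trans xt).
Qed.

Let F1 t : 1 <= t -> (F t)%:E = unit_prob A.
Proof.
move=> t1; rewrite FE (unit_probE (mI t)) (unit_probE mA).
congr (mu _); rewrite -setIA; congr (_ `&` _).
apply/seteqP; split => x; first by case.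
move=> h; split => //; move: h; rewrite /= !in_itv/= => /andP[_ x1].
exact: le_trans x1 t1.
Qed.

(** Within [0, 1] the sublevel set of F is an initial segment; tau is its supremum, and the
    Lipschitz bound forces F tau = s. *)
Let level (s : R) : 0 <= s -> s <= F 1 ->
  exists2 tau : R, F tau = s & forall t : R, 0 <= t <= 1 -> (F t <= s) = (t <= tau).
Proof.
move=> s0 s1.
pose S := [set t : R | 0 <= t <= 1 /\ F t <= s].
have S0 : S 0 by split; rewrite ?lexx ?ler01// F_le0.
have supS : has_sup S by split; [exists 0|exists 1 => t [/andP[]]].
pose tau := sup S.
have tau0 : 0 <= tau by apply: ub_le_sup => //; exact: supS.2.
have tau1 : tau <= 1 by apply: ge_sup; [exists 0|move=> t [/andP[]]].
have Fle : F tau <= s.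
  apply/ler_addgt0Pr => e e0.
  have [t [t01 Ft] te] := sup_adherent e0 supS.
  have tt : t <= tau by apply: ub_le_sup; [exact: supS.2|split].
  by have := F_lip tt; rewrite -/tau in te; lra.
have Fge : s <= F tau.
  apply/ler_addgt0Pr => e e0.
  have [t1|t1] := leP 1 (tau + e).
    have := F_lip tau1; lra.
  have h : tau <= tau + e by lra.
  have : ~ S (tau + e).
    by move=> /(ub_le_sup supS.2); rewrite -/tau; lra.
  move=> /not_andP[/negP|/negP]; first by rewrite negb_and -!ltNge => /orP[]; lra.
  by rewrite -ltNge => h2; have := F_lip h; lra.
exists tau; first by apply/eqP; rewrite eq_le Fle.
move=> t t01; apply/idP/idP => [Ft|tt].
  by apply: ub_le_sup; [exact: supS.2|split].
exact: le_trans (F_homo tt) Fle.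
Qed.

Let mF (s : R) : measurable [set t | F t <= s].
Proof.
rewrite -[X in measurable X]setTI; apply: measurable_fun_le => //.
by apply: nondecreasing_measurable => // x y; exact: F_homo.
Qed.

Let level_measure (s : R) : 0 <= s -> s <= F 1 ->
  unit_prob (A `&` [set t | F t <= s]) = s%:E.
Proof.
move=> s0 s1; have [tau Ftau H] := level s0 s1.
transitivity (F tau)%:E; last by rewrite Ftau.
rewrite FE (unit_probE (mI tau)) unit_probE; last by apply: measurableI.
congr (mu _); rewrite -!setIA; congr (_ `&` _).
apply/seteqP; split => t [/= Ht]; rewrite !in_itv/= => t01; split => //; move: Ht.
  by rewrite H.
by rewrite /= in_itv/= -H.
Qed.

(** Piece k is the set where F lies in (V k, V (k + 1)], V being the cumulative masses. *)
Lemma measurable_split n (v : nat -> R) : (forall k, 0 <= v k) ->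
  \sum_(k < n) v k = 1 ->
  exists g : R -> nat, [/\ forall k, measurable (g @^-1` [set k]),
    forall t, (g t < n)%N /\ v (g t) != 0 &
    forall k, (k < n)%N ->
      fine (unit_prob (A `&` g @^-1` [set k])) = v k * fine (unit_prob A)].
Proof.
move=> v0 v1; pose V k := F 1 * \sum_(j < k) v j.
have V0 : V 0%N = 0 by rewrite /V big_ord0 mulr0.
have Vn : V n = F 1 by rewrite /V v1 mulr1.
have VS k : V k.+1 = V k + F 1 * v k by rewrite /V big_ord_recr/= mulrDr.
have Vge0 k : 0 <= V k by rewrite mulr_ge0// sumr_ge0.
have Vle k : (k <= n)%N -> V k <= F 1.
  move=> kn; rewrite -Vn; apply: ler_wpM2l => //.
  by rewrite -(subnKC kn) big_split_ord/= lerDl sumr_ge0.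
have F_max t : F t <= F 1.
  have [t1|t1] := leP 1 t; last exact: F_homo (ltW t1).
  by rewrite -lee_fin (F1 t1) (F1 (lexx 1)).
(* Points with F t <= 0 lie in no such piece. They form a null part of A and are sent to k0, because
   v (g t) != 0 is claimed for every t. *)
have [k0 k0n vk0] : exists2 k, (k < n)%N & v k != 0.
  apply: contrapT => H; have : \sum_(k < n) v k = 0.
    apply: big1 => k _; apply: contrapT => /eqP vk.
    by apply: H; exists k.
  by rewrite v1 => /eqP; rewrite oner_eq0.
pose g t := if F t <= 0 then k0 else find (fun k => F t <= V k.+1) (iota 0 n).
have gP t : 0 < F t -> (g t < n)%N /\ V (g t) < F t <= V (g t).+1.
  move=> Ft; rewrite /g leNgt Ft/=.
  set p := fun k => _.
  have hp : has p (iota 0 n).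
    apply/hasP; have n0 : (0 < n)%N by apply: leq_ltn_trans k0n.
    exists n.-1; first by rewrite mem_iota add0n/= ltn_predL.
    by rewrite /p prednK ?Vn.
  have fn : (find p (iota 0 n) < n)%N by rewrite -{2}(size_iota 0 n) -has_find.
  split => //; have := nth_find 0%N hp; rewrite nth_iota// add0n => h.
  apply/andP; split; last exact: h.
  case E : (find p (iota 0 n)) => [|k]; first by rewrite V0.
  have := @before_find _ 0%N p (iota 0 n) k; rewrite E => /(_ (leqnn _)).
  rewrite nth_iota ?add0n; last by apply: ltn_trans fn; rewrite E.
  by rewrite /p => /negbT; rewrite -ltNge.
have gE k : g @^-1` [set k] = ([set t | F t <= V k.+1] `&` ~` [set t | F t <= V k]
     `&` [set t | (k < n)%N]) `|` (if k == k0 then [set t | F t <= 0] else set0).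
  apply/seteqP; split => t /=.
    move=> gk; have [Ft|Ft] := ltP 0 (F t).
      left; have := gP t Ft; rewrite gk => -[kn /andP[a b]]; split => //; split => //.
      by apply/negP; rewrite -ltNge.
    by right; move: gk; rewrite /g Ft => ->; rewrite eqxx.
  move=> [[[a /negP]]|].
    rewrite -ltNge => b kn.
    have Ft : 0 < F t by apply: le_lt_trans b.
    have [gn /andP[c d]] := gP t Ft.
    have mono i j : (i <= j)%N -> V i <= V j.
      by move=> /subnKC <-; apply: ler_wpM2l => //; rewrite big_split_ord/= lerDl sumr_ge0.
    apply/eqP; rewrite eqn_leq; apply/andP; split; rewrite leqNgt; apply/negP => h.
      by have := mono _ _ h; lra.
    by have := mono _ _ h; lra.
  by case: eqP => // -> /=; rewrite /g => ->.
have mg k : measurable (g @^-1` [set k]).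
  rewrite gE; apply: measurableU; last by case: ifP.
  apply: measurableI; first by apply: measurableI => //; exact: measurableC.
  have [kn|kn] := boolP (k < n)%N; last by rewrite (_ : [set _ | _] = set0)//; apply/seteqP; split.
  by rewrite (_ : [set _ | _] = setT)//; apply/seteqP; split.
exists g; split => //.
- move=> t; have [Ft|Ft] := ltP 0 (F t); last by rewrite /g Ft.
  have [gn /andP[a b]] := gP t Ft; split => //.
  by apply/eqP => vg; move: b; rewrite VS vg mulr0 addr0 leNgt a.
- move=> k kn.
  have mAF s : measurable (A `&` [set t | F t <= s]) by exact: measurableI.
  have lm1 := level_measure (Vge0 k.+1) (Vle _ kn).
  have lm2 := level_measure (Vge0 k) (Vle _ (ltnW kn)).
  pose D := (A `&` [set t | F t <= V k.+1]) `\` (A `&` [set t | F t <= V k]).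
  have mD : measurable D by exact: measurableD.
  have DE : unit_prob D = (V k.+1 - V k)%:E.
    rewrite measureD; [|exact: mAF|exact: mAF|].
      2: by rewrite -ge0_fin_numE//; apply: fin_num_measure; exact: mAF.
    rewrite [X in (X - _)%E]lm1 EFinB -lm2; congr (_ - unit_prob _)%E.
    rewrite setIACA setIid; congr (_ `&` _); apply/seteqP; split => t /=; first by case.
    by move=> h; split => //; apply: le_trans h _; rewrite VS lerDl mulr_ge0.
  have Z : unit_prob (A `&` [set t | F t <= 0]) = 0%E by exact: level_measure.
  have DS : D `<=` A `&` g @^-1` [set k].
    move=> t [[At h1] h2]; split => //; rewrite gE; left; split => //; split => //.
    by move=> h3; apply: h2.
  have SD : A `&` g @^-1` [set k] `<=` D `|` (A `&` [set t | F t <= 0]).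
    move=> t [At]; rewrite gE => -[[[h1 h2] _]|]; first by left; split => // -[].
    by case: ifP => // _ h; right.
  have mAg : measurable (A `&` g @^-1` [set k]) by exact: measurableI.
  rewrite -[X in (v k * fine X)](F1 (lexx 1))/=.
  have -> : v k * F 1 = V k.+1 - V k by rewrite VS; ring.
  apply: EFin_inj; rewrite fineK; last exact: fin_num_measure.
  apply/eqP; rewrite -DE eq_le; apply/andP; split; last first.
    by apply: le_measure; rewrite ?inE.
  apply: (@le_trans _ _ (unit_prob (D `|` (A `&` [set t | F t <= 0])))).
    apply: le_measure; rewrite ?inE; [exact: mAg| |exact: SD].
    by apply: measurableU; [exact: mD|exact: mAF].
  have U2 := measureU2 unit_prob mD (mAF 0).
  apply: le_trans U2 _.
  by rewrite [X in (_ + X)%E]Z adde0.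
Qed.

End split.
End base_space.

Section stages.
Context {R : realType}.
Local Notation Q := (@unit_prob R).
Implicit Types (J : R -> nat * nat) (F : seq (nat * nat)).

(* J is a random dyadic node on the uniform probability space [0, 1]; its law is
   the distribution of mass over the nodes listed by F. *)
Definition stage J F : Prop :=
  [/\ uniq F, all valid_node F, forall t, J t \in F
    & forall K, measurable (J @^-1` [set K])].

Definition fiber_mass (I : eqType) (H : R -> I) (a : I) : R :=
  fine (Q (H @^-1` [set a])).

Definition stage_energy J F : R :=
  \sum_(K <- F) \sum_(K' <- F) fiber_mass J K * fiber_mass J K' * node_energy K K'.

Lemma fiber_mass_ge0 (I : eqType) (H : R -> I) (a : I) : 0 <= fiber_mass H a.
Proof. exact: fine_ge0. Qed.

Lemma stage_energy_ge0 J F : stage J F -> 0 <= stage_energy J F.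
Proof.
case=> _ /allP vF _ _; rewrite /stage_energy big_seq; apply: sumr_ge0 => K /vF vK.
rewrite big_seq; apply: sumr_ge0 => K' /vF vK'.
by rewrite mulr_ge0 ?mulr_ge0 ?fiber_mass_ge0// node_energy_ge0.
Qed.

Lemma Ex_simple d (T : measurableType d) (P : probability T R) (I : eqType)
    (H : T -> I) (G : seq I) (phi : I -> R) :
  uniq G -> (forall t, H t \in G) -> (forall a, measurable (H @^-1` [set a])) ->
  bounded_measurable (fun t => phi (H t)) /\
  Ex P (fun t => phi (H t)) = \sum_(a <- G) fine (P (H @^-1` [set a])) * phi a.
Proof.
move=> uG HG mH.
have b a : bounded_measurable (fun t => phi a * \1_(H @^-1` [set a]) t).
  apply: bounded_measurableM; first exact: bounded_measurable_cst.
  exact: bounded_measurable_indic.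
have -> : (fun t => phi (H t)) = (fun t => \sum_(a <- G) phi a * \1_(H @^-1` [set a]) t).
  apply/funext => t; rewrite (bigD1_seq (H t))//= big1 ?addr0.
    by rewrite indicE mem_set// mulr1.
  move=> a aH; rewrite indicE memNset ?mulr0// => /= e.
  by rewrite e eqxx in aH.
split; first exact: bounded_measurable_sum.
rewrite Ex_sum//; apply: eq_bigr => a _.
rewrite ExZ; last exact: bounded_measurable_indic.
by rewrite mulrC; congr (_ * _); exact: Ex_indic.
Qed.

Lemma Ex_simple2 d (T : measurableType d) (P : probability T R) (I : eqType)
    (H : T -> I) (G : seq I) (phi : I -> I -> R) :
  uniq G -> (forall t, H t \in G) -> (forall a, measurable (H @^-1` [set a])) ->
  bounded_measurable (fun s => Ex P (fun t => phi (H s) (H t))) /\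
  Ex P (fun s => Ex P (fun t => phi (H s) (H t))) =
  \sum_(a <- G) \sum_(b <- G) fine (P (H @^-1` [set a])) *
    fine (P (H @^-1` [set b])) * phi a b.
Proof.
move=> uG HG mH.
pose psi a := \sum_(b <- G) fine (P (H @^-1` [set b])) * phi a b.
have -> : (fun s => Ex P (fun t => phi (H s) (H t))) = (fun s => psi (H s)).
  by apply/funext => s; exact: (Ex_simple P (phi (H s)) uG HG mH).2.
have [bpsi ->] := Ex_simple P psi uG HG mH; split => //.
by apply: eq_bigr => a _; rewrite mulr_sumr; apply: eq_bigr => b _; rewrite mulrA.
Qed.

(** The finite sum is the form that gets estimated, the iterated expectation the one that passes to
    the limit. *)
Lemma stage_energyE J F : stage J F ->
  Ex Q (fun s => Ex Q (fun t => node_energy (J s) (J t))) = stage_energy J F.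
Proof. by case=> uF _ JF mJ; exact: (@Ex_simple2 _ (measurableTypeR R) Q _ J F (@node_energy R) uF JF mJ).2. Qed.

Lemma sum_fiber_mass (I : eqType) (H : R -> I) (G : seq I) :
  uniq G -> (forall t, H t \in G) -> (forall a, measurable (H @^-1` [set a])) ->
  \sum_(a <- G) fiber_mass H a = 1.
Proof.
move=> uG HG mH.
have [_] := @Ex_simple _ (measurableTypeR R) Q _ H G (fun=> 1) uG HG mH.
rewrite Ex_cst => ->.
by apply: eq_bigr => a _; rewrite mulr1.
Qed.

(** Each end of the hull moves inwards by at most the size of the coarser node. *)
Lemma hull_refine (K K' I I' : nat * nat) :
  dlo K <= dlo I :> R -> dhi I <= dhi K :> R ->
  dlo K' <= dlo I' :> R -> dhi I' <= dhi K' :> R ->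
  hull K K' - 2 * 2 ^- minn K.1 K'.1 <= hull I I' :> R.
Proof.
move=> a b c d; set s : R := 2 ^- minn K.1 K'.1.
have p2 q : (minn K.1 K'.1 <= q)%N -> 2 ^- q <= s.
  by move=> h; rewrite lef_pV2 ?posrE ?exprn_gt0// ler_eXn2l ?ltr1n.
have h1 := dhi_sub_dlo (R := R) K; have h2 := dhi_sub_dlo (R := R) K'.
have h3 : 2 ^- K.1 <= s by apply: p2; rewrite geq_minl.
have h4 : 2 ^- K'.1 <= s by apply: p2; rewrite geq_minr.
have h5 := dlo_lt_dhi (R := R) I; have h6 := dlo_lt_dhi (R := R) I'.
have m1 : Num.max (dhi K) (dhi K') - s <= Num.max (dhi I) (dhi I') :> R.
  rewrite lerBlDr ge_max; apply/andP; split.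
    have : dhi I <= Num.max (dhi I) (dhi I') :> R by rewrite le_max lexx.
    by lra.
  have : dhi I' <= Num.max (dhi I) (dhi I') :> R by rewrite le_max lexx orbT.
  by lra.
have m2 : Num.min (dlo I) (dlo I') <= Num.min (dlo K) (dlo K') + s :> R.
  rewrite -lerBlDr le_min; apply/andP; split.
    have : Num.min (dlo I) (dlo I') <= dlo I :> R by rewrite ge_min lexx.
    by lra.
  have : Num.min (dlo I) (dlo I') <= dlo I' :> R by rewrite ge_min lexx orbT.
  by lra.
rewrite /hull; lra.
Qed.

End stages.

Section refine.
Context {R : realType}.
Local Notation Q := (@unit_prob R).
Local Notation L := (@node_energy R).
Implicit Types (J : R -> nat * nat) (F : seq (nat * nat)).

(* Nodes whose hull exceeds 2^-q / theta gain at most 4 theta; closer nodes gain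
   a constant, which is absorbed by their energy L K K' since the latter is at
   least q ln 2 + ln theta. *)
Lemma pair_refine (n : nat) (N : nat -> nat * nat) (v w : nat -> R) (K K' : nat * nat)
    (theta : R) (q : nat) :
  (forall k, 0 <= v k) -> (forall k, 0 <= w k) ->
  \sum_(k < n) v k = 1 -> \sum_(k < n) w k = 1 ->
  (forall k, v k != 0 -> dlo K <= dlo (N k) :> R /\ dhi (N k) <= dhi K :> R) ->
  (forall k, w k != 0 -> dlo K' <= dlo (N k) :> R /\ dhi (N k) <= dhi K' :> R) ->
  \sum_(k < n) \sum_(j < n) v k * w j * L (N k) (N j) <=
    ln 2 * (minn K.1 K'.1 + 6)%:R ->
  valid_node K -> valid_node K' ->
  (q <= K.1)%N -> (q <= K'.1)%N -> 0 < theta -> theta <= 4^-1 ->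
  0 < q%:R * ln 2 + ln theta ->
  \sum_(k < n) \sum_(j < n) v k * w j * L (N k) (N j) <=
  L K K' + (4 * theta + (6 * ln 2 - ln theta) / (q%:R * ln 2 + ln theta) * L K K').
Proof.
move=> v0 w0 v1 w1 vK wK near vdK vdK' qK qK' t0 t4 Lam0.
set s : R := 2 ^- minn K.1 K'.1.
have s0 : 0 < s by rewrite invr_gt0 exprn_gt0.
have D0 : 0 < hull K K' :> R by exact: hull_gt0.
have l2 : 0 <= ln 2 :> R by rewrite ln_ge0// ler1n.
have lt0 : ln theta <= 0 by rewrite ln_le0//; lra.
have C0 : 0 <= 6 * ln 2 - ln theta by lra.
have L0 : 0 <= L K K' by exact: node_energy_ge0.
have [far|close] := leP s (theta * hull K K').
  have bound : \sum_(k < n) \sum_(j < n) v k * w j * L (N k) (N j) <= L K K' + 4 * theta.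
    apply: (@le_trans _ _ (\sum_(k < n) \sum_(j < n) v k * w j * (L K K' + 4 * theta))).
      apply: ler_sum => k _; apply: ler_sum => j _.
      have [->|vk] := eqVneq (v k) 0; first by rewrite !mul0r.
      have [->|wj] := eqVneq (w j) 0; first by rewrite mulr0 !mul0r.
      apply: ler_wpM2l; first by rewrite mulr_ge0.
      have [a b] := vK _ vk; have [c d] := wK _ wj.
      have h := hull_refine a b c d; rewrite -/s in h.
      have h1 : hull K K' * (1 - 2 * theta) <= hull (N k) (N j) by nra.
      have u0 : 0 < 1 - 2 * theta by lra.
      have : L (N k) (N j) <= L K K' - ln (1 - 2 * theta).
        rewrite /node_energy -opprD -lnM ?posrE// lerN2 ler_ln ?posrE ?mulr_gt0//.
        exact: hull_gt0.
      move=> /le_trans; apply; rewrite lerD2l -lnV ?posrE//.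
      (* By ln (1 + x) <= x the gain is at most 2 theta / (1 - 2 theta), hence at most 4 theta as
         theta <= 1/4. *)
      have -> : (1 - 2 * theta)^-1 = 1 + 2 * theta / (1 - 2 * theta).
        by field; rewrite gt_eqF.
      apply: le_trans (le_ln1Dx _) _.
        by apply: lt_le_trans (divr_ge0 _ (ltW u0)) => //; rewrite mulr_ge0// ltW.
      by rewrite ler_pdivrMr//; nra.
    under eq_bigr do rewrite -mulr_suml -mulr_sumr w1 mulr1.
    by rewrite -mulr_suml v1 mul1r.
  apply: le_trans bound _; rewrite lerD2l lerDl.
  by rewrite mulr_ge0// divr_ge0// ltW.
(* Close pair: the hull is below 2^-m / theta, m the smaller generation, so L K K' >= m ln 2 + ln
   theta, and ln 2 (m + 6) exceeds it by at most 6 ln 2 - ln theta. *)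
apply: le_trans near _.
set m := minn K.1 K'.1 in s s0 close *.
have qm : (q <= m)%N by rewrite leq_min qK.
have LE : m%:R * ln 2 + ln theta <= L K K'.
  have h : hull K K' <= s / theta by rewrite ler_pdivlMr// mulrC ltW.
  rewrite /node_energy lerNr opprD.
  have -> : - (m%:R * ln 2) - ln theta = ln (s / theta).
    by rewrite ln_div ?posrE// /s lnV ?posrE ?exprn_gt0// lnXn// mulr_natl.
  by rewrite ler_ln ?posrE// divr_gt0.
have LamE : q%:R * ln 2 + ln theta <= L K K'.
  by apply: le_trans LE; rewrite lerD2r ler_wpM2r// ler_nat.
have : 6 * ln 2 - ln theta <= (6 * ln 2 - ln theta) / (q%:R * ln 2 + ln theta) * L K K'.
  by rewrite mulrAC -mulrA ler_peMr// ler_pdivlMr// mul1r.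
rewrite natrD; set u := _ / _ * _; move=> hu; nra.
Qed.

(** The fibre of J over K is cut in the proportions v K, so the mass of K moves to nodes of centres
    inside K. The new energy is given exactly, to be estimated pair by pair. *)
Lemma redistribute_stage (r0 : nat) (c : nat -> R) J F m :
  (0 < r0)%N -> good_centers r0 c -> stage J F ->
  exists (n : nat) (v : nat * nat -> nat -> R) J' F',
    [/\ stage J' F',
      forall t, dlo (J t) <= dlo (J' t) :> R /\ dhi (J' t) <= dhi (J t) :> R,
      forall K, K \in F' -> exists2 k, (m <= k)%N &
        K = center_node c r0 k /\ 0 <= c k
      & stage_energy J' F' = \sum_(K <- F) \sum_(K' <- F) fiber_mass J K * fiber_mass J K' *
        (\sum_(k < n) \sum_(j < n) v K k * v K' j *
          L (center_node c r0 k) (center_node c r0 j))] /\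
    [/\ forall K k, 0 <= v K k,
      forall K, K \in F -> \sum_(k < n) v K k = 1,
      forall K k, K \in F -> v K k != 0 ->
        dlo K <= dlo (center_node c r0 k) :> R /\ dhi (center_node c r0 k) <= dhi K :> R
      & forall K K', K \in F -> K' \in F ->
        \sum_(k < n) \sum_(j < n) v K k * v K' j *
            L (center_node c r0 k) (center_node c r0 j) <=
          ln 2 * (minn K.1 K'.1 + 6)%:R].
Proof.
move=> r00 good stJ.
have [uF vF JF mJ] := stJ.
(* Centres of index beyond every generation in F have nodes finer than all nodes of F, so each lies
   inside the node that contains its centre. *)
pose M := maxn m (\max_(K <- F) K.1).
have [n [v [v0 vcell v1 vE]]] := good F M vF.
pose N := center_node c r0.
have vsub K k : K \in F -> v K k != 0 ->
    [/\ (m <= k)%N, 0 <= c k, valid_node (N k), dlo K <= dlo (N k) :> R &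
      dhi (N k) <= dhi K :> R].
  move=> KF vk; have [Mk Kc] := vcell K k KF vk.
  have vK := allP vF _ KF.
  have /andP[c0 c1] := dcell_unit vK Kc.
  have Kk : (K.1 <= r0 * k.+1)%N.
    apply: (@leq_trans k); last by apply: leq_trans (leq_pmull _ r00); exact: leqnSn.
    apply: leq_trans Mk; rewrite leq_max; apply/orP; right.
    exact: (leq_bigmax_seq (F := fun K : nat * nat => K.1)).
  have [a b] := cell_subset Kc Kk.
  by split => //; [apply: leq_trans Mk; rewrite leq_maxl|exact: valid_cell].
have [G HG] : exists G : nat * nat -> R -> nat, forall K, K \in F ->
    [/\ forall k, measurable (G K @^-1` [set k]),
      forall t, (G K t < n)%N /\ v K (G K t) != 0 &
      forall k, (k < n)%N ->
       fine (Q (J @^-1` [set K] `&` G K @^-1` [set k])) = v K k * fine (Q (J @^-1` [set K]))].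
  have /choice[G HG] : forall K, exists g : R -> nat, K \in F ->
    [/\ forall k, measurable (g @^-1` [set k]),
      forall t, (g t < n)%N /\ v K (g t) != 0 &
      forall k, (k < n)%N ->
       fine (Q (J @^-1` [set K] `&` g @^-1` [set k])) = v K k * fine (Q (J @^-1` [set K]))].
    move=> K; have [KF|KF] := boolP (K \in F); last by exists (fun=> 0%N).
    have [g Hg] := measurable_split (mJ K) (v0 K) (v1 K KF).
    by exists g.
  by exists G.
(* Distinct pairs (K, k) may yield the same new node; the fibres of H have the product masses
   wanted. *)
pose H t := (J t, G (J t) t).
pose S := [seq (K, k) | K <- F, k <- iota 0 n].
have uS : uniq S by apply: allpairs_uniq => //; [exact: iota_uniq|case=> ? ? [? ?] _ _ [-> ->]].
have HS t : H t \in S.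
  apply/allpairsP; exists (H t) => /=; split => //.
  have [_ /(_ t)[Gn _] _] := HG _ (JF t).
  by rewrite mem_iota.
have preH K k : H @^-1` [set (K, k)] = J @^-1` [set K] `&` G K @^-1` [set k].
  apply/seteqP; split => t /=; rewrite /H.
    by case=> <- <-.
  by case=> -> ->.
have mH p : measurable (H @^-1` [set p]).
  case: p => K k; rewrite preH.
  have [KF|KF] := boolP (K \in F).
    by apply: measurableI => //; have [mG _ _] := HG K KF; exact: mG.
  rewrite (_ : _ `&` _ = set0)//; apply/seteqP; split => // t [/= JK _].
  by move: KF; rewrite -JK JF.
have massH K k : K \in F -> (k < n)%N ->
    fiber_mass H (K, k) = v K k * fiber_mass J K.
  by move=> KF kn; rewrite /fiber_mass preH; have [_ _ ->] := HG K KF.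
pose J' t := N (H t).2.
(* Indices of zero weight are dropped: nothing is known about where their centres lie. *)
pose F' := undup [seq N p.2 | p <- S & v p.1 p.2 != 0].
have F'P K : K \in F' -> exists p, [/\ p.1 \in F, v p.1 p.2 != 0 & K = N p.2].
  rewrite mem_undup => /mapP[p]; rewrite mem_filter => /andP[vp /allpairsP[[a b] [/= aF _ e]]] ->.
  by exists p; split => //; rewrite e.
have vH t : v (J t) (G (J t) t) != 0 by have [_ /(_ t)[]] := HG _ (JF t).
have stJ' : stage J' F'.
  split.
  - exact: undup_uniq.
  - by apply/allP => K /F'P[p [pF vp ->]]; have [] := vsub _ _ pF vp.
  - move=> t; rewrite mem_undup; apply/mapP; exists (H t) => //.
    by rewrite mem_filter HS andbT; exact: vH.
  - move=> K; have -> : J' @^-1` [set K] = \bigcup_(p in [set` [seq p <- S | N p.2 == K]])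
        (H @^-1` [set p]).
      apply/seteqP; split => t /=.
        by move=> e; exists (H t) => //=; rewrite mem_filter HS andbT; apply/eqP.
      by move=> [p /=]; rewrite mem_filter => /andP[/eqP <- _] <-.
    by apply: fin_bigcup_measurable => // p _.
exists n, v, J', F'; split; last first.
  split => // K k KF vk; by have [_ _ _ a b] := vsub _ _ KF vk.
split => //.
  by move=> t; have [_ _ _ a b] := vsub _ _ (JF t) (vH t).
  by move=> K /F'P[p [pF vp ->]]; have [mk c0 _ _ _] := vsub _ _ pF vp; exists p.2.
rewrite -(stage_energyE stJ').
have -> : Ex Q (fun s => Ex Q (fun t => node_energy (J' s) (J' t))) =
    Ex Q (fun s => Ex Q (fun t => (fun p p' => L (N p.2) (N p'.2)) (H s) (H t))) by [].
rewrite (@Ex_simple2 _ _ (measurableTypeR R) Q _ H S (fun p p' => L (N p.2) (N p'.2)) uS HS mH).2.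
transitivity (\sum_(p <- S) \sum_(p' <- S) fiber_mass H p * fiber_mass H p' * L (N p.2) (N p'.2)).
  by [].
rewrite big_allpairs_dep; rewrite big_seq [RHS]big_seq; apply: eq_bigr => K KF.
rewrite -{1}[n]subn0 -/(index_iota 0 n) big_mkord.
under eq_bigr => k _ do rewrite big_allpairs_dep/=.
rewrite exchange_big/= big_seq [RHS]big_seq; apply: eq_bigr => K' KF'.
rewrite mulr_sumr; apply: eq_bigr => k _.
rewrite -{1}[n]subn0 -/(index_iota 0 n) big_mkord mulr_sumr.
apply: eq_bigr => j _; rewrite !massH//.
by set x := L _ _; ring.
Qed.

(** q depends on the energy bound B but not on the stage. The choice of theta keeps the additive
    gain within eps / 2, and q makes C B / (q ln 2 + ln theta) at most eps / 2. *)
Lemma refine_stage (r0 : nat) (c : nat -> R) (eps B : R) :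
  (0 < r0)%N -> good_centers r0 c -> 0 < eps -> 0 <= B ->
  exists q, forall J F m, stage J F -> (forall K, K \in F -> (q <= K.1)%N) ->
    stage_energy J F <= B ->
    exists J' F', [/\ stage J' F',
      forall t, dlo (J t) <= dlo (J' t) :> R /\ dhi (J' t) <= dhi (J t) :> R,
      forall K, K \in F' -> exists2 k, (m <= k)%N &
        K = center_node c r0 k /\ 0 <= c k
      & stage_energy J' F' <= stage_energy J F + eps].
Proof.
move=> r00 good eps0 B0.
pose theta : R := Num.min 4^-1 (eps / 8).
have t0 : 0 < theta by rewrite lt_min invr_gt0 ltr0n/= divr_gt0.
have t4 : theta <= 4^-1 by rewrite ge_min lexx.
have te : 4 * theta <= eps / 2.
  have : theta <= eps / 8 by rewrite ge_min lexx orbT.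
  by lra.
have l2 : 0 < ln 2 :> R by rewrite ln_gt0// ltr1n.
pose C := 6 * ln 2 - ln theta.
have C0 : 0 <= C.
  have : ln theta <= 0 by rewrite ln_le0//; lra.
  by rewrite /C; lra.
pose Lam0 : R := 2 * C * B / eps + 1.
have Lam01 : 0 < Lam0.
  by rewrite ltr_wpDl// divr_ge0 ?(ltW eps0)// mulr_ge0// mulr_ge0.
pose q := (Num.truncn ((Lam0 - ln theta) / ln 2)).+1.
have qLam : Lam0 <= q%:R * ln 2 + ln theta.
  rewrite -lerBlDr -ler_pdivrMr//; apply: ltW; exact: truncnS_gt.
exists q => J F m stJ qF EB.
have [n [v [J' [F' [[stJ' nest cen EE] [v0 v1 vsub vE]]]]]] :=
  redistribute_stage m r00 good stJ.
have [uF vF JF mJ] := stJ.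
exists J', F'; split => //; rewrite EE.
have E0 := stage_energy_ge0 stJ.
have Lamq : 0 < q%:R * ln 2 + ln theta by exact: lt_le_trans qLam.
pose cst := C / (q%:R * ln 2 + ln theta).
apply: (@le_trans _ _ (\sum_(K <- F) \sum_(K' <- F) fiber_mass J K * fiber_mass J K' *
   (L K K' + (4 * theta + cst * L K K')))).
  rewrite big_seq [leRHS]big_seq; apply: ler_sum => K KF.
  rewrite big_seq [leRHS]big_seq; apply: ler_sum => K' KF'.
  apply: ler_wpM2l; first by rewrite mulr_ge0// fiber_mass_ge0.
  apply: pair_refine => //; rewrite ?v1//.
  - by move=> k /(vsub K k KF).
  - by move=> k /(vsub K' k KF').
  - exact: vE.
  - exact: (allP vF).
  - exact: (allP vF).
  - exact: qF.
  - exact: qF.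
have -> : \sum_(K <- F) \sum_(K' <- F) fiber_mass J K * fiber_mass J K' *
   (L K K' + (4 * theta + cst * L K K')) =
   stage_energy J F + (4 * theta + cst * stage_energy J F).
  have mass1 : \sum_(K <- F) fiber_mass J K = 1 by exact: sum_fiber_mass.
  transitivity (stage_energy J F + (\sum_(K <- F) \sum_(K' <- F)
      fiber_mass J K * fiber_mass J K' * (4 * theta) + cst * stage_energy J F)).
    rewrite /stage_energy mulr_sumr -!big_split/=; apply: eq_bigr => K _.
    rewrite mulr_sumr -!big_split/=; apply: eq_bigr => K' _.
    by set x := L _ _; ring.
  congr (_ + (_ + _)).
  under eq_bigr do rewrite -mulr_suml -mulr_sumr mass1 mulr1.
  by rewrite -mulr_suml mass1 mul1r.
rewrite lerD2l.
have : cst * stage_energy J F <= eps / 2.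
  apply: (@le_trans _ _ (cst * B)); first by rewrite ler_wpM2l// divr_ge0// ltW.
  rewrite /cst mulrAC ler_pdivrMr//; apply: (@le_trans _ _ (eps / 2 * Lam0)); last first.
    by rewrite ler_wpM2l// divr_ge0// ltW.
  rewrite /Lam0 mulrDr mulr1.
  have -> : eps / 2 * (2 * C * B / eps) = C * B by field; rewrite gt_eqF.
  by rewrite lerDl divr_ge0// ltW.
by move: te; lra.
Qed.

End refine.

(** * Limit of a sequence of stages *)

Section support.
Context {R : realType}.
Implicit Types (mu : probability (R * R)%type R).

Lemma closed_msupport mu : closed (msupport mu).
Proof.
rewrite -openC openE => z /existsNP[U /not_implyP[oU /not_implyP[Uz U0]]].
have : nbhs z U by exact: open_nbhs_nbhs.
apply: filterS => w Uw H; exact: U0 (H U oU Uw).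
Qed.

Lemma msupport_subset mu (C : set (R * R)) : closed C -> mu (~` C) = 0%E ->
  msupport mu `<=` C.
Proof.
move=> cC C0 z Hz; apply: contrapT => nCz.
by have := Hz (~` C) (closed_openC cC) nCz; rewrite [X in (_ < X)%E]C0 ltxx.
Qed.

(** Closed, unlike [dcell]: nested cells can shrink to a right endpoint. *)
Definition flat_box (K : nat * nat) : set (R * R) := `[dlo K, dhi K]%classic `*` [set 0].

Lemma compact_flat_box K : compact (flat_box K).
Proof. by apply: compact_setX; [exact: segment_compact|exact: compact_set1]. Qed.

Lemma closed_flat_boxes (F : seq (nat * nat)) :
  closed (\big[setU/set0]_(K <- F) flat_box K).
Proof.
apply: closed_bigsetU => K _; apply: compact_closed; last exact: compact_flat_box.
exact: norm_hausdorff.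
Qed.

End support.

Section limit_measure.
Context {R : realType}.
Local Notation Q := (@unit_prob R).
Variables (J : nat -> R -> nat * nat) (F : nat -> seq (nat * nat)).
Hypothesis stJ : forall n, stage (J n) (F n).
Hypothesis nested : forall n t,
  dlo (J n t) <= dlo (J n.+1 t) :> R /\ dhi (J n.+1 t) <= dhi (J n t) :> R.
Hypothesis shrink : forall n K, K \in F n -> (n <= K.1)%N.

Let vJ n t : valid_node (J n t).
Proof. by have [_ /allP vF JF _] := stJ n; exact: vF. Qed.

Let JF n t : J n t \in F n. Proof. by have [_ _ h _] := stJ n. Qed.

Let dlo_homo t : nondecreasing_seq (fun n => dlo (J n t) : R).
Proof. by apply/nondecreasing_seqP => n; have [] := nested n t. Qed.

Let dhi_homo t : nonincreasing_seq (fun n => dhi (J n t) : R).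
Proof. by apply/nonincreasing_seqP => n; have [] := nested n t. Qed.

Let dlo_dhi t n m : dlo (J n t) <= dhi (J m t) :> R.
Proof.
apply: le_trans (dlo_homo t (leq_maxl n m)) _.
by apply: le_trans (ltW (dlo_lt_dhi _)) (dhi_homo t (leq_maxr n m)).
Qed.

Let dlo_ub t m : ubound (range (fun n => dlo (J n t) : R)) (dhi (J m t)).
Proof. by move=> _ [n _ <-]; exact: dlo_dhi. Qed.

(** The one common point of the nested closed nodes J n t, since their sizes tend to 0. *)
Definition limit_point (t : measurableTypeR R) : R :=
  sup (range (fun n => dlo (J n t) : R)).

Let phi_ge n t : dlo (J n t) <= limit_point t.
Proof. by apply: ub_le_sup; [exists (dhi (J 0%N t)); exact: dlo_ub|exists n]. Qed.

Let phi_le n t : limit_point t <= dhi (J n t).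
Proof. by apply: ge_sup; [exists (dlo (J 0%N t)), 0%N|exact: dlo_ub]. Qed.

Lemma measurable_stage_fun n (g : nat * nat -> R) :
  bounded_measurable (fun t : measurableTypeR R => g (J n t)).
Proof.
have [uF _ JFn mJ] := stJ n.
have b a : bounded_measurable (fun t : measurableTypeR R => g a * \1_(J n @^-1` [set a]) t).
  apply: bounded_measurableM; first exact: bounded_measurable_cst.
  by apply: bounded_measurable_indic; exact: mJ.
have -> : (fun t => g (J n t)) = (fun t => \sum_(a <- F n) g a * \1_(J n @^-1` [set a]) t).
  apply/funext => t; rewrite (bigD1_seq (J n t))//= big1 ?addr0.
    by rewrite indicE mem_set// mulr1.
  move=> a aH; rewrite indicE memNset ?mulr0// => /= e.
  by rewrite e eqxx in aH.
exact: bounded_measurable_sum.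
Qed.

Lemma measurable_limit_point : measurable_fun setT limit_point.
Proof.
apply: (@measurable_fun_cvg _ _ _ setT (fun n (t : measurableTypeR R) => dlo (J n t) : R)).
  by move=> n; exact: (measurable_stage_fun n (@dlo R)).1.
move=> t _; apply: nondecreasing_cvgn; first exact: dlo_homo.
by exists (dhi (J 0%N t)); exact: dlo_ub.
Qed.

Let mPhi : measurable_fun setT (fun t : measurableTypeR R => (limit_point t, 0 : R)).
Proof. by apply: measurable_fun_pair => //; exact: measurable_limit_point. Qed.

Let Phi : {mfun (measurableTypeR R) >-> (R * R)%type} :=
  HB.pack (fun t : measurableTypeR R => (limit_point t, 0 : R))
    (isMeasurableFun.Build _ _ _ _ _ mPhi).

Let nu : probability (R * R)%type R := distribution Q Phi.

Let nu_support n : msupport nu `<=` \big[setU/set0]_(K <- F n) flat_box K.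
Proof.
apply: msupport_subset; first exact: closed_flat_boxes.
rewrite /nu /distribution/= /pushforward (_ : _ @^-1` _ = set0) ?measure0//.
apply/seteqP; split => // t /=; apply.
rewrite -bigcup_seq; exists (J n t); first exact: JF.
by split => //=; rewrite in_itv/= phi_ge phi_le.
Qed.

Let energyn n s t : R := node_energy (J n s) (J n t).

Let energyn_homo s t : nondecreasing_seq (fun n => energyn n s t).
Proof.
apply/nondecreasing_seqP => n; rewrite /energyn /node_energy lerN2 ler_ln ?posrE ?hull_gt0//.
have [a b] := nested n s; have [c d] := nested n t.
rewrite /hull lerB//.
  by rewrite ge_max !le_max b d orbT.
by rewrite le_min !ge_min a c orbT.
Qed.

Let energyn_ge0 n s t : 0 <= energyn n s t.
Proof. exact: node_energy_ge0. Qed.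

Let hulln_le n s t : hull (J n s) (J n t) <= `|limit_point s - limit_point t| + 2 * 2 ^- n :> R.
Proof.
have sz u : dhi (J n u) - dlo (J n u) <= 2 ^- n :> R.
  rewrite dhi_sub_dlo lef_pV2 ?posrE ?exprn_gt0// ler_eXn2l ?ltr1n//.
  exact: shrink (JF n u).
have := sz s; have := sz t; have := phi_ge n s; have := phi_ge n t.
have := phi_le n s; have := phi_le n t.
have := ler_norm (limit_point s - limit_point t).
have := ler_norm (limit_point t - limit_point s); rewrite distrC.
have p0 : 0 <= 2 ^- n :> R by rewrite invr_ge0 exprn_ge0.
rewrite /hull; set x := limit_point s; set y := limit_point t.
move=> *; rewrite lerBlDr ge_max; apply/andP; split; rewrite -lerBlDl le_min; apply/andP; split; lra.
Qed.

(** The hulls shrink to the distance of the limit points, so the node energies reach the kernel in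
    the limit, and grow to +oo when these points coincide. *)
Let kernel_le s t :
  (shifted_kernel 0 (Phi s) (Phi t) <= ereal_sup (range (fun n => (energyn n s t)%:E)))%E.
Proof.
set S := ereal_sup _.
have Sge n : ((energyn n s t)%:E <= S)%E by apply: ereal_sup_ubound; exists n.
have S0 : (0 <= S)%E by apply: le_trans (Sge 0%N); rewrite lee_fin.
rewrite /shifted_kernel adde0 ge_max S0 andbT /logkernel /= cdist_real.
set dd := `|_|.
have small (e : R) : 0 < e -> exists n, 2 * 2 ^- n <= e :> R.
  move=> e0; have /cvgrPdist_lt/(_ (e / 2))[|n _ /(_ n (leqnn n))] : 2 ^- n @[n --> \oo] --> (0 : R).
  - under eq_fun do rewrite -exprVn.
    by apply: cvg_expr; rewrite gtr0_norm ?invr_gt0// invf_lt1// ltr1n.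
  - by rewrite divr_gt0.
  by rewrite sub0r normrN ger0_norm ?invr_ge0 ?exprn_ge0// => h; exists n; lra.
case: eqP => [d0|/eqP d0].
  rewrite leye_eq; apply/eqP/eqyP => A A0.
  have [n Hn] := small (expR (- A)) (expR_gt0 _).
  apply: le_trans (Sge n); rewrite lee_fin /energyn /node_energy lerNr.
  rewrite -[leRHS]expRK ler_ln ?posrE ?hull_gt0 ?expR_gt0//.
  by apply: le_trans (hulln_le n s t) _; rewrite -/dd d0 add0r.
have dd0 : 0 < dd by rewrite lt_def d0 normr_ge0.
apply/lee_addgt0Pr => e e0.
have [n Hn] := small (dd * e) (mulr_gt0 dd0 e0).
apply: (@le_trans _ _ ((energyn n s t)%:E + e%:E)%E); last by apply: leeD.
rewrite -EFinD lee_fin /energyn /node_energy.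
have h1 : ln (hull (J n s) (J n t)) <= ln (dd * (1 + e)).
  rewrite ler_ln ?posrE ?hull_gt0 ?mulr_gt0 ?addr_gt0//.
  by apply: le_trans (hulln_le n s t) _; rewrite -/dd mulrDr mulr1 lerD2l.
have h2 : ln (dd * (1 + e)) <= ln dd + e.
  rewrite lnM ?posrE ?addr_gt0// lerD2l; apply: le_ln1Dx.
  by apply: lt_trans e0; rewrite ltrN10.
lra.
Qed.

(** Node energies increase with n, so the bound passes to the limit by monotone convergence, in the
    inner and then in the outer integral. *)
Lemma limit_measure (B : R) :
  (forall n, stage_energy (J n) (F n) <= B) ->
  exists nu : probability (R * R)%type R,
  [/\ compact (msupport nu), (energy nu <= B%:E)%E &
    forall n, msupport nu `<=` \big[setU/set0]_(K <- F n) flat_box K].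
Proof.
move=> EB; exists nu; split; last exact: nu_support.
  have cB : compact ((`[0, 1]%classic : set R) `*` [set (0 : R)]).
    by apply: compact_setX; [exact: segment_compact|exact: compact_set1].
  apply: (subclosed_compact (@closed_msupport R nu) cB).
  - move=> z /(nu_support 0); rewrite -bigcup_seq => -[K /= KF [/=]].
    rewrite !in_itv/= => /andP[a b] z2; split => //=.
    have [_ /allP vF _ _] := stJ 0; have := dhi_le1 (R := R) (vF K KF).
    by rewrite ?in_itv/= (le_trans (dlo_ge0 K) a) => /(le_trans b).
have unit z : msupport nu z -> 0 <= z.1 <= 1 /\ z.2 = 0.
  move=> /(nu_support 0); rewrite -bigcup_seq => -[K /= KF [/=]].
  rewrite in_itv/= => /andP[a b] z2; split => //=.
  have [_ /allP vF _ _] := stJ 0; have := dhi_le1 (R := R) (vF K KF).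
  by rewrite (le_trans (dlo_ge0 K) a) => /(le_trans b).
have KC z w : msupport nu z -> msupport nu w -> ((- 0)%:E <= logkernel z w)%E.
  case: z => x x'; case: w => y y' /unit[/= /andP[x0 x1] ->] /unit[/= /andP[y0 y1] ->].
  have := @logkernel_ge R (x, 0) (y, 0) 1 ltr01; rewrite ln1; apply; rewrite cdist_real.
  by rewrite ler_norml; apply/andP; split; lra.
rewrite (energy_shift (lexx 0) KC) sube0.
have pot0 z : (0 <= potential nu 0 z)%E by exact: potential_ge0.
rewrite (ge0_integral_distribution Phi (measurable_potential nu 0) pot0).
have mS (z : R * R) : measurable_fun setT (shifted_kernel 0 z).
  exact: (measurableT_comp (measurable_shifted_kernel 0) (measurable_pair1 z)).
have potE z : potential nu 0 z = (\int[Q]_t shifted_kernel 0 z (Phi t))%E.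
  have p0 (w : R * R) : (0 <= shifted_kernel 0 z w)%E by exact: shifted_kernel_ge0.
  by rewrite -[RHS](ge0_integral_distribution Phi (mS z) p0).
have men n s : measurable_fun setT (fun t : measurableTypeR R => (energyn n s t)%:E).
  by apply/measurable_EFinP; exact: (measurable_stage_fun n (node_energy (J n s))).1.
pose G n s := (\int[Q]_t (energyn n s t)%:E)%E.
have GE n s : G n s = (Ex Q (fun t => energyn n s t))%:E.
  by rewrite EFin_Ex//; exact: (measurable_stage_fun n (node_energy (J n s))).
have bG n : bounded_measurable (fun s : measurableTypeR R => Ex Q (fun t => energyn n s t)).
  exact: (measurable_stage_fun n (fun K => Ex Q (fun t => node_energy K (J n t)))).
have G0 n s : (0 <= G n s)%E by apply: integral_ge0 => t _; rewrite lee_fin.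
have Gnd s : nondecreasing_seq (G ^~ s).
  move=> n m nm; apply: ge0_le_integral => //.
  - by move=> t _; rewrite lee_fin.
  - by move=> t _; rewrite lee_fin; exact: energyn_homo.
have mG n : measurable_fun setT (G n : measurableTypeR R -> \bar R).
  rewrite (_ : G n = EFin \o (fun s => Ex Q (fun t => energyn n s t))).
    by apply/measurable_EFinP; exact: (bG n).1.
  by apply/funext => s; exact: GE.
have pot_le s : (potential nu 0 (Phi s) <= limn (G ^~ s))%E.
  rewrite potE -(monotone_convergence Q measurableT (men ^~ s)); last 2 first.
  - by move=> n t _; rewrite lee_fin.
  - by move=> t _ n m nm; rewrite lee_fin; exact: energyn_homo.
  apply: ge0_le_integral => //.
  - by move=> t _; exact: shifted_kernel_ge0.
  - exact: (measurableT_comp (mS (Phi s)) mPhi).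
  - apply: (@emeasurable_fun_cvg _ _ _ _ (fun n (t : measurableTypeR R) => (energyn n s t)%:E) _ (fun n => men n s)) => t _.
    apply: ereal_nondecreasing_is_cvgn => n m nm.
    by rewrite lee_fin; exact: energyn_homo.
  - move=> t _.
    have nd : nondecreasing_seq (fun n => (energyn n s t)%:E).
      by move=> n m nm; rewrite lee_fin; exact: energyn_homo.
    by have /cvg_lim -> := ereal_nondecreasing_cvgn nd; [exact: kernel_le|].
apply: (@le_trans _ _ (\int[Q]_s limn (G ^~ s))%E).
  apply: ge0_le_integral => //.
  - by move=> s _; exact: pot0.
  - exact: (measurableT_comp (measurable_potential nu 0) mPhi).
  - apply: (@emeasurable_fun_cvg _ _ _ _ (fun n (s : measurableTypeR R) => G n s) _ mG) => s _.
    by apply: ereal_nondecreasing_is_cvgn; exact: Gnd.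
  - by move=> s _; exact: pot_le.
rewrite [leLHS](monotone_convergence Q measurableT mG (fun n s _ => G0 n s) (fun s _ => Gnd s)).
apply: lime_le.
  apply: ereal_nondecreasing_is_cvgn => n m nm.
  apply: ge0_le_integral => //; try exact: mG.
  by move=> s _; exact: Gnd.
apply: nearW => n; under eq_integral do rewrite GE.
by rewrite -EFin_Ex// lee_fin (stage_energyE (stJ n)).
Qed.

End limit_measure.

Section from_stage.
Context {R : realType}.

(** Step n costs eps 2^-(n + 1), so all stages have energy at most e0 + eps; this common bound
    allows all thresholds q n to be fixed in advance. *)
Lemma measure_from_stage (r0 : nat) (c : nat -> R) (eps e0 : R) :
  (0 < r0)%N -> good_centers r0 c -> 0 < eps -> 0 <= e0 ->
  exists q, forall J F, stage J F -> (forall K, K \in F -> (q <= K.1)%N) ->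
    stage_energy J F <= e0 ->
    exists nu : probability (R * R)%type R,
      [/\ compact (msupport nu), (energy nu <= (e0 + eps)%:E)%E &
        forall m z, msupport nu z -> z.2 = 0 /\
          exists2 k, (m <= k)%N & 0 <= c k /\ `|z.1 - c k| <= 2 ^- (r0 * k.+1)].
Proof.
move=> r00 good eps0 e00.
have epsn n : 0 < eps * 2 ^- n.+1 by rewrite mulr_gt0// invr_gt0 exprn_gt0.
have B0 : 0 <= e0 + eps by rewrite addr_ge0// ltW.
have /choice[q qP] n := refine_stage r00 good (epsn n) B0.
(* Generation at least q n permits the next refinement; generation at least n makes the nodes
   shrink. *)
pose inv n (s : (R -> nat * nat) * seq (nat * nat)) := [/\ stage s.1 s.2,
  forall K, K \in s.2 -> (maxn (q n) n <= K.1)%N &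
  stage_energy s.1 s.2 <= e0 + eps * (1 - 2 ^- n)].
have inv_le n s : inv n s -> stage_energy s.1 s.2 <= e0 + eps.
  case=> _ _ /le_trans; apply; rewrite lerD2l ler_piMr ?(ltW eps0)//.
(* Choice needs a total successor, so a state violating the invariant is left unchanged. *)
have /choice[step stepP] (a : nat * ((R -> nat * nat) * seq (nat * nat))) :
    exists s', inv a.1 a.2 -> [/\ inv a.1.+1 s',
      forall t, dlo (a.2.1 t) <= dlo (s'.1 t) :> R /\ dhi (s'.1 t) <= dhi (a.2.1 t) :> R &
      forall K, K \in s'.2 -> exists2 k, (a.1.+1 <= k)%N & K = center_node c r0 k /\ 0 <= c k].
  case: a => n s /=.
  have [hs|] := pselect (inv n s); last by move=> nis; exists s.
  have [st gn E] := hs.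
  have [|J' [F' [st' nest cen E']]] :=
      qP n s.1 s.2 (maxn (q n.+1) n.+1) st _ (inv_le _ _ hs).
    by move=> K /gn; rewrite geq_max => /andP[].
  exists (J', F') => _; split => //=.
    split => //=.
      move=> K /cen[k mk [-> _]] /=; apply: (leq_trans mk).
      by rewrite (leq_trans (leqnSn k))// leq_pmull.
    apply: (le_trans E'); apply: (le_trans (lerD E (lexx _))).
    rewrite -addrA lerD2l -mulrDr exprS invfM; apply: ler_wpM2l; first exact: ltW.
    by set x := (2 ^+ n)^-1; lra.
  by move=> K /cen[k]; rewrite geq_max => /andP[_ nk] h; exists k.
exists (q 0%N) => J F stJ gF EJ.
pose s := fix s n := if n is n'.+1 then step (n', s n') else (J, F).
have invs n : inv n (s n).
  elim: n => [|n IH]; last by have [] := stepP (n, s n) IH.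
  split => //=.
  by apply: (le_trans EJ); rewrite expr0 invr1 subrr mulr0 addr0.
have stS n : stage (s n).1 (s n).2 by have [] := invs n.
have nestS n t : dlo ((s n).1 t) <= dlo ((s n.+1).1 t) :> R /\
    dhi ((s n.+1).1 t) <= dhi ((s n).1 t) :> R.
  by have [_ /(_ t) h _] := stepP (n, s n) (invs n); exact: h.
have shrS n K : K \in (s n).2 -> (n <= K.1)%N.
  by move=> Ks; have [_ /(_ K Ks)] := invs n; rewrite geq_max => /andP[].
have [nu [cnu enu snu]] := limit_measure stS nestS shrS (fun n => inv_le n _ (invs n)).
(* Stage 0 is arbitrary; from stage m + 1 on, the nodes surround centres of index above m. *)
exists nu; split => // m z /(snu m.+1); rewrite -bigcup_seq => -[K /= Ks [/= zK z2]].
split => //.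
have [_ _ /(_ K Ks)[k /= mk [KE ck0]]] := stepP (m, s m) (invs m).
exists k; first exact: ltnW.
split => //; have := cell_dcell (r0 * k.+1) ck0; rewrite -/(center_node c r0 k) -KE.
rewrite /dcell/= in_itv/= => /andP[c1 c2].
move: zK; rewrite in_itv/= => /andP[z1 z2'].
have := dhi_sub_dlo (R := R) K; rewrite KE /= -KE => e.
by rewrite ler_norml -e; apply/andP; split; lra.
Qed.

End from_stage.

(** * Approximation of measures on the segment *)

Section first_stage.
Context {R : realType}.
Local Notation unit_segment := (embedR (`[0%R, 1%R] : set R)).

Lemma measurable_unit_segment : measurable unit_segment.
Proof.
have -> : unit_segment = (`[0%R, 1%R] : set R) `*` [set 0 : R].
  by apply/seteqP; split => z [].
by apply: measurableX.
Qed.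

Lemma null_outside_segment (mu : probability (R * R)%type R) :
  msupport mu `<=` unit_segment -> mu (~` unit_segment) = 0%E.
Proof.
move=> smu; have [N [mN N0 sN]] := null_outside_msupport mu.
apply: (subset_measure0 _ mN _ N0).
  by apply: measurableC; exact: measurable_unit_segment.
by move=> z /= nz; apply: contrapT => /sN/smu.
Qed.

(* The cell of generation q containing a point of the unit segment, the last
   one being closed; points off the segment get the spare label 2 ^ q. *)
Definition label (q : nat) (z : R * R) : nat :=
  if pselect (unit_segment z) then minn (Num.truncn (z.1 * 2 ^+ q)) (2 ^ q).-1
  else (2 ^ q)%N.

Lemma label_lt q z : unit_segment z -> (label q z < 2 ^ q)%N.
Proof.
move=> zI; rewrite /label; case: pselect => //= _.
by rewrite gtn_min orbC ltn_predL expn_gt0.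
Qed.

Lemma label_ltS q z : (label q z < (2 ^ q).+1)%N.
Proof.
have [zI|nzI] := pselect (unit_segment z); first exact: ltnW (label_lt q zI).
by rewrite /label; case: pselect.
Qed.

Lemma label_outside q : label q @^-1` [set (2 ^ q)%N] = ~` unit_segment.
Proof.
apply/seteqP; split => z /=; last by rewrite /label; case: pselect.
by move=> e zI; have := label_lt q zI; rewrite e ltnn.
Qed.

Lemma label_cell q z : unit_segment z ->
  dlo (q, label q z) <= z.1 <= dhi (q, label q z).
Proof.
move=> zI; rewrite /label; case: pselect => //= -[_]; rewrite /= in_itv/= => /andP[z0 z1].
set y := z.1 * 2 ^+ q; have y0 : 0 <= y by rewrite mulr_ge0// exprn_ge0.
rewrite /dlo /dhi/= ler_pdivrMr ?ler_pdivlMr ?exprn_gt0// -/y.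
have /andP[a b] := truncn_itv y0; apply/andP; split.
  by apply: le_trans a; rewrite ler_nat geq_minl.
rewrite /minn; case: ifP => _; first exact: ltW.
by rewrite prednK ?expn_gt0// natrX /y ler_piMl// exprn_ge0.
Qed.

Lemma measurable_label q n : measurable (label q @^-1` [set n]).
Proof.
suff mge k : measurable [set z | (k <= label q z)%N].
  have -> : label q @^-1` [set n] = [set z | (n <= label q z)%N] `\` [set z | (n.+1 <= label q z)%N].
    apply/seteqP; split => z /=; first by move=> ->; rewrite leqnn ltnn.
    by move=> [a /negP]; rewrite -leqNgt => b; apply/eqP; rewrite eqn_leq a b.
  exact: measurableD.
have mS := measurable_unit_segment.
have [kq|kq] := ltnP k (2 ^ q); last first.
  have [kE|kE] := eqVneq k (2 ^ q)%N.
    rewrite (_ : mkset _ = ~` unit_segment); first exact: measurableC.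
    rewrite -(label_outside q); apply/seteqP; split => z /=; rewrite kE.
      by move=> h; apply/eqP; rewrite eqn_leq h andbT -ltnS label_ltS.
    by move=> ->.
  rewrite (_ : mkset _ = set0)//; apply/seteqP; split => z //= h.
  have lq : (label q z <= 2 ^ q)%N by rewrite -ltnS label_ltS.
  by have := leq_trans h lq; rewrite leqNgt ltn_neqAle eq_sym kE kq.
have kN : (k <= (2 ^ q).-1)%N by rewrite -ltnS prednK// expn_gt0.
rewrite (_ : mkset _ = ~` unit_segment `|` [set z | (k <= Num.truncn (z.1 * 2 ^+ q))%N]); last first.
  apply/seteqP; split => z /=; rewrite /label; case: pselect => h /=.
  - by rewrite leq_min => /andP[? _]; right.
  - by left.
  - by case=> // ?; rewrite leq_min kN andbT.
  - by move=> _; exact: ltnW.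
apply: measurableU; first exact: measurableC.
case: k {kq kN} => [|k]; first by rewrite (_ : mkset _ = setT)//; apply/seteqP; split.
rewrite (_ : mkset _ = setT `&` fst @^-1` [set x : R | k.+1%:R / 2 ^+ q <= x]); last first.
  rewrite setTI; apply/seteqP; split => z /=; rewrite truncn_gt_nat ler_pdivrMr ?exprn_gt0//.
apply: measurable_fst => //.
rewrite (_ : mkset _ = `[k.+1%:R / 2 ^+ q, +oo[%classic); first exact: measurable_itv.
by apply/seteqP; split => x /=; rewrite in_itv/= andbT.
Qed.

(** Two points are no farther apart than the hull of their cells is long, so discretising can only
    lower the energy. *)
Lemma first_stage (mu : probability (R * R)%type R) q :
  msupport mu `<=` unit_segment ->
  exists J F, [/\ stage J F, forall K, K \in F -> K.1 = q &
    ((stage_energy J F)%:E <= energy mu)%E].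
Proof.
move=> smu; pose n := (2 ^ q)%N; pose G := iota 0 n.+1.
have uG : uniq G by exact: iota_uniq.
have HG z : label q z \in G by rewrite mem_iota/= add0n label_ltS.
have mL := measurable_label q.
pose v k := fine (mu (label q @^-1` [set k])).
have v0 k : 0 <= v k by exact: fine_ge0.
have vn : v n = 0 by rewrite /v /n label_outside null_outside_segment.
have v1 : \sum_(k < n) v k = 1.
  have [_] := Ex_simple mu (fun=> 1) uG HG mL; rewrite Ex_cst => ->.
  rewrite /G -[n.+1]subn0 -/(index_iota 0 n.+1) big_mkord big_ord_recr/= -/(v n) vn mul0r addr0.
  by apply: eq_bigr => k _; rewrite mulr1.
(* The law of the label is carried over to the space [0, 1] of the stages. *)
have [g [mg gv gE]] := measurable_split measurableT v0 v1.
pose J t := (q, g t); pose F := [seq (q, k) | k <- iota 0 n].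
have uF : uniq F by rewrite map_inj_uniq ?iota_uniq// => a b [].
have JE k : J @^-1` [set (q, k)] = g @^-1` [set k].
  by apply/seteqP; split => t /=; [case|rewrite /J => ->].
exists J, F; split.
- split => //.
  + by apply/allP => K /mapP[k]; rewrite mem_iota/= add0n => kn ->.
  + by move=> t; apply/mapP; exists (g t) => //; rewrite mem_iota/= add0n; have [] := gv t.
  + move=> [r k]; have [->|rq] := eqVneq r q; first by rewrite JE.
    rewrite (_ : _ @^-1` _ = set0)//; apply/seteqP; split => // t /= [rE _].
    by rewrite rE eqxx in rq.
- by move=> K /mapP[k _ ->].
(* The value 0 at the spare label keeps phi below the shifted kernel on the whole plane. *)
pose phi a b : R := if (a < n)%N && (b < n)%N then node_energy (q, a) (q, b) else 0.
have massE k : (k < n)%N -> fiber_mass J (q, k) = v k.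
  move=> kn; rewrite /fiber_mass JE -(setTI (g @^-1` _)) gE//.
  by rewrite probability_setT mulr1.
have [bphi EE] := Ex_simple2 mu phi uG HG mL.
have -> : stage_energy J F = Ex mu (fun s => Ex mu (fun t => phi (label q s) (label q t))).
  rewrite EE /stage_energy /F big_map /G -[n.+1]addn1 iotaD big_cat/= add0n.
  rewrite [X in _ = _ + X]big_seq1 [X in _ = _ + X]big1 ?addr0; last first.
    by move=> k _; rewrite -/(v n) vn !mul0r.
  rewrite big_seq [RHS]big_seq; apply: eq_bigr => k; rewrite mem_iota/= add0n => kn.
  rewrite big_map big_cat/= big_seq1 -/(v n) vn mulr0 mul0r addr0.
  rewrite big_seq [RHS]big_seq; apply: eq_bigr => j; rewrite mem_iota/= add0n => jn.
  by rewrite !massE// /phi kn jn.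
have phi0 a b : 0 <= phi a b.
  by rewrite /phi; case: ifP => // /andP[an bn]; apply: node_energy_ge0.
have segdist z w : unit_segment z -> unit_segment w -> cdist z w = `|z.1 - w.1|.
  by case: z w => z1 z2 [w1 w2] [/= -> _] [/= -> _]; rewrite cdist_real.
have phile z w : ((phi (label q z) (label q w))%:E <= shifted_kernel 0 z w)%E.
  rewrite /phi; case: ifP => [/andP[zn wn]|_]; last exact: shifted_kernel_ge0.
  have inI y : (label q y < n)%N -> unit_segment y.
    by rewrite /label; case: pselect => //= _; rewrite ltnn.
  rewrite /shifted_kernel adde0 le_max; apply/orP; left.
  apply: logkernel_ge; first exact: hull_gt0.
  by rewrite segdist; [apply: hull_dist; apply: label_cell|..]; exact: inI.
rewrite (@energy_shift _ mu 0)// ?sube0; last first.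
  move=> z w /smu zI /smu wI; rewrite -(ln1 R); apply: logkernel_ge => //.
  rewrite segdist//; move: zI wI => [_ +] [_ +]; rewrite /= !in_itv/= => /andP[a b] /andP[e f].
  by rewrite ler_norml; apply/andP; split; lra.
have bL s : bounded_measurable (fun t => phi (label q s) (label q t)).
  exact: (Ex_simple mu (phi (label q s)) uG HG mL).1.
rewrite EFin_Ex//; apply: ge0_le_integral => //.
- by move=> z _; rewrite lee_fin; apply: Ex_ge0.
- by apply/measurable_EFinP; have [] := bphi.
- exact: measurable_potential.
move=> z _; rewrite EFin_Ex//; apply: ge0_le_integral => //.
- by move=> w _; rewrite lee_fin.
- by apply/measurable_EFinP; have [] := bL z.
- exact: (measurableT_comp (measurable_shifted_kernel 0) (measurable_pair1 z)).
Qed.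

End first_stage.

Section segment_measures.
Context {R : realType}.
Local Notation unit_segment := (embedR (`[0%R, 1%R] : set R)).

Lemma energy_ge0 (mu : probability (R * R)%type R) :
  msupport mu `<=` unit_segment -> (0 <= energy mu)%E.
Proof.
move=> smu; have [J [F [stJ _ le_mu]]] := first_stage 0 smu.
apply: le_trans le_mu; rewrite lee_fin; exact: stage_energy_ge0.
Qed.

Lemma approximate_measure (r0 : nat) (c : nat -> R) (mu : probability (R * R)%type R)
    (e eps : R) :
  (0 < r0)%N -> good_centers r0 c -> msupport mu `<=` unit_segment ->
  (energy mu <= e%:E)%E -> 0 < eps ->
  exists nu : probability (R * R)%type R,
    [/\ compact (msupport nu), (energy nu <= (e + eps)%:E)%E &
      forall m z, msupport nu z -> z.2 = 0 /\
        exists2 k, (m <= k)%N & 0 <= c k /\ `|z.1 - c k| <= 2 ^- (r0 * k.+1)].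
Proof.
move=> r00 good smu emu eps0.
have e0 : 0 <= e by rewrite -lee_fin (le_trans (energy_ge0 smu)).
have [q Hq] := measure_from_stage r00 good eps0 e0.
have [J [F [stJ gF EJ]]] := first_stage q smu.
apply: Hq stJ _ _; first by move=> K /gF ->.
by rewrite -lee_fin (le_trans EJ).
Qed.

(** Refinement at small cost needs fine nodes. Starting from the root node [0, 1], one
    redistribution reaches generation q with energy at most 6 ln 2, so no energy integral has to be
    computed. *)
Lemma finite_energy_measure (r0 : nat) (c : nat -> R) :
  (0 < r0)%N -> good_centers r0 c ->
  exists nu : probability (R * R)%type R,
    [/\ compact (msupport nu), (energy nu < +oo)%E &
      forall m z, msupport nu z -> z.2 = 0 /\
        exists2 k, (m <= k)%N & 0 <= c k /\ `|z.1 - c k| <= 2 ^- (r0 * k.+1)].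
Proof.
move=> r00 good.
have B0 : 0 <= 6 * ln 2 :> R by rewrite mulr_ge0// ln_ge0// ler1n.
have [q Hq] := measure_from_stage r00 good ltr01 B0.
have st0 : stage (fun _ : R => (0, 0)%N) [:: (0, 0)%N].
  split => //.
  move=> K; have [->|K0] := eqVneq K (0, 0)%N.
    by rewrite (_ : _ @^-1` _ = setT)//; apply/seteqP; split.
  by rewrite (_ : _ @^-1` _ = set0)//; apply/seteqP; split => // t /= e; rewrite -e eqxx in K0.
have [n [v [J' [F' [[stJ' _ cen EE] [_ _ _ vE]]]]]] := redistribute_stage q r00 good st0.
have gF' K : K \in F' -> (q <= K.1)%N.
  move=> /cen[k qk [-> _]] /=; apply: (leq_trans qk).
  by rewrite (leq_trans (leqnSn k))// leq_pmull.
have EJ' : stage_energy J' F' <= 6 * ln 2.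
  have [u _ a b] := st0; have := sum_fiber_mass u a b.
  rewrite EE !big_seq1 => ->; rewrite !mul1r mulrC.
  exact: vE (mem_head _ _) (mem_head _ _).
have [nu [cnu enu snu]] := Hq J' F' stJ' gF' EJ'.
by exists nu; split => //; apply: le_lt_trans enu _; rewrite ltry.
Qed.

End segment_measures.

(** * The limsup set and its capacity *)

Section limsup.
Context {R : realType}.
Variables (lambda alpha : R).
Hypothesis lambda0 : 0 < lambda.
Hypothesis alpha0 : 0 < alpha.

Lemma interval_len_small (eps : R) : 0 < eps ->
  exists m, forall k, (m <= k)%N -> interval_len lambda alpha k < eps.
Proof.
move=> eps0; pose M := (lambda * eps)^-1.
have M0 : 0 < M by rewrite invr_gt0 mulr_gt0.
exists (Num.truncn (M `^ alpha^-1)) => k mk.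
have kM : M <= k.+1%:R `^ alpha.
  have -> : M = (M `^ alpha^-1) `^ alpha.
    by rewrite -powRrM mulVf ?gt_eqF// powRr1// ltW.
  apply: ge0_ler_powR; rewrite ?nnegrE ?powR_ge0 ?(ltW alpha0)//.
  by apply: ltW; apply: lt_le_trans (truncnS_gt _) _; rewrite ler_nat ltnS.
have le1 : eps^-1 <= lambda * k.+1%:R `^ alpha.
  apply: le_trans (ler_wpM2l (ltW lambda0) kM).
  by rewrite /M invfM mulrA divff ?gt_eqF// mul1r.
rewrite /interval_len expRN -[ltRHS]invrK ltf_pV2 ?posrE ?expR_gt0 ?invr_gt0//.
apply: lt_le_trans (expR_ge1Dx _); rewrite addrC.
by rewrite (le_lt_trans le1)// ltrDl.
Qed.

(** Here alpha <= 1 enters: (k + 1)^alpha <= k + 1, so a linear generation is enough. The extra ln 2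
    accounts for the half length. *)
Lemma cell_size_lt (r0 k : nat) : alpha <= 1 -> lambda + ln 2 < r0%:R * ln 2 ->
  2 ^- (r0 * k.+1) < interval_len lambda alpha k / 2.
Proof.
move=> alpha1 r0E.
have l2 : 0 < ln 2 :> R by rewrite ln_gt0// ltr1n.
have -> : 2 ^- (r0 * k.+1) = expR (- (r0%:R * ln 2 * k.+1%:R)) :> R.
  by rewrite expRN mulrAC -natrM expRM_natl lnK ?posrE.
have -> : interval_len lambda alpha k / 2 =
    expR (- (lambda * (k.+1%:R `^ alpha) + ln 2)).
  by rewrite opprD expRD [expR (- ln 2)]expRN lnK ?posrE.
rewrite ltr_expR ltrN2.
have p1 : k.+1%:R `^ alpha <= k.+1%:R :> R.
  by rewrite -[leRHS]powRr1// ler_powR// ler1n.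
have k1 : 1 <= k.+1%:R :> R by rewrite ler1n.
apply: (@le_lt_trans _ _ ((lambda + ln 2) * k.+1%:R)); last by rewrite ltr_pM2r// ltr0n.
by rewrite mulrDl lerD// ?ler_pM2l// ler_peMr// ltW.
Qed.

Context {d} {T : measurableType d} (P : probability T R) (c : nat -> {RV P >-> R}).

(** The lengths tend to 0, so a point of the limsup set is a limit of centres, and [0, 1] is
    closed. *)
Lemma limsup_set_unit omega :
  (forall k, 0 <= c k omega <= 1) -> limsup_set c lambda alpha omega `<=` `[0, 1].
Proof.
move=> c01 x Sx; rewrite /= in_itv/= leNgt andbC leNgt.
have near (eps : R) : 0 < eps -> exists k, `|x - c k omega| < eps.
  move=> eps0; have [m lm] := interval_len_small eps0.
  have [k /= mk] := Sx m I; rewrite in_itv/= => /andP[a b].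
  have := lm k mk; exists k; rewrite ltr_norml; apply/andP.
  have : 0 < interval_len lambda alpha k by exact: expR_gt0.
  by split; lra.
apply/andP; split; apply/negP => h.
  have [|k] := near (x - 1); first by rewrite subr_gt0.
  by have /andP[_ b] := c01 k; rewrite ltr_norml => /andP[_]; lra.
have [|k] := near (- x); first by rewrite oppr_gt0.
by have /andP[b _] := c01 k; rewrite ltr_norml => /andP[? _]; lra.
Qed.

Lemma limsup_set_near (r0 : nat) omega x :
  alpha <= 1 -> lambda + ln 2 < r0%:R * ln 2 ->
  (forall m, exists2 k, (m <= k)%N & `|x - c k omega| <= 2 ^- (r0 * k.+1)) ->
  limsup_set c lambda alpha omega x.
Proof.
move=> alpha1 r0E xn m _; have [k mk xk] := xn m; exists k => //=.
have := cell_size_lt k alpha1 r0E.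
by move: xk; rewrite in_itv/= ler_norml => /andP[a b] h; apply/andP; split; lra.
Qed.

End limsup.

(** Approximation up to every eps is enough for equal infima; nonnegative energies exclude the value
    -oo. *)
Lemma logcap_eq (R : realType) (E E' : set (R * R)) :
  E `<=` E' ->
  (forall mu, admissible E' mu -> (0 <= energy mu)%E) ->
  (forall (mu : probability (R * R)%type R) (e eps : R), admissible E' mu ->
     (energy mu <= e%:E)%E -> 0 < eps ->
     exists nu, admissible E nu /\ (energy nu <= (e + eps)%:E)%E) ->
  logcap E = logcap E'.
Proof.
move=> EE' E'0 approx; rewrite /logcap.
suff -> : ereal_inf [set energy mu | mu in [set mu | admissible E mu]] =
  ereal_inf [set energy mu | mu in [set mu | admissible E' mu]] by [].
apply/eqP; rewrite eq_le; apply/andP; split; last first.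
  apply: ereal_inf_le_tmp => _ [mu [/= cmu smu] <-]; exists mu => //; split => //.
  exact: subset_trans EE'.
apply: le_ereal_inf_tmp => _ [mu /= amu <-].
have := E'0 _ amu; case emu : (energy mu) => [e| |]// _; last exact: leey.
apply/lee_addgt0Pr => eps eps0.
have [|nu [anu enu]] := approx mu e eps amu _ eps0; first by rewrite emu.
by apply: le_trans enu; apply: ereal_inf_lbound; exists nu.
Qed.

Lemma logcap_gt0 (R : realType) (E : set (R * R)) (mu : probability (R * R)%type R) :
  admissible E mu -> (energy mu < +oo)%E -> (0 < logcap E)%E.
Proof.
move=> amu emu; rewrite /logcap.
have : (ereal_inf [set energy mu | mu in [set mu | admissible E mu]] < +oo)%E.
  by apply: le_lt_trans emu; apply: ereal_inf_lbound; exists mu.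
by case: ereal_inf => [r| |]// _; rewrite ?lte_fin ?expR_gt0 ?ltry.
Qed.

Lemma logcap_eq0 (R : realType) (E : set (R * R)) :
  (forall mu, admissible E mu -> energy mu = +oo%E) -> logcap E = 0%E.
Proof.
move=> infE; rewrite /logcap.
suff -> : ereal_inf [set energy mu | mu in [set mu | admissible E mu]] = +oo%E by [].
by apply/eqP; rewrite -leye_eq; apply: le_ereal_inf_tmp => _ [mu /= /infE -> <-].
Qed.

Lemma law_unit d (T : measurableType d) (R : realType) (P : probability T R)
  (c : nat -> {RV P >-> R}) (f : R -> R) :
  (forall (k : nat) (A : set R), measurable A ->
     P (c k @^-1` A) =
     (\int[@lebesgue_measure R]_(x in A `&` `[0%R, 1%R]) (f x)%:E)%E) ->
  {ae P, forall omega, forall k, 0 <= c k omega <= 1}.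
Proof.
move=> law; apply: ae_foralln => k.
exists (c k @^-1` ~` `[0%R, 1%R]); split.
- by rewrite -[X in measurable X]setTI; apply: measurable_funPT => //; exact: measurableC.
- have mC : measurable (~` `[0%R, 1%R] : set R) by exact: measurableC.
  by have := law k _ mC; rewrite setICl integral_set0 => h; exact: h.
- by move=> t /= h; rewrite in_itv.
Qed.

Theorem theorem1p5 (R : realType) (d : measure_display) (T : measurableType d)
  (P : probability T R) (lambda alpha : R)
  (c : nat -> {RV P >-> R}) (f : R -> R) :
  0 < lambda -> 0 < alpha ->
  mutually_independent c ->
  measurable_fun setT f ->
  (forall x, 0 <= f x) ->
  (exists M : R, forall x, f x <= M) ->
  {ae (@lebesgue_measure R), forall x, x \in `[0, 1] -> 0 < f x} ->
  (forall (k : nat) (A : set R), measurable A ->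
     P (c k @^-1` A) =
     (\int[@lebesgue_measure R]_(x in A `&` `[0%R, 1%R]) (f x)%:E)%E) ->
  ((alpha <= 1 ->
     {ae P, forall omega,
        logcap (embedR (limsup_set c lambda alpha omega))
        = logcap (embedR `[0, 1])}
     /\ (0 < logcap (embedR (`[0%R, 1%R] : set R)))%E)
   /\
   (1 < alpha -> forall omega,
        logcap (embedR (limsup_set c lambda alpha omega)) = 0%E)).
Proof.
move=> lambda0 alpha0 ind mf f0 _ fpos law; split.
- move=> alpha1.
  (* The least integer with r0 ln 2 > lambda + ln 2, as [cell_size_lt] requires. *)
  pose r0 := (Num.truncn ((lambda + ln 2) / ln 2)).+1.
  have r0E : lambda + ln 2 < r0%:R * ln 2.
    by rewrite -ltr_pdivrMr; [exact: truncnS_gt|rewrite ln_gt0// ltr1n].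
  have good : {ae P, forall omega, good_centers r0 (fun k => c k omega) /\
      forall k, 0 <= c k omega <= 1}.
    have := good_centers_ae ind mf f0 law fpos r0.
    by apply: filterS2 (law_unit law) => omega ? ?.
  have inS omega (nu : probability (R * R)%type R) : (forall k, 0 <= c k omega <= 1) -> compact (msupport nu) ->
      (forall m z, msupport nu z -> z.2 = 0 /\ exists2 k, (m <= k)%N &
         0 <= c k omega /\ `|z.1 - c k omega| <= 2 ^- (r0 * k.+1)) ->
      admissible (embedR (limsup_set c lambda alpha omega)) nu.
    move=> c01 cnu snu; split => // z zS.
    split; first by have [] := snu 0%N z zS.
    apply: (limsup_set_near lambda0 alpha1 r0E) => m.
    by have [_ [k mk [_ zk]]] := snu m z zS; exists k.
  have sub omega : (forall k, 0 <= c k omega <= 1) ->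
      embedR (limsup_set c lambda alpha omega) `<=` embedR `[0, 1].
    by move=> c01 z [z2 /(limsup_set_unit lambda0 alpha0 c01)].
  split.
    apply: filterS good => omega [good c01]; apply: logcap_eq; first exact: sub.
      by move=> mu [_ smu]; exact: energy_ge0.
    move=> mu e eps [cmu smu] emu eps0.
    have [nu [cnu enu snu]] := approximate_measure (ltn0Sn _ : (0 < r0)%N) good smu emu eps0.
    by exists nu; split => //; exact: inS.
  (* The capacity of [0, 1] is deterministic: a single good omega, which exists because the
     exceptional set is null, provides a measure of finite energy. *)
  have [omega [gomega c01]] : exists omega, good_centers r0 (fun k => c k omega) /\
      forall k, 0 <= c k omega <= 1.
    apply: contrapT => noomega; have [N [mN N0 sN]] := good.
    have NT : N = setT.
      by apply/seteqP; split => // omega _; apply: sN => h; apply: noomega; exists omega.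
    by have := probability_setT P; rewrite -NT N0 => /eqP; rewrite eq_sym onee_eq0.
  have [nu [cnu enu snu]] := finite_energy_measure (ltn0Sn _ : (0 < r0)%N) gomega.
  apply: logcap_gt0 enu; split => //.
  by have [_ snuS] := inS omega nu c01 cnu snu; exact: subset_trans (sub _ c01).
(* Only the lengths of the intervals matter here, so the conclusion holds for every omega. *)
- move=> alpha1 omega; apply: logcap_eq0 => mu.
  apply: (@energy_limsup _ (fun k => c k omega) (interval_len lambda alpha)
    (fun k => lambda * k.+1%:R `^ alpha)) => //.
  + by move=> k; rewrite mulr_gt0// powR_gt0.
  + have [B HB] := riemann_bounded alpha1; exists (lambda^-1 * B) => n.
    under eq_bigr do rewrite invfM.
    by rewrite -mulr_sumr ler_wpM2l// invr_ge0 ltW.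
  + by move=> m x; exact.
Qed.
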